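(* Let $\lambda\in X$ be a dominant integral weight of $\mathfrak g$ and let $\Pi:\mathcal A(\lambda)\to\mathrm{QLS}(-w_\circ\lambda)$ be the forgetful map from the quantum alcove model (based on a lexicographic $\lambda$-chain) to quantum Lakshmibai-Seshadri paths of shape $-w_\circ\lambda$. Let $p\in I_{\rm af}$, let $e_p$ be the root operator (and $\varepsilon_p$ the corresponding string function) on QLS paths, and let $f_p$ be the root operator in the quantum alcove model. Given $A\in\mathcal A(\lambda)$, we have $f_p(A)\neq\mathbf 0$ if and only if $\varepsilon_p(\Pi(A))>\delta_{p,0}$; in this case, $$e_p(\Pi(A))=\Pi(f_p(A)).$$
   Context: Root data. $\mathfrak g_{\rm af}$ is an untwisted affine Lie algebra with Dynkin index set $I_{\rm af}=I\sqcup\{0\}$, $\mathfrak g$ its finite-dimensional simple subalgebra with index set $I$, simple roots $\alpha_i$, coroots $\alpha_i^\vee$, roots $\Phi=\Phi^+\sqcup\Phi^-$, highest root $\theta$, Weyl group $W$ with reflections $r_\alpha$, length $\ell$, longest element $w_\circ$, weight lattice $X$, $\rho=\frac12\sum_{\alpha\in\Phi^+}\alpha$; $\langle\cdot,\cdot\rangle$ pairs coroots with weights. For a dominant weight $\mu$ with $K=\{i\in I:\langle\alpha_i^\vee,\mu\rangle=0\}$: $W_K$ is the parabolic subgroup, $W^K$ the minimal-length representatives of $W/W_K$, $\lfloor w\rfloor^K$ the minimal representative of $wW_K$, $\Phi_K^+$ the positive roots in the span of $\alpha_j$ ($j\in K$), $\rho_K=\frac12\sum_{\alpha\in\Phi_K^+}\alpha$.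 $J=\{i\in I:\langle\alpha_i^\vee,\lambda\rangle=0\}$; $\omega:I\to I$ is defined by $w_\circ\alpha_j=-\alpha_{\omega(j)}$, so $\omega(J)$ is the corresponding set for $-w_\circ\lambda$. Quantum Bruhat graphs: $\mathrm{QB}(W^K)$ has vertex set $W^K$ and edges $w\xrightarrow{\alpha}\lfloor wr_\alpha\rfloor^K$, $\alpha\in\Phi^+\setminus\Phi_K^+$, with either $\ell(wr_\alpha)=\ell(w)+1$ (Bruhat edge) or $\ell(\lfloor wr_\alpha\rfloor^K)=\ell(w)+1-\langle\alpha^\vee,2\rho-2\rho_K\rangle$ (quantum edge); $\mathrm{QB}(W)$ is the case $K=\emptyset$. $\mathrm{QB}_{b\mu}(W^K)$ ($b\in\mathbb Q$) is the subgraph with only the edges with $b\langle\alpha^\vee,\mu\rangle\in\mathbb Z$. QLS paths: $\mathrm{QLS}(\mu)$ is the set of $\eta=(x_1,\dots,x_s;b_0,\dots,b_s)$ with $x_k\in W^K$, $x_k\ne x_{k+1}$, rationals $0=b_0<\cdots<b_s=1$, such that there is a directed path from $x_{k+1}$ to $x_k$ in $\mathrm{QB}_{b_k\mu}(W^K)$ for $1\le k\le s-1$; $\eta$ is identified with the piecewise-linear path $[0,1]\to\mathbb R\otimes X$ from $0$ with direction $x_k\mu$ on $[b_{k-1},b_k]$. Put $\tilde\alpha_j=\alpha_j$, $s_j=r_j$ for $j\in I$, and $\tilde\alpha_0=-\theta$, $s_0=r_\theta$. Root operator: with $H(t)=\langle\tilde\alpha_j^\vee,\eta(t)\rangle$ and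 $m=\min_{[0,1]}H$ (an integer $\le 0$), $e_j\eta=\mathbf0$ if $m=0$; otherwise with $t_1=\min\{t:H(t)=m\}$, $t_0=\max\{t\le t_1:H(t)=m+1\}$, $e_j\eta$ is $\eta(t)$ on $[0,t_0]$, $\eta(t_0)+s_j(\eta(t)-\eta(t_0))$ on $[t_0,t_1]$, $\eta(t)+\tilde\alpha_j$ on $[t_1,1]$; it lies again in $\mathrm{QLS}(\mu)$. $\varepsilon_j(\eta)=\max\{n\ge0:e_j^n\eta\neq\mathbf0\}$. Quantum alcove model: fix a total order $I=\{1<\cdots<r\}$. The $\lambda$-hyperplanes are $H_{\beta,-l}=\{\mu:\langle\beta^\vee,\mu\rangle=-l\}$, $\beta\in\Phi^+$, $0\le l<\langle\beta^\vee,\lambda\rangle$; ordering them by the lexicographic order on $\frac1{\langle\beta^\vee,\lambda\rangle}(l,c_1,\dots,c_r)$, where $\beta^\vee=\sum c_i\alpha_i^\vee$, gives $H_{\beta_1,-l_1},\dots,H_{\beta_m,-l_m}$ (lex $\lambda$-chain). $\mathcal A(\lambda)$ is the set of (possibly empty) subsets $A=\{j_1<\cdots<j_s\}\subseteq[m]=\{1,\dots,m\}$ such that $e\xrightarrow{\beta_{j_1}}r_{\beta_{j_1}}\xrightarrow{\beta_{j_2}}\cdots\xrightarrow{\beta_{j_s}}r_{\beta_{j_1}}\cdots r_{\beta_{j_s}}$ is a directed path in $\mathrm{QB}(W)$. With $r_{\beta,l}$ the affine reflection in $H_{\beta,l}$, $\mathrm{wt}(A)=-r_{\beta_{j_1},-l_{j_1}}\cdots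 r_{\beta_{j_s},-l_{j_s}}(-\lambda)$. Root operators on $\mathcal A(\lambda)$: for $i\in[m]$ let $j_k$ be the largest element of $A$ less than $i$; $\gamma_i=r_{\beta_{j_1}}\cdots r_{\beta_{j_k}}(\beta_i)$, and $l_i^A$ is defined by $H_{|\gamma_i|,-l_i^A}=r_{\beta_{j_1},-l_{j_1}}\cdots r_{\beta_{j_k},-l_{j_k}}(H_{\beta_i,-l_i})$, where $|\gamma|=\mathrm{sgn}(\gamma)\gamma\in\Phi^+$. Let $\alpha=\tilde\alpha_p$, $I_\alpha=\{i\in[m]:\gamma_i=\pm\alpha\}$, $\widehat I_\alpha=I_\alpha\cup\{\infty\}$ (with $\infty$ the largest element), $l_\infty^A:=\langle\mathrm{sgn}(\alpha)\alpha^\vee,\mathrm{wt}(A)\rangle$, $M=\max\{\mathrm{sgn}(\alpha)l_i^A:i\in\widehat I_\alpha\}$. If $M>\delta_{p,0}$, let $\ell$ be the minimum $i\in\widehat I_\alpha$ with $\mathrm{sgn}(\alpha)l_i^A=M$ and $k$ the predecessor of $\ell$ in $\widehat I_\alpha$ (it exists), and put $f_p(A)=(A\setminus\{\ell\})\cup\{k\}$ (with $A\setminus\{\infty\}=A$); otherwise $f_p(A)=\mathbf 0$. One has $f_p(A)\in\mathcal A(\lambda)$ when nonzero. The map $\Pi$: put $t_i=l_i/\langle\beta_i^\vee,\lambda\rangle$. For $A=\{j_1<\cdots<j_s\}\in\mathcal A(\lambda)$ write $\{t_{j_1}\le\cdots\le t_{j_s}\}\cup\{0\}=\{0=b_0<b_1<\cdots<b_p\}$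 as a set, let $0=n_0\le n_1<\cdots<n_{p+1}=s$ be such that $t_{j_h}=b_k$ iff $n_k<h\le n_{k+1}$, and let $w_k=r_{\beta_{j_1}}r_{\beta_{j_2}}\cdots r_{\beta_{j_{n_{k+1}}}}$, $k=0,\dots,p$. Then $\Pi(A)=(\lfloor w_0w_\circ\rfloor^{\omega(J)},\lfloor w_1w_\circ\rfloor^{\omega(J)},\dots,\lfloor w_pw_\circ\rfloor^{\omega(J)};\,b_0,b_1,\dots,b_p,1)\in\mathrm{QLS}(-w_\circ\lambda)$. *)

(* Defs.v *)
From HB Require Import structures.
From mathcomp Require Import all_boot all_order all_algebra.
From mathcomp Require Import boolp classical_sets reals.

Set Implicit Arguments.
Unset Strict Implicit.
Unset Printing Implicit Defensive.

Import Order.TTheory GRing.Theory Num.Theory.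

Local Open Scope classical_set_scope.
Local Open Scope ring_scope.

(* The minimum / maximum of a set, with an irrelevant default when none exists. *)
Definition set_min d (T : porderType d) (x0 : T) (S : set T) : T :=
  xget x0 (S `&` lbound S).
Definition set_max d (T : porderType d) (x0 : T) (S : set T) : T :=
  xget x0 (S `&` ubound S).

Section Euclidean.
Variables (R : realType) (r : nat).
Implicit Types (a b v : 'cV[R]_r).

Definition dot a b : R := (a^T *m b) 0 0.

Definition coroot a : 'cV[R]_r := (2 / dot a a) *: a.

(* <a^vee, v> *)
Definition pairing a v : R := dot (coroot a) v.

(* v |-> v - <a^vee, v> a *)
Definition refl a : 'M[R]_r := 1%:M - a *m (coroot a)^T.

Definition refl_prod (s : seq 'cV[R]_r) : 'M[R]_r :=
  foldr (fun a w => refl a *m w) 1%:M s.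

Definition hyperplane a (l : R) : set 'cV[R]_r := [set v | pairing a v = l].

Definition aff_refl a (l : R) v : 'cV[R]_r := v - (pairing a v - l) *: a.

(* Coordinates of v in the family e, when e is a basis. *)
Definition coords (e : 'I_r -> 'cV[R]_r) v : 'cV[R]_r :=
  invmx (\matrix_(i, j) e j i 0) *m v.

End Euclidean.

(* The root system of a finite-dimensional simple Lie algebra g of rank r: an
   irreducible reduced crystallographic root system in Euclidean R^r, with a
   base indexed by I = 'I_r.  The chosen total order on I is the order of 'I_r,
   and the indexing of the base is arbitrary. *)
Record root_system (R : realType) (r : nat) := RootSystem {
  roots : seq 'cV[R]_r;
  simple : 'I_r -> 'cV[R]_r;
  rank_gt0 : (0 < r)%N;
  roots_uniq : uniq roots;
  roots_neq0 : 0 \notin roots;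
  roots_refl : forall a b, a \in roots -> b \in roots ->
    refl a *m b \in roots;
  roots_int : forall a b, a \in roots -> b \in roots ->
    pairing a b \is a Num.int;
  roots_reduced : forall a (c : R), a \in roots -> c *: a \in roots ->
    c = 1 \/ c = -1;
  roots_irreducible : forall P : pred 'cV[R]_r,
    has P roots -> has (predC P) roots ->
    exists a b, [/\ a \in roots, b \in roots, P a, ~~ P b & dot a b != 0];
  simple_root : forall i, simple i \in roots;
  simple_basis : (\matrix_(i, j) simple j i 0) \in unitmx;
  simple_sign : forall a, a \in roots ->
    (forall i, coords simple a i 0 \is a Num.nat) \/
    (forall i, - coords simple a i 0 \is a Num.nat)
}.

(* I_af = I + {0}, with None standing for the affine index 0. *)
Definition affine_index (r : nat) := option 'I_r.

Definition delta0 r (p : affine_index r) : nat := (p == None).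

(* Paths [0, 1] -> R (x) X, extended to all of R by constants. *)
Definition vpath (R : realType) (r : nat) := R -> 'cV[R]_r.

Section RootSystem.
Variables (R : realType) (r : nat) (D : root_system R r).
Implicit Types (a b v mu : 'cV[R]_r) (w x : 'M[R]_r) (K : {set 'I_r}).

Definition pos_root a : bool :=
  (a \in roots D) && [forall i, 0 <= coords (simple D) a i 0].

(* Phi_K^+ *)
Definition pos_root_in K a : bool :=
  pos_root a && [forall i, (i \notin K) ==> (coords (simple D) a i 0 == 0)].

Definition sgn_root a : R := if pos_root a then 1 else -1.

Definition abs_root a : 'cV[R]_r := sgn_root a *: a.

Definition rho K : 'cV[R]_r :=
  2^-1 *: (\sum_(a <- roots D | pos_root_in K a) a).

Definition theta : 'cV[R]_r :=
  xget 0 [set t | t \in roots D /\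
    forall b, b \in roots D ->
      forall i, coords (simple D) b i 0 <= coords (simple D) t i 0].

Definition simple_prod (s : seq 'I_r) : 'M[R]_r :=
  refl_prod [seq simple D i | i <- s].

(* W_K; the Weyl group W itself is the case K = I. *)
Definition weyl K : set 'M[R]_r :=
  [set w | exists2 s : seq 'I_r, all (mem K) s & w = simple_prod s].

Definition len w : nat :=
  set_min 0%N [set n | exists2 s : seq 'I_r, size s = n & w = simple_prod s].

Definition longest : 'M[R]_r :=
  xget 1%:M [set w | weyl [set: 'I_r]%SET w /\
    forall x, weyl [set: 'I_r]%SET x -> (len x <= len w)%N].

Definition weyl_coset K w : set 'M[R]_r := [set w *m u | u in weyl K].

(* x has minimal length in w W_K *)
Definition min_in_coset K w x : Prop :=
  weyl_coset K w x /\ forall y, weyl_coset K w y -> (len x <= len y)%N.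

(* W^K *)
Definition min_reps K : set 'M[R]_r :=
  [set x | weyl [set: 'I_r]%SET x /\ min_in_coset K x x].

Definition min_rep K w : 'M[R]_r := xget 1%:M (min_in_coset K w).

(* The edges of QB(W^K). *)
Definition bruhat_edge w a : Prop := len (w *m refl a) = (len w).+1.

Definition quantum_edge K w a : Prop :=
  (len (min_rep K (w *m refl a)))%:R =
  (len w)%:R + 1 - pairing a (2 *: rho [set: 'I_r]%SET - 2 *: rho K).

Definition qb_edge K a w x : Prop :=
  [/\ min_reps K w, pos_root a && ~~ pos_root_in K a,
      x = min_rep K (w *m refl a) &
      bruhat_edge w a \/ quantum_edge K w a].

(* In QB(W) = QB(W^set0), s is the sequence of labels of a directed path
   w -> w r_(s_1) -> w r_(s_1) r_(s_2) -> ... *)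
Fixpoint qb_path w (s : seq 'cV[R]_r) : Prop :=
  if s is a :: s' then
    qb_edge finset.set0 a w (w *m refl a) /\ qb_path (w *m refl a) s'
  else True.

Definition stab_index mu : {set 'I_r} :=
  [set i | pairing (simple D i) mu == 0]%SET.

(* w_o alpha_j = - alpha_(omega j) *)
Definition omega (j : 'I_r) : 'I_r :=
  odflt j [pick i | longest *m simple D j == - simple D i].

Definition dominant_integral mu : Prop :=
  forall i, pairing (simple D i) mu \is a Num.nat.

Definition affine_root (p : affine_index r) : 'cV[R]_r :=
  if p is Some j then simple D j else - theta.

Definition affine_refl (p : affine_index r) : 'M[R]_r :=
  if p is Some j then refl (simple D j) else refl theta.

(* The sequence eta = (x_1, ..., x_s; b_0, ..., b_s) as a pair, and the path of
   shape mu it stands for: its direction is x_k mu on [b_(k-1), b_k]. *)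
Definition path_data : Type := (seq 'M[R]_r * seq R)%type.

Definition path_of mu (eta : path_data) : vpath R r := fun t =>
  \sum_(k < size eta.1)
    (Num.min t (nth 0 eta.2 k.+1) - Num.min t (nth 0 eta.2 k)) *:
      (nth 1%:M eta.1 k *m mu).

(* Root operators: None is the formal symbol 0.  QLS(mu) is a set of paths
   stable under them; the formulas make sense for any path. *)
Definition height (p : affine_index r) (eta : vpath R r) (t : R) : R :=
  pairing (affine_root p) (eta t).

Definition height_min p (eta : vpath R r) : R :=
  set_min 0 [set height p eta t | t in [set t | 0 <= t <= 1]].

Definition e_t1 p (eta : vpath R r) : R :=
  set_min 0 [set t | 0 <= t <= 1 /\ height p eta t = height_min p eta].

Definition e_t0 p (eta : vpath R r) : R :=
  set_max 0 [set t | 0 <= t <= e_t1 p eta /\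
                     height p eta t = height_min p eta + 1].

Definition e_op p (eta : vpath R r) : option (vpath R r) :=
  if height_min p eta == 0 then None else
  Some (fun t =>
    if t <= e_t0 p eta then eta t
    else if t <= e_t1 p eta then
      eta (e_t0 p eta) + affine_refl p *m (eta t - eta (e_t0 p eta))
    else eta t + affine_root p).

Definition epsilon p (eta : vpath R r) : nat :=
  set_max 0%N [set n | iter n (obind (e_op p)) (Some eta) <> None].

Section AlcoveModel.
Variable lambda : 'cV[R]_r.

(* (l, c_1, ..., c_r) / <b^vee, lambda>, where b^vee = \sum_i c_i alpha_i^vee;
   seqlexi carries the lexicographic order. *)
Definition lex_key (h : 'cV[R]_r * nat) : seqlexi R :=
  [seq y / pairing h.1 lambda |
    y <- h.2%:R :: [seq coords (fun j => coroot (simple D j)) (coroot h.1) i 0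
                   | i <- enum 'I_r]].

(* The lex lambda-chain; (b, l) stands for H_(b, -l), with 0 <= l < <b^vee,
   lambda>, a natural number when lambda is dominant integral. *)
Definition lambda_chain : seq ('cV[R]_r * nat) :=
  sort (fun h h' => (lex_key h <= lex_key h')%O)
    [seq (b, l) | b <- [seq a <- roots D | pos_root a],
                  l <- iota 0 (Num.truncn (pairing b lambda))].

Local Notation m := (size lambda_chain).
Implicit Types (A : {set 'I_m}) (i j : 'I_m).

Definition beta i : 'cV[R]_r := (tnth (in_tuple lambda_chain) i).1.
Definition level i : nat := (tnth (in_tuple lambda_chain) i).2.

(* A(lambda); enum A lists A increasingly. *)
Definition admissible A : Prop := qb_path 1%:M [seq beta j | j <- enum A].

(* r_(beta_(j_1), -l_(j_1)) ... r_(beta_(j_k), -l_(j_k)) applied to v *)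
Definition aff_prod (s : seq 'I_m) v : 'cV[R]_r :=
  foldr (fun j => aff_refl (beta j) (- (level j)%:R)) v s.

Definition wt A : 'cV[R]_r := - aff_prod (enum A) (- lambda).

Definition before A i : seq 'I_m := [seq j : 'I_m <- enum A | (j < i)%N].

Definition gamma A i : 'cV[R]_r :=
  refl_prod [seq beta j | j <- before A i] *m beta i.

(* l_i^A *)
Definition folded_level A i : int :=
  xget 0 [set l : int | hyperplane (abs_root (gamma A i)) (- l%:~R) =
    [set aff_prod (before A i) v | v in hyperplane (beta i) (- (level i)%:R)]].

Section AlcoveRootOperator.
Variables (p : affine_index r) (A : {set 'I_m}).
Let alpha := affine_root p.

Definition I_alpha : {set 'I_m} :=
  [set i | (gamma A i == alpha) || (gamma A i == - alpha)]%SET.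

(* The set I_alpha + {infinity}, listed increasingly; None is infinity. *)
Definition I_hat : seq (option 'I_m) := rcons [seq Some i | i <- enum I_alpha] None.

(* sgn(alpha) l_i^A, for i in I_hat *)
Definition signed_level (i : option 'I_m) : R :=
  sgn_root alpha *
    (if i is Some i' then (folded_level A i')%:~R
     else sgn_root alpha * pairing alpha (wt A)).

Definition max_level : R :=
  \big[Num.max/signed_level None]_(h <- I_hat) signed_level h.

Definition f_op : option {set 'I_m} :=
  if (delta0 p)%:R < max_level then
    let pos := find (fun h => signed_level h == max_level) I_hat in
    let A' := if nth None I_hat pos is Some l then (A :\ l)%SET else A in
    Some (if nth None I_hat pos.-1 is Some k then (k |: A')%SET else A')
  else None.

End AlcoveRootOperator.

Definition rel_level i : R := (level i)%:R / pairing (beta i) lambda.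

(* [:: b_0; ...; b_p] *)
Definition breaks A : seq R :=
  sort <=%O (undup (0 :: [seq rel_level j | j <- enum A])).

(* w_k for t = b_k: the rel_level j are nondecreasing in j, so that the j in A
   with rel_level j <= b_k are j_1, ..., j_(n_(k+1)). *)
Definition break_elt A (t : R) : 'M[R]_r :=
  refl_prod [seq beta j | j <- enum A & rel_level j <= t].

Definition Pi_data A : path_data :=
  ([seq min_rep (omega @: stab_index lambda)%SET (break_elt A t *m longest)
   | t <- breaks A],
   rcons (breaks A) 1).

Definition Pi A : vpath R r := path_of (- (longest *m lambda)) (Pi_data A).

End AlcoveModel.
End RootSystem.

(* Main.v *)
Require Import Defs.
From mathcomp Require Import all_boot all_order all_algebra.
From mathcomp Require Import boolp classical_sets reals.
From mathcomp Require Import ring lra zify.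

(* Proof idea.  Let [U_q] be the product of the reflections in the roots
   [beta j], [j] in [A], [j < q].  The path [Pi A] is the straight path
   [- t lambda] folded at the hyperplanes indexed by [A], so the function
   [H t = <alpha^vee, Pi A t>] is affine between consecutive relative levels,
   with slope of the sign opposite to that of [U_q^-1 alpha], and the signed
   levels of the alcove model are the values of [- H] at the positions of
   [I_alpha] and at infinity.  Along a quantum Bruhat path [U_q^-1 alpha] turns
   from positive to negative only by a reflection in [U_q^-1 alpha] itself, that
   is at a position of [I_alpha]; hence [H] has its local minima at these
   positions, and they are integral.  This gives the minimum of [H], and
   [epsilon] is its opposite.
   Starting instead from a generic point of the fundamental alcove separates the
   crossings, in the lexicographic order.  Comparing the strip of [alpha] in which
   the perturbed path lies with the sign of [U_q^-1 alpha] shows that the two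
   positions exchanged by [f_op] are consecutive visits to the levels
   [min H + 1] and [min H], that [A] folds at the second but not at the first, and
   that [H] descends in between.  Exchanging the folds therefore reflects this part
   of the path and translates the rest by [alpha]; where it does so at other times
   than [e_op], [H] is constant and the two paths agree. *)

Set Implicit Arguments.
Unset Strict Implicit.
Unset Printing Implicit Defensive.

Import Order.TTheory GRing.Theory Num.Theory.

Local Open Scope ring_scope.

(** * Reflections in Euclidean space *)

(** The bound [delta0 p] comes from the strip in which the path starts: a point of the fundamental
    alcove pairs with a simple coroot in ]0, 1[, but with the coroot of [- theta] in ]-1, 0[. A
    minimal level below [- delta0 p] therefore forces an earlier visit to a hyperplane of [alpha],
    and this visit is what [f_op] exchanges with. Descent is read off the sign of a root, not off a
    slope, because a singular [lambda] makes slopes vanish. Positions of equal relative level share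
    one time of [Pi A], so the path alone does not show their order. Hence two timetables:
    [break_pt], with repetitions, for the path, and [cross_pt], strict, for the order. The sign rule
    is a length count: for [p] in [I] only a Bruhat edge can make the root negative, for [p = 0]
    only a quantum edge. The iterates of [e_op] are not followed inside QLS paths. Instead
    [integral_valleys] is a class of functions that contains [Pi A] for admissible [A] and is stable
    under [e_op], each application raising the minimum by one. *)

Section Dot.
Variables (R : realType) (r : nat).
Implicit Types (a b v w : 'cV[R]_r) (x y : 'M[R]_r).

Lemma dotE a b : dot a b = \sum_i a i 0 * b i 0.
Proof. by rewrite /dot mxE; apply: eq_bigr => i _; rewrite mxE. Qed.

Lemma dotC a b : dot a b = dot b a.
Proof. by rewrite !dotE; apply: eq_bigr => i _; rewrite mulrC. Qed.

Lemma dotDr a v w : dot a (v + w) = dot a v + dot a w.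
Proof. by rewrite /dot mulmxDr mxE. Qed.

Lemma dotZr a (c : R) v : dot a (c *: v) = c * dot a v.
Proof. by rewrite /dot -scalemxAr mxE. Qed.

Lemma dotNr a v : dot a (- v) = - dot a v.
Proof. by rewrite -scaleN1r dotZr mulN1r. Qed.

Lemma dotZl a (c : R) v : dot (c *: a) v = c * dot a v.
Proof. by rewrite dotC dotZr dotC. Qed.

Lemma dotDl a b v : dot (a + b) v = dot a v + dot b v.
Proof. by rewrite !(dotC _ v) dotDr. Qed.

Lemma dotNl a v : dot (- a) v = - dot a v.
Proof. by rewrite dotC dotNr dotC. Qed.

Lemma dot_sumr a (I : Type) (s : seq I) (P : pred I) (F : I -> 'cV[R]_r) :
  dot a (\sum_(i <- s | P i) F i) = \sum_(i <- s | P i) dot a (F i).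
Proof.
elim/big_rec2: _ => [|i x y _ <-]; last by rewrite dotDr.
by rewrite -(scale0r a) dotZr mul0r.
Qed.

Lemma dot_ge0 a : 0 <= dot a a.
Proof. by rewrite dotE sumr_ge0 // => i _; rewrite -expr2 sqr_ge0. Qed.

Lemma dot_gt0 a : a != 0 -> 0 < dot a a.
Proof.
move=> a0; rewrite lt_def dot_ge0 andbT; apply: contraNneq a0.
rewrite dotE => /eqP; rewrite psumr_eq0 => [/allP a0|i _]; last first.
  by rewrite -expr2 sqr_ge0.
apply/eqP/colP => i; rewrite mxE.
have := a0 i; rewrite mem_index_enum => /(_ isT).
by rewrite mulf_eq0 orbb => /eqP.
Qed.

Lemma dot_mulmxl x a v : dot (x *m a) v = dot a (x^T *m v).
Proof. by rewrite /dot trmx_mul mulmxA. Qed.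

Lemma pairingE a v : pairing a v = 2 / dot a a * dot a v.
Proof. by rewrite /pairing /coroot dotZl. Qed.

Lemma pairingDr a v w : pairing a (v + w) = pairing a v + pairing a w.
Proof. exact: dotDr. Qed.

Lemma pairingZr a (c : R) v : pairing a (c *: v) = c * pairing a v.
Proof. exact: dotZr. Qed.

Lemma pairingNr a v : pairing a (- v) = - pairing a v.
Proof. exact: dotNr. Qed.

Lemma pairingBr a v w : pairing a (v - w) = pairing a v - pairing a w.
Proof. by rewrite pairingDr pairingNr. Qed.

Lemma pairing0r a : pairing a 0 = 0.
Proof. by rewrite -(scale0r a) pairingZr mul0r. Qed.

Lemma pairing_sumr a (I : Type) (s : seq I) (P : pred I) (F : I -> 'cV[R]_r) :
  pairing a (\sum_(i <- s | P i) F i) = \sum_(i <- s | P i) pairing a (F i).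
Proof. exact: dot_sumr. Qed.

Lemma corootN a : coroot (- a) = - coroot a.
Proof. by rewrite /coroot dotNl dotNr opprK scalerN. Qed.

Lemma pairingNl a v : pairing (- a) v = - pairing a v.
Proof. by rewrite /pairing corootN dotNl. Qed.

Lemma pairing_self a : a != 0 -> pairing a a = 2.
Proof. by move=> /dot_gt0 a0; rewrite pairingE divfK // gt_eqF. Qed.

Lemma reflE a v : refl a *m v = v - pairing a v *: a.
Proof.
rewrite /refl mulmxBl mul1mx -mulmxA /pairing /dot; congr (_ - _).
by rewrite -mul_mx_scalar -mx11_scalar.
Qed.

Lemma refl_tr a : (refl a)^T = refl a.
Proof.
rewrite /refl /coroot linearB /= trmx1 trmx_mul trmxK linearZ /=.
by rewrite -scalemxAl -scalemxAr.
Qed.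

Lemma eq_mulmxc x y : (forall v : 'cV[R]_r, x *m v = y *m v) -> x = y.
Proof.
move=> xy; apply/matrixP => i j; have /colP/(_ i) := xy (delta_mx j 0).
by rewrite -!colE !mxE.
Qed.

Lemma reflN a : refl (- a) = refl a.
Proof. by rewrite /refl corootN raddfN /= mulNmx mulmxN opprK. Qed.

Lemma refl_self a : refl a *m a = - a.
Proof.
have [->|a0] := eqVneq a 0; first by rewrite mulmx0 oppr0.
by rewrite reflE pairing_self // scalerDl scale1r opprD addrA subrr sub0r.
Qed.

Lemma reflK a : refl a *m refl a = 1%:M.
Proof.
apply: eq_mulmxc => v; rewrite mul1mx -mulmxA !reflE.
rewrite pairingBr pairingZr.
have [->|a0] := eqVneq a 0; first by rewrite !scaler0 !subr0.
rewrite pairing_self // -addrA -opprD -scalerDl mulr_natr mulr2n opprD addNKr.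
by rewrite subrr ?scale0r subr0.
Qed.

Definition orth x := x^T *m x = 1%:M.

Lemma orthV x : orth x -> x *m x^T = 1%:M.
Proof. exact: mulmx1C. Qed.

Lemma orth_refl a : orth (refl a).
Proof. by rewrite /orth refl_tr reflK. Qed.

Lemma orth1 : orth 1%:M.
Proof. by rewrite /orth trmx1 mulmx1. Qed.

Lemma orthM x y : orth x -> orth y -> orth (x *m y).
Proof.
by move=> ox oy; rewrite /orth trmx_mul mulmxA -(mulmxA y^T) ox mulmx1.
Qed.

Lemma orth_tr x : orth x -> orth x^T.
Proof. by move=> /orthV ox; rewrite /orth trmxK. Qed.

Lemma orthKl x v : orth x -> x^T *m (x *m v) = v.
Proof. by move=> ox; rewrite mulmxA ox mul1mx. Qed.

Lemma orthKr x v : orth x -> x *m (x^T *m v) = v.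
Proof. by move=> /orthV ox; rewrite mulmxA ox mul1mx. Qed.

Lemma orth_inj x : orth x -> injective (mulmx x : 'cV[R]_r -> _).
Proof. by move=> ox v w /(congr1 (mulmx x^T)); rewrite !orthKl. Qed.

Lemma dot_orth x a v : orth x -> dot (x *m a) (x *m v) = dot a v.
Proof. by move=> ox; rewrite dot_mulmxl orthKl. Qed.

Lemma pairing_orth x a v : orth x -> pairing (x *m a) (x *m v) = pairing a v.
Proof. by move=> ox; rewrite !pairingE !dot_orth. Qed.

Lemma pairing_mulmxl x a v :
  orth x -> pairing (x *m a) v = pairing a (x^T *m v).
Proof. by move=> ox; rewrite -[in LHS](orthKr v ox) pairing_orth. Qed.

Lemma refl_orth x a : orth x -> refl (x *m a) *m x = x *m refl a.
Proof.
move=> ox; apply: eq_mulmxc => v; rewrite -!mulmxA !reflE pairing_orth //.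
by rewrite mulmxBr -scalemxAr.
Qed.

Lemma pairing_refll a b v :
  pairing (refl b *m a) v = pairing a v - pairing b v * pairing a b.
Proof.
rewrite pairing_mulmxl; last exact: orth_refl.
by rewrite refl_tr reflE pairingBr pairingZr.
Qed.

End Dot.

(** * Roots, words and the length function *)

Section SetMin.
Variables (d : Order.disp_t) (T : porderType d).
Implicit Types (S : set T) (x : T).

Lemma set_minE x0 S x : S x -> (forall y, S y -> (x <= y)%O) ->
  set_min x0 S = x.
Proof.
move=> Sx lbx; rewrite /set_min; case: xgetP => [y _ [Sy lby]|/(_ x)[]//].
by apply: le_anti; rewrite lbx // andbT; apply: lby.
Qed.

Lemma set_maxE x0 S x : S x -> (forall y, S y -> (y <= x)%O) ->
  set_max x0 S = x.
Proof.
move=> Sx ubx; rewrite /set_max; case: xgetP => [y _ [Sy uby]|/(_ x)[]//].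
by apply: le_anti; rewrite ubx //=; apply: uby.
Qed.

End SetMin.

Lemma nat_has_min (S : set nat) n : S n ->
  exists2 k, S k & forall j, S j -> (k <= j)%N.
Proof.
move=> Sn; have ex : exists k, `[< S k >] by exists n; apply/asboolP.
exists (ex_minn ex); first by case: ex_minnP => k /asboolP.
by case: ex_minnP => k _ kmin j Sj; apply: kmin; apply/asboolP.
Qed.

Section Roots.
Variables (R : realType) (r : nat) (D : root_system R r).
Implicit Types (a b v mu : 'cV[R]_r) (w x : 'M[R]_r) (i j : 'I_r).
Implicit Types (s : seq 'I_r).
Local Notation pos := (pos_root D).
Local Notation co := (coords (simple D)).
Local Notation rts := (Defs.roots D).
Local Notation sp := (simple_prod D).

Lemma coordsD a b i : co (a + b) i 0 = co a i 0 + co b i 0.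
Proof. by rewrite /coords mulmxDr mxE. Qed.

Lemma coordsZ (c : R) a i : co (c *: a) i 0 = c * co a i 0.
Proof. by rewrite /coords -scalemxAr mxE. Qed.

Lemma coordsN a i : co (- a) i 0 = - co a i 0.
Proof. by rewrite -scaleN1r coordsZ mulN1r. Qed.

Lemma coordsB a b i : co (a - b) i 0 = co a i 0 - co b i 0.
Proof. by rewrite coordsD coordsN. Qed.

Lemma coords_basis_sum (e : 'I_r -> 'cV[R]_r) v :
  (\matrix_(i, j) e j i 0) \in unitmx -> v = \sum_i coords e v i 0 *: e i.
Proof.
move=> eu; rewrite -[LHS]mul1mx -(mulmxV eu) -mulmxA.
apply/colP => k; rewrite mxE summxE; apply: eq_bigr => i _.
by rewrite !mxE mulrC; congr (_ * _); rewrite /coords mxE.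
Qed.

Lemma coords_sum v : v = \sum_i co v i 0 *: simple D i.
Proof. exact/coords_basis_sum/simple_basis. Qed.

Lemma coords_inj a b : (forall i, co a i 0 = co b i 0) -> a = b.
Proof.
by move=> ab; rewrite [a]coords_sum [b]coords_sum; apply: eq_bigr => i _; rewrite ab.
Qed.

Lemma coords_simple i j : co (simple D j) i 0 = (i == j)%:R.
Proof.
rewrite /coords; set S := (\matrix_(_, _) _).
have -> : simple D j = col j S.
  by apply/colP => k; rewrite !mxE.
by rewrite colE mulmxA mulVmx ?simple_basis // mul1mx mxE eqxx andbT.
Qed.

Lemma dot_coords a v : dot a v = \sum_i co a i 0 * dot (simple D i) v.
Proof.
rewrite {1}[a]coords_sum dotC dot_sumr; apply: eq_bigr => i _.
by rewrite dotZr dotC.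
Qed.

Lemma root_neq0 a : a \in rts -> a != 0.
Proof. by apply: contraTneq => ->; exact: roots_neq0. Qed.

Lemma root_opp a : a \in rts -> - a \in rts.
Proof. by move=> ra; rewrite -refl_self roots_refl. Qed.

Lemma pos_mem a : pos a -> a \in rts.
Proof. by case/andP. Qed.

Lemma pos_coord a i : pos a -> 0 <= co a i 0.
Proof. by case/andP => _ /forallP. Qed.

Lemma coords0P a : a \in rts -> (forall i, co a i 0 = 0) -> False.
Proof.
move=> /root_neq0/eqP a0 co0; apply: a0; apply: coords_inj => i.
by rewrite co0 -(scale0r a) coordsZ mul0r.
Qed.

Lemma neg_coord a i : a \in rts -> ~~ pos a -> co a i 0 <= 0.
Proof.
move=> ra; rewrite /pos_root ra /=; case: (simple_sign ra) => sa.
  by case/negP; apply/forallP => k; apply: natr_ge0.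
by move=> _; rewrite -oppr_ge0; apply: natr_ge0.
Qed.

Lemma posN a : a \in rts -> pos (- a) = ~~ pos a.
Proof.
move=> ra; apply/idP/idP => [pNa|npa].
  apply/negP => pa; apply: (coords0P ra) => i; apply: le_anti.
  by rewrite pos_coord // andbT -oppr_ge0 -coordsN pos_coord.
rewrite /pos_root root_opp //=; apply/forallP => i.
by rewrite coordsN oppr_ge0 neg_coord.
Qed.

Lemma pos_gt a i : a \in rts -> 0 < co a i 0 -> pos a.
Proof. by move=> ra; apply: contraTT => npa; rewrite -leNgt neg_coord. Qed.

Lemma coord_nat a i : pos a -> co a i 0 \is a Num.nat.
Proof.
move=> pa; case: (simple_sign (pos_mem pa)) => [//|/(_ i)/natr_ge0].
rewrite oppr_ge0 => le0; suff -> : co a i 0 = 0 by rewrite rpred0.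
by apply: le_anti; rewrite le0 pos_coord.
Qed.

Lemma pos_simple i : pos (simple D i).
Proof.
rewrite /pos_root simple_root /=; apply/forallP => j.
by rewrite coords_simple ler0n.
Qed.

Lemma root_pos_scale a (c : R) : a \in rts -> c *: a \in rts -> 0 < c -> c = 1.
Proof. by move=> ra rca c0; case: (roots_reduced ra rca) => // c1; lra. Qed.

(** Some coordinate of [b] away from [i] is positive, since otherwise [b] would be a positive
    multiple of [simple D i], hence equal to it as the system is reduced. The reflection does not
    change that coordinate, and one positive coordinate decides the sign of a root. *)
Lemma pos_refl_simple i b : pos b -> b != simple D i ->
  pos (refl (simple D i) *m b).
Proof.
move=> pb bi; have rb := pos_mem pb.
have [k ki bk] : exists2 k, k != i & 0 < co b k 0.
  apply/exists_inP; apply: contraNT bi => /fintype.exists_inPn nk.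
  have bE : b = co b i 0 *: simple D i.
    apply: coords_inj => k; rewrite coordsZ coords_simple.
    have [->|ki] := eqVneq k i; first by rewrite mulr1.
    by rewrite mulr0; apply: le_anti; rewrite pos_coord // andbT leNgt nk.
  have b0 : 0 < co b i 0.
    rewrite lt_def pos_coord // andbT; apply: contra_neq (root_neq0 rb) => b0.
    by rewrite bE b0 scale0r.
  move: (rb); rewrite bE => rb'.
  by rewrite (root_pos_scale (simple_root D i) rb' b0) scale1r.
apply: (@pos_gt _ k); first by rewrite roots_refl // simple_root.
by rewrite reflE coordsB coordsZ coords_simple (negPf ki) mulr0 subr0.
Qed.

Lemma simple_prod_cons i s : sp (i :: s) = refl (simple D i) *m sp s.
Proof. by []. Qed.

Lemma simple_prod_cat s s' : sp (s ++ s') = sp s *m sp s'.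
Proof.
by elim: s => [|i s IH]; rewrite ?mul1mx //= !simple_prod_cons IH mulmxA.
Qed.

Lemma simple_prod_rcons s i : sp (rcons s i) = sp s *m refl (simple D i).
Proof. by rewrite -cats1 simple_prod_cat /simple_prod /= mulmx1. Qed.

Lemma orth_simple_prod s : orth (sp s).
Proof.
elim: s => [|i s IH]; first exact: orth1.
by rewrite simple_prod_cons; apply: orthM => //; exact: orth_refl.
Qed.

Lemma simple_prod_rev s : sp (rev s) = (sp s)^T.
Proof.
elim: s => [|i s IH]; first by rewrite trmx1.
by rewrite rev_cons simple_prod_rcons IH simple_prod_cons trmx_mul refl_tr.
Qed.

Definition weyl_elt w := exists s, w = sp s.

Lemma weyl_setT w : weyl D [set: 'I_r]%SET w <-> weyl_elt w.
Proof.
split=> [[s _ ->]|[s ->]]; first by exists s.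
by exists s => //; apply/allP => i _; rewrite inE.
Qed.

Lemma weyl1 : weyl_elt 1%:M.
Proof. by exists [::]. Qed.

Lemma weylM w x : weyl_elt w -> weyl_elt x -> weyl_elt (w *m x).
Proof. by case=> s -> [s' ->]; exists (s ++ s'); rewrite simple_prod_cat. Qed.

Lemma weylV w : weyl_elt w -> weyl_elt w^T.
Proof. by case=> s ->; exists (rev s); rewrite simple_prod_rev. Qed.

Lemma weyl_orth w : weyl_elt w -> orth w.
Proof. by case=> s ->; exact: orth_simple_prod. Qed.

Lemma weyl_simple i : weyl_elt (refl (simple D i)).
Proof. by exists [:: i]; rewrite /simple_prod /= mulmx1. Qed.

Lemma weyl_root w a : weyl_elt w -> a \in rts -> w *m a \in rts.
Proof.
case=> s ->; elim: s => [|i s IH] ra; first by rewrite mul1mx.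
by rewrite simple_prod_cons -mulmxA roots_refl ?simple_root ?IH.
Qed.

(** Read from the right, the word turns [b] negative at some letter, whose simple root must then be
    the image of [b] so far. Deleting that letter amounts to multiplying by [refl b] on the
    right. *)
Lemma strong_exchange s b : pos b -> ~~ pos (sp s *m b) ->
  exists2 s', size s = (size s').+1 & sp s' = sp s *m refl b.
Proof.
move=> pb; elim: s => [|i s IH]; first by rewrite mul1mx pb.
have [pc|npc] := boolP (pos (sp s *m b)); last first.
  case: (IH npc) => s' ss' sE _; exists (i :: s'); rewrite /= ?ss' //.
  by rewrite !simple_prod_cons sE mulmxA.
have [ci _|ci] := eqVneq (sp s *m b) (simple D i); last first.
  by rewrite simple_prod_cons -mulmxA pos_refl_simple.
exists s => //; rewrite simple_prod_cons -mulmxA -refl_orth; last exact: orth_simple_prod.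
by rewrite ci mulmxA reflK mul1mx.
Qed.

Lemma len_le s : (len D (sp s) <= size s)%N.
Proof.
rewrite /len; set S := (X in set_min _ X).
have Ss : S (size s) by exists s.
have [k Sk kmin] := nat_has_min Ss.
by rewrite (set_minE _ Sk) // kmin.
Qed.

Lemma len_word w : weyl_elt w -> exists2 s, size s = len D w & w = sp s.
Proof.
case=> s ws; rewrite /len; set S := (X in set_min _ X).
have Ss : S (size s) by exists s.
have [k Sk kmin] := nat_has_min Ss.
by rewrite (set_minE _ Sk).
Qed.

Lemma len_simple i : (len D (refl (simple D i)) <= 1)%N.
Proof.
by have := len_le [:: i]; rewrite /simple_prod /= mulmx1.
Qed.

Lemma lenV w : weyl_elt w -> len D w^T = len D w.
Proof.
have le x : weyl_elt x -> (len D x^T <= len D x)%N.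
  by move=> /len_word[s <- ->]; rewrite -simple_prod_rev (leq_trans (len_le _)) // size_rev.
by move=> Ww; apply/eqP; rewrite eqn_leq le //= -{1}[w]trmxK le //; exact: weylV.
Qed.

Lemma len_mul_le w x : weyl_elt w -> weyl_elt x ->
  (len D (w *m x) <= len D w + len D x)%N.
Proof.
move=> /len_word[s <- ->] /len_word[s' <- ->].
by rewrite -simple_prod_cat -size_cat len_le.
Qed.

Lemma len_refl_lt w b : weyl_elt w -> pos b -> ~~ pos (w *m b) ->
  (len D (w *m refl b) < len D w)%N.
Proof.
move=> /len_word[s <- ->] pb nb; have [s' -> <-] := strong_exchange pb nb.
by rewrite ltnS len_le.
Qed.

Definition height_root a : R := \sum_i co a i 0.

Lemma height_nat a : pos a -> height_root a \is a Num.nat.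
Proof. by move=> pa; apply: rpred_sum => i _; exact: coord_nat. Qed.

Lemma simple_pairing_gt0 b : pos b -> exists i, 0 < pairing (simple D i) b.
Proof.
move=> pb; apply/existsP; apply: contraT => /fintype.existsPn nb.
have := dot_gt0 (root_neq0 (pos_mem pb)); rewrite {1}dot_coords ltNge => /negP[].
apply: sumr_le0 => i _; rewrite mulr_ge0_le0 ?pos_coord //.
have := nb i; rewrite pairingE -leNgt pmulr_rle0 // divr_gt0 //.
exact/dot_gt0/root_neq0/simple_root.
Qed.

(** A simple reflection whose root pairs positively with [b] lowers the height by at least 1, the
    pairing being an integer, so the descent ends at a simple root. *)
Lemma pos_conj_simple b : pos b -> exists s i, b = sp s *m simple D i.
Proof.
move=> pb; have [n] : exists n, height_root b < n%:R.
  by have /natrP[n ->] := height_nat pb; exists n.+1; rewrite ltr_nat.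
elim: n b pb => [|n IH] b pb.
  by rewrite ltNge /height_root sumr_ge0 // => i _; exact: pos_coord.
move=> bn; have [i bi] := simple_pairing_gt0 pb.
have [->|nbi] := eqVneq b (simple D i).
  by exists [::], i; rewrite mul1mx.
have /IH[|s [j sE]] := pos_refl_simple pb nbi.
  have -> : height_root (refl (simple D i) *m b) =
            height_root b - pairing (simple D i) b.
    rewrite /height_root reflE.
    under eq_bigr do rewrite coordsB coordsZ coords_simple.
    rewrite big_split /= sumrN -mulr_sumr; congr (_ - _).
    rewrite (bigD1 i) //= eqxx big1 ?addr0 ?mulr1 // => j.
    by move=> /negPf ->.
  suff : 1 <= pairing (simple D i) b by move: bn; rewrite -natr1; lra.
  have := roots_int (simple_root D i) (pos_mem pb).
  by move=> /intrP[z zE]; move: bi; rewrite zE ltr0z ler1z.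
exists (i :: s), j; rewrite simple_prod_cons -mulmxA -sE mulmxA reflK.
by rewrite mul1mx.
Qed.

Lemma root_conj_simple b : b \in rts -> exists s i, b = sp s *m simple D i.
Proof.
move=> rb; have [/pos_conj_simple//|] := boolP (pos b).
rewrite -posN // => /pos_conj_simple[s [i sE]]; exists (rcons s i), i.
by rewrite simple_prod_rcons -mulmxA refl_self mulmxN -sE opprK.
Qed.

Lemma weyl_refl b : b \in rts -> weyl_elt (refl b).
Proof.
move=> /root_conj_simple[s [i ->]].
exists (s ++ i :: rev s); rewrite simple_prod_cat simple_prod_cons simple_prod_rev.
rewrite mulmxA -refl_orth; last exact: orth_simple_prod.
by rewrite -mulmxA (orthV (orth_simple_prod s)) mulmx1.
Qed.

Lemma len_refl_gt w b : weyl_elt w -> pos b -> pos (w *m b) ->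
  (len D w < len D (w *m refl b))%N.
Proof.
move=> Ww pb pwb; have Wb := weyl_refl (pos_mem pb).
rewrite -[w in X in (X < _)%N]mulmx1 -(reflK b) mulmxA.
apply: len_refl_lt => //; first exact: weylM.
rewrite -mulmxA refl_self mulmxN posN ?pwb //.
by rewrite weyl_root // pos_mem.
Qed.

Lemma perm_roots w : weyl_elt w -> perm_eq [seq w *m a | a <- rts] rts.
Proof.
move=> Ww; have inj := orth_inj (weyl_orth Ww).
apply: uniq_perm; rewrite ?map_inj_uniq ?roots_uniq //.
move=> a; apply/mapP/idP => [[b rb ->]|ra]; first exact: weyl_root.
exists (w^T *m a); first exact/weyl_root/ra/weylV.
by rewrite orthKr //; exact: weyl_orth.
Qed.

Lemma big_roots_weyl (T : Type) (idx : T) (op : Monoid.com_law idx) w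
    (P : pred 'cV[R]_r) (F : 'cV[R]_r -> T) : weyl_elt w ->
  \big[op/idx]_(a <- rts | P a) F a =
  \big[op/idx]_(a <- rts | P (w *m a)) F (w *m a).
Proof.
by move=> Ww; rewrite -(perm_big _ (perm_roots Ww)) big_map.
Qed.

Lemma big_rootsN (T : Type) (idx : T) (op : Monoid.com_law idx)
    (P : pred 'cV[R]_r) (F : 'cV[R]_r -> T) :
  \big[op/idx]_(a <- rts | P a) F a = \big[op/idx]_(a <- rts | P (- a)) F (- a).
Proof.
rewrite -[RHS](big_map -%R P F); apply: perm_big.
apply: uniq_perm; rewrite ?(map_inj_uniq (@oppr_inj _)) ?roots_uniq //.
move=> a; apply/idP/mapP => [ra|[b rb ->]]; last exact: root_opp.
by exists (- a); rewrite ?opprK ?root_opp.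
Qed.

(** * Length as the number of inversions, and the longest element *)

Definition ninv w : nat := \sum_(a <- rts) (pos a && ~~ pos (w *m a)).

(** Apart from its own root up to sign, a simple reflection preserves the sign of every root.
    Reindexing the count by it leaves only the term of [simple D i]: 1 after the multiplication, 0
    before. *)
Lemma ninv_rcons w i : weyl_elt w -> pos (w *m simple D i) ->
  ninv (w *m refl (simple D i)) = (ninv w).+1.
Proof.
move=> Ww pwi; set si := simple D i; have ri : si \in rts := simple_root D i.
rewrite /ninv (bigD1_seq si) ?roots_uniq // [in RHS](bigD1_seq si) ?roots_uniq //=.
rewrite -mulmxA refl_self mulmxN posN ?weyl_root // pwi pos_simple /= add0n add1n.
congr _.+1; rewrite [LHS](big_roots_weyl _ _ _ (weyl_simple i)) /= -/si.
have siN a : (refl si *m a == si) = (a == - si).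
  apply/eqP/eqP => [asi|->]; last by rewrite mulmxN refl_self opprK.
  by rewrite -refl_self -{2}asi mulmxA reflK mul1mx.
rewrite big_seq_cond [RHS]big_seq_cond big_mkcond [RHS]big_mkcond.
apply: eq_bigr => a _ /=; rewrite siN.
case ra: (a \in rts) => //=.
have -> : w *m refl si *m (refl si *m a) = w *m a.
  by rewrite -mulmxA (mulmxA (refl si)) reflK mul1mx.
have [->|asi] := eqVneq a si.
  by rewrite refl_self posN // pos_simple /=; case: ifP.
have [->|aNsi] /= := eqVneq a (- si); first by rewrite posN // pos_simple.
suff -> : pos (refl si *m a) = pos a by [].
have [pa|npa] := boolP (pos a); first exact: pos_refl_simple.
apply/negbTE; rewrite -posN ?roots_refl // -mulmxN pos_refl_simple ?posN //.
by apply: contraNneq aNsi => aE; rewrite /si -aE opprK.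
Qed.

Lemma len_ninv w : weyl_elt w -> len D w = ninv w.
Proof.
move=> /len_word[s]; move: {2}(size s) (erefl (size s)) => n.
elim: n s w => [|n IH] s w ssz slen ws.
  move/size0nil: ssz slen ws => -> <- ->; rewrite /ninv big_seq big1 // => a ra.
  by rewrite mul1mx andbN.
case/lastP: s ssz slen ws => [//|s i]; rewrite size_rcons => -[ssz] slen.
rewrite simple_prod_rcons => ws; have Ws : weyl_elt (sp s) by exists s.
have lens : size s = len D (sp s).
  apply/eqP; rewrite eqn_leq len_le andbT -ltnS slen ws.
  rewrite (leq_trans (len_mul_le Ws (weyl_simple i))) //.
  by rewrite -addn1 leq_add2l len_simple.
have psi : pos (sp s *m simple D i).
  apply: contraT => /(len_refl_lt Ws (pos_simple i)).
  by rewrite -ws -slen -lens ltnNge leqnSn.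
by rewrite -slen ws ninv_rcons // -(IH s) // lens.
Qed.

Lemma len_bound w : weyl_elt w -> (len D w <= size rts)%N.
Proof.
move=> Ww; rewrite len_ninv // /ninv -sum1_size leq_sum // => a _.
exact: leq_b1.
Qed.

Lemma len0_eq1 w : weyl_elt w -> (forall a, pos a -> pos (w *m a)) -> w = 1%:M.
Proof.
move=> Ww wp; have : len D w = 0%N.
  rewrite len_ninv // /ninv big1 // => a _.
  by case pa: (pos a) => //=; rewrite wp.
by have [s <- ->] := len_word Ww => /size0nil ->.
Qed.

Lemma longestP : weyl_elt (longest D) /\
  forall x, weyl_elt x -> (len D x <= len D (longest D))%N.
Proof.
suff [w Ww wmax] : exists2 w, weyl_elt w & forall x, weyl_elt x -> (len D x <= len D w)%N.
  rewrite /longest; case: xgetP => [y _ [/weyl_setT Wy ymax]|/(_ w)[]].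
    by split=> // x /weyl_setT; apply: ymax.
  by split=> [|x /weyl_setT/wmax//]; apply/weyl_setT.
(* The Weyl group is a set of matrices, so a longest element is found by minimising the deficit from
   the number of roots, which bounds every length. *)
have : exists n, exists2 w, weyl_elt w & (size rts - len D w)%N = n.
  by exists (size rts - len D 1%:M)%N, 1%:M => //; exact: weyl1.
case=> n Sn; have [k [w Ww wk] kmin] := nat_has_min
  (Sn : [set n | exists2 w, weyl_elt w & (size rts - len D w)%N = n]%classic n).
exists w => // x Wx; have := kmin _ (ex_intro2 _ _ x Wx erefl).
by have := len_bound Wx; have := len_bound Ww; lia.
Qed.

Lemma weyl_longest : weyl_elt (longest D).
Proof. by case: longestP. Qed.

(** A simple root kept positive would produce a longer element. So all simple roots become negative,
    and with them their nonnegative combinations. *)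
Lemma longest_neg a : pos a -> ~~ pos (longest D *m a).
Proof.
have [Ww wmax] := longestP => pa.
have neg_simple i : ~~ pos (longest D *m simple D i).
  apply/negP => /(len_refl_gt Ww (pos_simple i)).
  by rewrite ltnNge wmax //; apply: weylM => //; exact: weyl_simple.
apply/negP => pwa; apply: (coords0P (pos_mem pwa)) => k; apply: le_anti.
rewrite pos_coord // andbT.
have -> : longest D *m a = \sum_i co a i 0 *: (longest D *m simple D i).
  rewrite {1}[a]coords_sum mulmx_sumr; apply: eq_bigr => i _.
  by rewrite scalemxAr.
have -> : co (\sum_i co a i 0 *: (longest D *m simple D i)) k 0 =
          \sum_i co a i 0 * co (longest D *m simple D i) k 0.
  rewrite /coords mulmx_sumr summxE; apply: eq_bigr => i _.
  by rewrite -scalemxAr mxE.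
apply: sumr_le0 => i _; rewrite mulr_ge0_le0 ?pos_coord // neg_coord //.
by rewrite weyl_root ?simple_root.
Qed.

Lemma longestK : longest D *m longest D = 1%:M.
Proof.
apply: len0_eq1 => [|a pa]; first exact: weylM weyl_longest weyl_longest.
have ra := weyl_root weyl_longest (pos_mem pa).
rewrite -mulmxA -[_ *m a]opprK mulmxN posN; last first.
  by rewrite weyl_root ?root_opp //; exact: weyl_longest.
by rewrite longest_neg // posN // longest_neg.
Qed.
End Roots.

(** * The highest root *)

Section Heights.
Variables (R : realType) (r : nat) (D : root_system R r).
Implicit Types (a b : 'cV[R]_r).

Lemma height_rootZ (c : R) a : height_root D (c *: a) = c * height_root D a.
Proof. by rewrite /height_root mulr_sumr; apply: eq_bigr => i _; rewrite coordsZ. Qed.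

Lemma height_rootB a b : height_root D (a - b) = height_root D a - height_root D b.
Proof. by rewrite /height_root -sumrB; apply: eq_bigr => i _; rewrite coordsB. Qed.

Lemma height_simple j : height_root D (simple D j) = 1.
Proof.
rewrite /height_root (bigD1 j) //= big1 => [|i ij]; rewrite coords_simple.
  by rewrite eqxx addr0.
by rewrite (negPf ij).
Qed.

Lemma height_pos_ge1 a : pos_root D a -> 1 <= height_root D a.
Proof.
move=> pa; have /natrP[[|n] hn] := height_nat pa; last by rewrite hn ler1n.
have : \sum_i coords (simple D) a i 0 == 0 by rewrite -/(height_root D a) hn.
rewrite psumr_eq0 => [/allP a0|i _]; last exact: pos_coord.
by case: (coords0P (pos_mem pa)) => i; apply/eqP/a0; rewrite mem_index_enum.
Qed.

End Heights.

Lemma seq_argmax (R : realDomainType) (T : eqType) (f : T -> R) (P : pred T)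
    (s : seq T) : has P s ->
  exists2 t, t \in s & P t /\ forall u, u \in s -> P u -> f u <= f t.
Proof.
elim: s => [//|x s IH] /= h; have [/IH[t ts [Pt tmax]]|nPs] := boolP (has P s).
  have [Px|nPx] := boolP (P x); last first.
    exists t; rewrite ?inE ?ts ?orbT //; split=> // u; rewrite inE.
    by case/predU1P => [->|/tmax//]; rewrite (negPf nPx).
  have [xt|tx] := leP (f x) (f t).
    exists t; rewrite ?inE ?ts ?orbT //; split=> // u; rewrite inE.
    by case/predU1P => [->|/tmax].
  exists x; rewrite ?mem_head //; split=> // u; rewrite inE.
  by case/predU1P => [->//|us /(tmax _ us) ut]; exact: le_trans ut (ltW tx).
move: h; rewrite (negPf nPs) orbF => Px; exists x; rewrite ?mem_head //.
split=> // u; rewrite inE; case/predU1P => [->//|us Pu].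
by case/hasP: nPs; exists u.
Qed.

Section HighestRoot.
Variables (R : realType) (r : nat) (D : root_system R r).
Implicit Types (a b v mu t : 'cV[R]_r) (w x : 'M[R]_r) (i j : 'I_r).
Implicit Types (s : seq 'I_r).
Local Notation pos := (pos_root D).
Local Notation co := (coords (simple D)).
Local Notation rts := (Defs.roots D).
Local Notation sp := (simple_prod D).
Local Notation al := (simple D).

Lemma pairing_root_int a v : (forall i, pairing (al i) v \is a Num.int) ->
  a \in rts -> pairing a v \is a Num.int.
Proof.
move=> iv /root_conj_simple[s [i ->]].
rewrite pairing_mulmxl; last exact: orth_simple_prod.
elim: s v iv => [|k s IH] v iv; first by rewrite trmx1 mul1mx.
rewrite simple_prod_cons trmx_mul refl_tr -mulmxA; apply: IH => j.
rewrite reflE pairingBr pairingZr rpredB ?rpredM ?iv //.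
by rewrite (@roots_int _ _ D) ?simple_root.
Qed.

Lemma dot_pairing a v : a \in rts -> dot a v = dot a a / 2 * pairing a v.
Proof.
move=> /root_neq0/dot_gt0; rewrite pairingE => a0.
by rewrite !mulrA divfK ?pnatr_eq0 // divff ?mul1r ?gt_eqF.
Qed.

Lemma pairing_sign a v : a \in rts ->
  ((0 < pairing a v) = (0 < dot a v)) * ((0 <= pairing a v) = (0 <= dot a v)).
Proof.
move=> ra; have a0 : 0 < dot a a / 2 by rewrite divr_gt0 ?dot_gt0 ?(root_neq0 ra).
by rewrite (dot_pairing v ra) pmulr_rgt0 // pmulr_rge0.
Qed.

Lemma pairing_dominant_ge0 a v : (forall i, 0 <= pairing (al i) v) -> pos a ->
  0 <= pairing a v.
Proof.
move=> dv pa; rewrite pairing_sign ?pos_mem // (dot_coords D) sumr_ge0 // => i _.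
by rewrite mulr_ge0 ?pos_coord // -pairing_sign ?simple_root.
Qed.

Lemma pairing_dominant_gt0 a v : (forall i, 0 < pairing (al i) v) -> pos a ->
  0 < pairing a v.
Proof.
move=> dv pa; rewrite pairing_sign ?pos_mem // (dot_coords D).
have dv0 i : 0 < dot (al i) v by rewrite -pairing_sign ?simple_root.
rewrite lt_def sumr_ge0 => [|i _]; last by rewrite mulr_ge0 ?pos_coord // ltW.
rewrite andbT; apply/eqP => /psumr_eq0P a0; apply: (coords0P (pos_mem pa)) => i.
have /eqP : co a i 0 * dot (al i) v = 0.
  by apply: a0 => // k _; rewrite mulr_ge0 ?pos_coord // ltW.
by rewrite mulf_eq0 (gt_eqF (dv0 i)) orbF => /eqP.
Qed.

Lemma simple_obtuse i j : i != j -> dot (al i) (al j) <= 0.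
Proof.
move=> ij; rewrite leNgt -pairing_sign ?simple_root // -leNgt.
have /(pos_coord i) : pos (refl (al i) *m al j).
  apply: pos_refl_simple; first exact: pos_simple.
  apply: contraNneq ij => /(congr1 (fun v => co v i 0)).
  by rewrite !coords_simple eqxx => /eqP; rewrite eqr_nat eqb1.
by rewrite reflE coordsB coordsZ !coords_simple eqxx (negPf ij) mulr1 sub0r oppr_ge0.
Qed.

Definition maximal_root t := t \in rts /\
  forall b, b \in rts -> (forall i, co t i 0 <= co b i 0) -> b = t.

Lemma maximal_above a : a \in rts ->
  exists2 t, maximal_root t & forall i, co a i 0 <= co t i 0.
Proof.
move=> ra; pose P := [pred t | [forall i, co a i 0 <= co t i 0]].
have : has P rts by apply/hasP; exists a => //=; apply/forallP.
case/(seq_argmax (height_root D)) => t rt [/forallP Pt tmax].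
exists t => //; split=> // b rb tb; apply: (@coords_inj _ _ D) => i; apply: le_anti.
rewrite tb andbT leNgt; apply/negP => lti.
suff : height_root D b <= height_root D t.
  rewrite leNgt => /negP[]; rewrite /height_root (bigD1 i) //= [ltRHS](bigD1 i) //=.
  by apply: ltr_leD => //; apply: ler_sum.
by apply: tmax => //; apply/forallP => k; exact: le_trans (Pt k) (tb k).
Qed.

Lemma maximal_pos t : maximal_root t -> pos t.
Proof.
move=> [rt tmax]; apply: contraT => nt.
have tN : - t = t.
  apply: tmax => [|i]; first exact: root_opp.
  have := neg_coord i rt nt.
  by rewrite coordsN; lra.
by move: (nt); rewrite -posN // tN (negPf nt).
Qed.

Lemma maximal_dominant t i : maximal_root t -> 0 <= pairing (al i) t.
Proof.
move=> [rt tmax]; rewrite leNgt; apply/negP => lt0.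
have /tmax : refl (al i) *m t \in rts by rewrite roots_refl ?simple_root.
rewrite reflE => tE; suff /(congr1 (fun v => co v i 0)) : t - pairing (al i) t *: al i = t.
  by rewrite coordsB coordsZ coords_simple eqxx mulr1; lra.
apply: tE => k; rewrite coordsB coordsZ coords_simple.
by case: eqP => _; rewrite ?mulr1 ?mulr0; lra.
Qed.

(** Irreducibility enters here. If a coordinate of [t] vanished, the simple roots inside and outside
    its support would be mutually orthogonal; every root, being conjugate to a simple one, would lie
    in one of the two spans. *)
Lemma maximal_coord_gt0 t i : maximal_root t -> 0 < co t i 0.
Proof.
move=> tmax; have pt := maximal_pos tmax; apply: contraT => ti.
pose S := [pred k | 0 < co t k 0].
(* The product of the dominant [t] with [al k] is a sum of nonpositive terms, since the coefficient
   of [al k] itself vanishes; hence every term is zero. *)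
have ort k j : ~~ S k -> S j -> dot (al k) (al j) = 0.
  move=> kS jS; have : 0 <= dot t (al k).
    by rewrite dotC -pairing_sign ?simple_root // maximal_dominant.
  rewrite (dot_coords D) (bigD1 j) //= => ge0; apply: le_anti.
  rewrite simple_obtuse ?andTb; last by apply: contraNneq kS => ->.
  have : \sum_(i0 < r | i0 != j) co t i0 0 * dot (al i0) (al k) <= 0.
    apply: sumr_le0 => l _; have [lk|lk] := eqVneq l k.
      have -> : co t l 0 = 0; last by rewrite mul0r.
      by apply: le_anti; rewrite pos_coord // lk leNgt kS.
    by rewrite mulr_ge0_le0 ?pos_coord // simple_obtuse.
  move=> le0; rewrite dotC -(pmulr_rge0 _ (jS : 0 < co t j 0)); lra.
pose supp (Q : pred 'I_r) := [pred a : 'cV[R]_r | [forall k, Q k || (co a k 0 == 0)]].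
have ort2 a b : supp S a -> supp (predC S) b -> dot a b = 0.
  move=> /forallP aS /forallP bS; rewrite (dot_coords D) big1 // => k _.
  have /orP[kS|/eqP->] := aS k; last by rewrite mul0r.
  rewrite dotC (dot_coords D) big1 ?mulr0 // => j _.
  by have /orP[jS|/eqP->] := bS j; rewrite ?mul0r // ort // mulr0.
have refl_supp (Q : pred 'I_r) a k : supp Q a -> supp Q (al k) || (pairing (al k) a == 0) ->
    supp Q (refl (al k) *m a).
  move=> /forallP Qa /orP[/forallP Qk|/eqP a0]; rewrite reflE; apply/forallP => j.
    have /orP[->//|/eqP aj] := Qa j; have /orP[->//|/eqP kj] := Qk j.
    by rewrite coordsB coordsZ aj kj mulr0 subrr eqxx orbT.
  by rewrite a0 scale0r subr0; exact: Qa.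
have supp_simple (Q : pred 'I_r) k : Q k -> supp Q (al k).
  move=> Qk; apply/forallP => j; rewrite coords_simple.
  by have [->|] := eqVneq j k; rewrite ?Qk ?eqxx ?orbT.
have pair0 a k : dot (al k) a = 0 -> pairing (al k) a == 0.
  by move=> a0; rewrite pairingE a0 mulr0.
have dich a : a \in rts -> supp S a || supp (predC S) a.
  move=> /root_conj_simple[s [k ->]]; elim: s => [|l s IH].
    rewrite mul1mx; apply/orP; case Sk: (S k); [left|right];
      exact/supp_simple/(negbT Sk) || exact/supp_simple.
  rewrite simple_prod_cons -mulmxA; case/orP: IH => IH.
    apply/orP; left; apply: refl_supp => //; case Sl: (S l).
      by rewrite supp_simple.
    by rewrite pair0 ?orbT // dotC ort2 //; exact/supp_simple/(negbT Sl).
  apply/orP; right; apply: refl_supp => //; case Sl: (S l).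
    by rewrite pair0 ?orbT // ort2 // supp_simple.
  by apply/orP; left; exact/supp_simple/(negbT Sl).
have [||a [b [ra rb Pa nPb /eqP[]]]] := @roots_irreducible _ _ D (supp S).
- apply/hasP; exists t; first exact: pos_mem.
  apply/forallP => k; case Sk: (S k) => //=; apply/eqP/le_anti.
  by rewrite pos_coord // andbT leNgt [_ < _]Sk.
- apply/hasP; exists (al i); first exact: simple_root.
  apply/negP => /forallP/(_ i); rewrite coords_simple eqxx oner_eq0 orbF.
  exact/negP.
by apply: ort2 => //; move: (dich b rb); rewrite (negPf nPb).
Qed.

(** If one of the two Cartan integers is 1, a reflection gives the difference. Otherwise both are at
    least 2, so [dot a b] bounds both square lengths and [a - b] has square length at most 0. *)
Lemma root_sub a b : a \in rts -> b \in rts -> 0 < dot a b -> a = b \/ a - b \in rts.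
Proof.
have key a' b' : a' \in rts -> b' \in rts -> 0 < dot a' b' ->
    dot b' b' <= dot a' b' \/ a' - b' \in rts.
  move=> ra rb ab; have : 0 < pairing b' a' by rewrite pairing_sign // dotC.
  have /intrP[z zE] := roots_int rb ra; rewrite zE ltr0z => z0.
  have [z1|z2] := eqVneq z 1.
    by right; have := roots_refl rb ra; rewrite reflE zE z1 scale1r.
  left; rewrite [dot a' b']dotC (dot_pairing a' rb) zE.
  have : 2 <= z%:~R :> R by rewrite (_ : 2 = 2%:~R) // ler_int; lia.
  have := dot_gt0 (root_neq0 rb); nra.
move=> ra rb ab; case: (key a b) => // [le1|]; last by right.
case: (key b a) => //; first by rewrite dotC.
  move=> le2; left; apply/eqP; rewrite -subr_eq0; apply: contraT => /dot_gt0.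
  by move: le1 le2; rewrite dotDl !dotDr !dotNl !dotNr (dotC b a); lra.
by move=> /root_opp; rewrite opprB; right.
Qed.

(** All coordinates of [t] are positive and [u] is dominant, so their product is positive and
    [root_sub] applies. Whatever the sign of the root [t - u], maximality of one of the two forces
    equality. *)
Lemma maximal_uniq t u : maximal_root t -> maximal_root u -> t = u.
Proof.
move=> tmax umax; have [rt mt] := tmax; have [ru mu] := umax.
have tu : 0 < dot t u.
  have [i ui] := simple_pairing_gt0 (maximal_pos umax).
  rewrite (dot_coords D) (bigD1 i) //= ltr_wpDr //; last first.
    by rewrite mulr_gt0 ?maximal_coord_gt0 // -pairing_sign ?simple_root.
  apply: sumr_ge0 => k _; apply: mulr_ge0; first exact/ltW/maximal_coord_gt0.
  by rewrite -pairing_sign ?simple_root // maximal_dominant.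
have [//|rtu] := root_sub rt ru tu.
have [ptu|ntu] := boolP (pos (t - u)).
  by apply: mu => // i; have := pos_coord i ptu; rewrite coordsB; lra.
apply/esym/mt => // i; have := neg_coord i rtu ntu; rewrite coordsB; lra.
Qed.

Lemma theta_highest : theta D \in rts /\
  forall b, b \in rts -> forall i, co b i 0 <= co (theta D) i 0.
Proof.
have [t tmax _] := maximal_above (simple_root D (Ordinal (rank_gt0 D))).
rewrite /theta; case: xgetP => [//|/(_ t)[]]; split=> [|b rb i]; first by case: tmax.
by have [u umax bu] := maximal_above rb; rewrite (maximal_uniq tmax umax).
Qed.

Lemma theta_root : theta D \in rts. Proof. by case: theta_highest. Qed.

Lemma theta_ge b i : b \in rts -> co b i 0 <= co (theta D) i 0.
Proof. by move=> rb; case: theta_highest => _ ->. Qed.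

Lemma theta_maximal : maximal_root (theta D).
Proof.
split=> [|b rb tb]; first exact: theta_root.
by apply: (@coords_inj _ _ D) => i; apply: le_anti; rewrite tb theta_ge.
Qed.

Lemma pos_theta : pos (theta D). Proof. exact: maximal_pos theta_maximal. Qed.

Lemma pairing_theta_ge0 a : pos a -> 0 <= pairing (theta D) a.
Proof.
move=> pa; rewrite pairing_sign ?theta_root // dotC -pairing_sign ?pos_mem //.
by apply: pairing_dominant_ge0 => // i; apply: maximal_dominant theta_maximal.
Qed.

(** With a pairing [z] of at least 2, the root [z theta - a] would have coordinates at most those of
    [theta], which gives [a] coordinates at least those of [theta]. *)
Lemma pairing_theta a : pos a -> a != theta D ->
  pairing (theta D) a = 0 \/ pairing (theta D) a = 1.
Proof.
move=> pa at_; have ra := pos_mem pa; have := pairing_theta_ge0 pa.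
have /intrP[z zE] := roots_int theta_root ra; rewrite zE ler0z => z0.
have [z1|z2] := leP z 1.
  have zz : z = 0 \/ z = 1 by lia.
  by case: zz => ->; [left|right].
case/negP: at_; apply/eqP; apply: (@coords_inj _ _ D) => i; apply: le_anti.
rewrite theta_ge //=; have := roots_refl theta_root ra.
rewrite reflE zE => /root_opp/(@theta_ge _ i); rewrite coordsN coordsB coordsZ.
have : 2 <= z%:~R :> R by rewrite (_ : 2 = 2%:~R) // ler_int; lia.
have := pos_coord i pos_theta; nra.
Qed.

End HighestRoot.

(** * Sign changes along quantum Bruhat edges *)

Section QuantumEdges.
Variables (R : realType) (r : nat) (D : root_system R r).
Implicit Types (a b v mu t : 'cV[R]_r) (u w x : 'M[R]_r) (i j : 'I_r).
Local Notation pos := (pos_root D).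
Local Notation co := (coords (simple D)).
Local Notation rts := (Defs.roots D).
Local Notation al := (simple D).

Definition rho2 : 'cV[R]_r := \sum_(a <- rts | pos a) a.

Lemma two_rho_setT : 2 *: rho D [set: 'I_r]%SET = rho2.
Proof.
rewrite /rho scalerA mulfV ?pnatr_eq0 // scale1r; apply: eq_bigl => a.
by rewrite /pos_root_in; case: pos_root => //=; apply/forallP => i; rewrite inE.
Qed.

Lemma pos_root_in0 a : pos_root_in D finset.set0 a = false.
Proof.
apply/negP => /andP[pa /forallP a0]; apply: (coords0P (pos_mem pa)) => i.
by apply/eqP; move: (a0 i); rewrite inE.
Qed.

Lemma two_rho_set0 : 2 *: rho D finset.set0 = 0.
Proof.
by rewrite /rho big_pred0 ?scaler0 // => a; rewrite pos_root_in0.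
Qed.

Lemma weyl_coset0 w : weyl_coset D finset.set0 w = [set w]%classic.
Proof.
apply/seteqP; split=> [x [u [[|i s] //= ss ->] <-]|x ->].
- by rewrite mulmx1.
- by move: ss; rewrite inE.
- by exists 1%:M; rewrite ?mulmx1 //; exists [::].
Qed.

Lemma min_rep0 w : min_rep D finset.set0 w = w.
Proof.
rewrite /min_rep; case: xgetP => [x _ [cx _]|/(_ w)[]].
  by move: cx; rewrite weyl_coset0.
by split=> [|y]; rewrite weyl_coset0 // => ->.
Qed.

Lemma qb_edge0P b u x : qb_edge D finset.set0 b u x ->
  [/\ weyl_elt D u, pos b, x = u *m refl b &
      len D (u *m refl b) = (len D u).+1 \/
      (len D (u *m refl b))%:R = (len D u)%:R + 1 - pairing b rho2].
Proof.
case=> -[/weyl_setT Wu _] /andP[pb _] -> ed; split=> //; first exact: min_rep0.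
case: ed => ed; [by left|right].
by move: ed; rewrite /quantum_edge min_rep0 two_rho_setT two_rho_set0 subr0.
Qed.

Lemma ninv_sum w : (ninv D w)%:R = \sum_(a <- rts | pos a) (~~ pos (w *m a))%:R :> R.
Proof.
rewrite natr_sum [RHS]big_mkcond; apply: eq_bigr => a _.
by case: (pos a).
Qed.

Lemma inv_pairing_ge1 a b : a \in rts -> pos a -> pos b -> ~~ pos (refl b *m a) ->
  1 <= pairing b a.
Proof.
move=> ra pa pb nra; have rb := pos_mem pb.
have /intrP[z zE] := roots_int rb ra; rewrite zE ler1z.
rewrite -gtz0_ge1 -(ltr0z R) -zE ltNge; apply: contra nra => le0.
rewrite /pos_root roots_refl //=; apply/forallP => i; rewrite reflE coordsB coordsZ.
by have := pos_coord i pa; have := pos_coord i pb; nra.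
Qed.

(** The positive roots that [refl b] keeps positive contribute nothing in total, as [refl b]
    permutes them and changes the sign of each term. Each inverted root contributes at least 1, and
    [b] itself 2. *)
Lemma len_refl_bound b : pos b -> (len D (refl b))%:R + 1 <= pairing b rho2.
Proof.
move=> pb; have rb := pos_mem pb; have Wb := weyl_refl rb.
have S0 : \sum_(a <- rts | pos a && pos (refl b *m a)) pairing b a = 0.
  suff : \sum_(a <- rts | pos a && pos (refl b *m a)) pairing b a =
         - \sum_(a <- rts | pos a && pos (refl b *m a)) pairing b a by lra.
  rewrite {1}(big_roots_weyl _ _ _ Wb) -sumrN; apply: eq_big => a.
    by rewrite mulmxA reflK mul1mx andbC.
  move=> _; rewrite reflE pairingBr pairingZr pairing_self ?(root_neq0 rb) //.
  lra.
rewrite pairing_sumr (bigID (fun a => pos (refl b *m a))) /= S0 add0r.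
rewrite len_ninv // ninv_sum.
pose F a : R := if pos a && ~~ pos (refl b *m a) then pairing b a - 1 else 0.
have F0 a : a \in rts -> 0 <= F a.
  rewrite /F => ra; case: ifP => // /andP[pa na]; rewrite subr_ge0.
  exact: inv_pairing_ge1.
have Fb : F b = 1.
  rewrite /F pb refl_self posN // pb /= pairing_self ?(root_neq0 rb) //; lra.
have -> : \sum_(a <- rts | pos a && ~~ pos (refl b *m a)) pairing b a =
    \sum_(a <- rts | pos a) (~~ pos (refl b *m a))%:R + \sum_(a <- rts) F a.
  rewrite [LHS]big_mkcond [X in _ = X + _]big_mkcond -big_split /=.
  apply: eq_bigr => a _; rewrite /F; case: (pos a); rewrite ?addr0 //=.
  by case: (pos _); rewrite /= ?addr0 // addrC subrK.
rewrite lerD2l (bigD1_seq b) ?roots_uniq //= Fb lerDl big_seq_cond sumr_ge0 // => a.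
by move=> /andP[/F0].
Qed.

Lemma pos_theta_sub a : a \in rts -> pairing (theta D) a = 1 -> pos (theta D - a).
Proof.
move=> ra a1; rewrite /pos_root -opprB root_opp /=; last first.
  by have := roots_refl (theta_root D) ra; rewrite reflE a1 scale1r.
by apply/forallP => i; rewrite opprB coordsB subr_ge0 theta_ge.
Qed.

(** The substitute, for [theta], of the rule for left multiplication by a simple reflection. By
    [pairing_theta], [refl theta] fixes a positive root other than [theta] or makes it negative, so
    the change in the number of inversions can be matched term by term with the pairing. *)
Lemma len_theta w : weyl_elt D w -> pos (w^T *m theta D) ->
  (len D (refl (theta D) *m w))%:R = (len D w)%:R - 1 + pairing (w^T *m theta D) rho2.
Proof.
set th := theta D => Ww pw; have rth : th \in rts := theta_root D.
have Wth := weyl_refl rth; have Wt := weylV Ww; have Ow := weyl_orth Ww.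
pose S a := pos (w^T *m a).
have SN a : a \in rts -> S (- a) = ~~ S a.
  by move=> ra; rewrite /S mulmxN posN // weyl_root.
have -> : pairing (w^T *m th) rho2 =
    \sum_(a <- rts | pos a) ((S a)%:R - (~~ S a)%:R) * pairing th a.
  rewrite pairing_mulmxl; last exact: orth_tr.
  rewrite trmxK /rho2 mulmx_sumr pairing_sumr (big_roots_weyl _ _ _ Wt) /=.
  under eq_bigr do rewrite orthKr //.
  rewrite (bigID pos) /= [X in _ + X]big_rootsN /=.
  rewrite big_seq_cond [X in _ + X]big_seq_cond [RHS]big_seq_cond.
  rewrite [X in X + _ = _]big_mkcond [X in _ + X = _]big_mkcond [RHS]big_mkcond -big_split /=.
  apply: eq_bigr => a _.
  case ra: (a \in rts); rewrite /= ?addr0 //; rewrite -/(S a) -/(S (- a)) SN // posN //.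
  rewrite negbK pairingNr.
  by case: (S a); case: (pos a); rewrite /= ?addr0 ?add0r ?subr0 ?sub0r ?mul1r ?mulN1r.
rewrite -lenV; last exact: weylM.
rewrite -(lenV Ww) trmx_mul refl_tr !len_ninv //; last exact: weylM.
rewrite /ninv (big_roots_weyl _ _ _ Wth) /= !natr_sum.
under eq_bigr => a _ do
  rewrite -mulmxA (mulmxA (refl th)) reflK mul1mx -/(S a).
have split_sum (F : 'cV[R]_r -> R) : \sum_(a <- rts) F a =
    \sum_(a <- rts | pos a) (F a + F (- a)).
  rewrite (bigID pos) /= [X in _ + X]big_rootsN big_split /=; congr (_ + _).
  rewrite big_seq_cond [RHS]big_seq_cond; apply: eq_bigl => a.
  by case ra: (a \in rts); rewrite //= posN ?negbK.
rewrite split_sum [X in _ = X - 1 + _]split_sum.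
suff : \sum_(a <- rts | pos a) ((pos (refl th *m a) && ~~ S a)%:R +
         (pos (refl th *m - a) && ~~ S (- a))%:R) -
       \sum_(a <- rts | pos a) ((pos a && ~~ S a)%:R + (pos (- a) && ~~ S (- a))%:R) =
       \sum_(a <- rts | pos a) ((S a)%:R - (~~ S a)%:R) * pairing th a - 1 :> R.
  by move=> E; rewrite -[LHS](subrK (\sum_(a <- rts | pos a)
    ((pos a && ~~ S a)%:R + (pos (- a) && ~~ S (- a))%:R))) E; ring.
rewrite -sumrB [LHS]big_mkcond [X in _ = X - 1]big_mkcond /= (bigD1_seq th) ?roots_uniq //=.
rewrite [in RHS](bigD1_seq th) ?roots_uniq //= pos_theta.
rewrite mulmxN refl_self opprK !posN // pos_theta SN // [S th]pw pairing_self ?(root_neq0 rth) //=.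
set X := (X in _ + X); set Y := (X in _ + X - 1).
suff -> : X = Y by ring.
rewrite /X /Y big_seq_cond [RHS]big_seq_cond; apply: eq_bigr => a /andP[ra ath].
case pa: (pos a) => //=; rewrite mulmxN !posN ?roots_refl // pa SN //=.
case: (pairing_theta pa ath) => a1.
  by rewrite reflE a1 scale0r subr0 pa /= addr0 subrr mulr0.
have -> : pos (refl th *m a) = false.
  apply/negbTE; rewrite reflE a1 scale1r -posN; last first.
    by have := roots_refl rth ra; rewrite reflE a1 scale1r.
  by rewrite opprB pos_theta_sub.
by rewrite a1 mulr1 /= negbK add0r addr0.
Qed.

(* For p = 0, [- theta] plays the role of a simple root: both cases compare the
   lengths of [u], [u r_b] and of their left translates by [r_alpha]. *)
Lemma qb_edge_sign (p : affine_index r) b u :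
  let nu := u^T *m affine_root D p in
  qb_edge D finset.set0 b u (u *m refl b) -> pos nu -> ~~ pos (refl b *m nu) ->
  nu = b.
Proof.
move=> nu /qb_edge0P[Wu pb _ ed] pnu nnu; have rb := pos_mem pb.
have Ou := weyl_orth Wu; have rnu := pos_mem pnu.
have rub : u *m b \in rts by exact: weyl_root.
have unu : u *m nu = affine_root D p by rewrite orthKr.
have Bpos : len D (u *m refl b) = (len D u).+1 -> pos (u *m b).
  move=> lu; apply: contraT => /(len_refl_lt Wu pb); rewrite lu; lia.
have Wv : weyl_elt D (u *m refl b) by apply: weylM => //; exact: weyl_refl.
have Bb := len_refl_bound pb.
have Wb := weyl_refl rb; have nuE : nu = u^T *m affine_root D p by [].
clearbody nu; case: p => [i|] /= in nuE unu.
  have Ws := weyl_simple D i; set s := refl (simple D i) in Ws *.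
  have lsu : len D (s *m u) = (len D u).+1.
    apply/eqP; rewrite eqn_leq (leq_trans (len_mul_le Ws Wu)); last first.
      by rewrite -add1n leq_add2r len_simple.
    rewrite -(lenV Wu) -(lenV (weylM Ws Wu)) trmx_mul refl_tr.
    by apply: len_refl_gt; rewrite ?pos_simple -?nuE //; exact: weylV.
  have lsv : (len D (s *m (u *m refl b)) < len D (u *m refl b))%N.
    rewrite -(lenV Wv) -(lenV (weylM Ws Wv)) trmx_mul [s^T]refl_tr.
    apply: len_refl_lt; rewrite ?pos_simple //; first exact: weylV.
    by rewrite trmx_mul refl_tr -mulmxA -nuE.
  (* On a Bruhat edge, if [u *m b] were not the simple root, [s] would keep it positive and
     [s *m u *m refl b] would be longer than [s *m u]. But it is shorter than [u *m refl b], which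
     has the length of [s *m u]. *)
  case: ed => [lv|lv].
    suff ubE : u *m b = simple D i by rewrite nuE -ubE orthKl.
    apply/eqP; apply: contraT => /(pos_refl_simple (Bpos lv)); rewrite -/s => psub.
    have := len_refl_gt (weylM Ws Wu) pb; rewrite -!mulmxA => /(_ psub).
    by move: lsv; rewrite lsu lv; lia.
  (* A quantum edge loses at least the length of [refl b], by [len_refl_bound], and [s] loses one
     more. Multiplying back by [refl b] cannot reach the length of [s *m u]. *)
  have := len_mul_le (weylM Ws Wv) Wb.
  rewrite mulmxA -mulmxA reflK mulmx1 lsu -!mulmxA.
  rewrite -(ler_nat R) natrD -natr1; move: lsv; rewrite -(ler_nat R) -natr1.
  by move=> h1 h2; exfalso; move: Bb lv h1 h2; clear; lra.
(* Now [p = 0]. Turning negative requires a positive pairing with [b], so [theta] pairs negatively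
   with [u *m b]. This root is then negative and the edge can only be quantum. *)
have c_gt0 : 0 < pairing nu b.
  rewrite (pairing_sign (D := D)) // dotC -(pairing_sign (D := D)) // ltNge.
  apply: contra nnu => le0; rewrite /pos_root roots_refl //=.
  apply/forallP => i; rewrite reflE coordsB coordsZ.
  have := pos_coord i pnu; have := pos_coord i pb; move: le0; clear; nra.
have thub : pairing (theta D) (u *m b) = - pairing nu b.
  by rewrite -[theta D]opprK -unu pairingNl pairing_orth.
have nub : ~~ pos (u *m b).
  by apply/negP => /pairing_theta_ge0; rewrite thub oppr_ge0 leNgt c_gt0.
case: ed => [/Bpos|lv]; first by rewrite (negPf nub).
apply/eqP; apply: contraT => nu_b; exfalso.
have pNub : pos (- (u *m b)) by rewrite posN.
have Nub_th : - (u *m b) != theta D.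
  apply: contraNneq nu_b => ubE; apply/eqP; apply: (orth_inj Ou).
  by rewrite unu -ubE opprK.
have c1 : pairing nu b = 1.
  have := pairing_theta pNub Nub_th; rewrite pairingNr thub opprK.
  by case=> // c0; move: c_gt0; rewrite c0 ltxx.
have Wth := weyl_refl (theta_root D).
(* With pairing 1, [refl theta] sends [u *m b] to a positive root, so [refl b] lengthens
   [refl theta *m u]. Yet [len_theta] at two elements and the quantum condition make the product one
   shorter. *)
have : (len D (refl (theta D) *m u) < len D (refl (theta D) *m u *m refl b))%N.
  apply: len_refl_gt => //; first exact: weylM.
  rewrite -mulmxA reflE thub c1 scaleN1r opprK addrC -[u *m b]opprK.
  apply: pos_theta_sub; first exact: pos_mem.
  by rewrite pairingNr thub c1 opprK.
have vth : (u *m refl b)^T *m theta D = - (refl b *m nu).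
  by rewrite trmx_mul refl_tr -mulmxA -[theta D]opprK mulmxN -nuE mulmxN.
have := len_theta Wv; rewrite vth posN ?roots_refl // => /(_ nnu).
have uth : (refl (theta D) *m u)^T *m theta D = nu.
  by rewrite trmx_mul refl_tr -mulmxA refl_self -nuE.
have := len_theta (weylM Wth Wu); rewrite uth => /(_ pnu).
rewrite !mulmxA reflK mul1mx pairingNl pairing_refll c1 lv -(ltr_nat R).
by clear; lra.
Qed.
End QuantumEdges.

(** * String functions of paths with integral valleys *)

Section RealFunctions.
Variable R : realType.
Implicit Types (H : R -> R) (a b c s t u v x y C m : R).

Lemma int_ltS x y : x \is a Num.int -> y \is a Num.int -> x < y -> x + 1 <= y.
Proof. by move=> /intrP[k ->] /intrP[l ->]; rewrite ltr_int -(intrD _ k 1) ler_int lezD1. Qed.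

Definition lipschitz_on H a b C : Prop := forall x y,
  a <= x -> x <= y -> y <= b -> `|H y - H x| <= C * (y - x).

(** The time is the supremum of those with value at least [c]; the Lipschitz bound, standing in for
    continuity, excludes both a larger and a smaller value there. *)
Lemma last_time H a b C c : lipschitz_on H a b C -> a <= b -> H b <= c -> c <= H a ->
  exists t, [/\ a <= t, t <= b, H t = c & forall x, t < x -> x <= b -> H x < c].
Proof.
move=> lipH ab Hb Ha; pose S := [set x | [/\ a <= x, x <= b & c <= H x]]%classic.
have Sa : S a by [].
have supS : has_sup S by split; [exists a | exists b => x []].
have C0 : 0 < `|C| + 1 by rewrite ltr_wpDl.
have lip x y : a <= x -> x <= y -> y <= b -> `|H y - H x| <= (`|C| + 1) * (y - x).
  move=> ax xy yb; apply: le_trans (lipH _ _ ax xy yb) _.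
  by rewrite ler_wpM2r ?subr_ge0 // ler_wpDr ?ler_norm.
pose t := sup S; have at_ : a <= t by exact: sup_upper_bound.
have tb : t <= b by apply: ge_sup; [exists a | move=> x []].
have Ht : H t = c.
  apply: le_anti; apply/andP; split; rewrite leNgt; apply/negP => lt.
    have tb' : t < b.
      rewrite lt_neqAle tb andbT; apply: contraTneq lt => ->; by rewrite -leNgt.
    pose x := Num.min b (t + (H t - c) / (`|C| + 1)).
    have d0 : 0 < (H t - c) / (`|C| + 1) by rewrite divr_gt0 ?subr_gt0.
    have tx : t < x by rewrite lt_min tb' ltrDl.
    have xb : x <= b by rewrite ge_min lexx.
    suff Sx : S x by have := sup_upper_bound supS Sx; rewrite leNgt tx.
    split=> //; first exact: le_trans (ltW tx).
    have := lip _ _ at_ (ltW tx) xb; rewrite distrC => /(le_trans (ler_norm _)).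
    have : x - t <= (H t - c) / (`|C| + 1) by rewrite lerBlDl ge_min lexx orbT.
    by rewrite ler_pdivlMr // mulrC; lra.
  have d0 : 0 < (c - H t) / (`|C| + 1) by rewrite divr_gt0 ?subr_gt0.
  have [x [ax xb cx] xt] := sup_adherent d0 supS.
  have le_xt : x <= t by exact: sup_upper_bound.
  have := lip _ _ ax le_xt tb; rewrite distrC => /(le_trans (ler_norm _)).
  have : t - x < (c - H t) / (`|C| + 1) by move: xt; rewrite -/t; lra.
  by rewrite ltr_pdivlMr // mulrC; lra.
exists t; split=> // x tx xb; rewrite ltNge; apply/negP => cx.
suff Sx : S x by have := sup_upper_bound supS Sx; rewrite leNgt tx.
by split=> //; exact: le_trans (ltW tx).
Qed.

Lemma first_time H a b C c : lipschitz_on H a b C -> a <= b -> H b <= c -> c <= H a ->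
  exists t, [/\ a <= t, t <= b, H t = c & forall x, a <= x -> x < t -> c < H x].
Proof.
move=> lipH ab Hb Ha.
(* Reversing both time and sign exchanges first and last times. *)
have lipN : lipschitz_on (fun x => - H (- x)) (- b) (- a) C.
  move=> x y bx xy ya; rewrite opprK addrC.
  have -> : y - x = - x - - y by rewrite opprK addrC.
  by apply: lipH; [rewrite lerNr|rewrite lerN2|rewrite lerNl].
have [|||t [bt ta Ht tlast]] := @last_time _ _ _ _ (- c) lipN.
- by rewrite lerN2.
- by rewrite opprK lerN2.
- by rewrite opprK lerN2.
exists (- t); split; [by rewrite lerNr|by rewrite lerNl|by rewrite -[LHS]opprK Ht opprK|].
move=> x ax xt; rewrite -ltrN2 -{1}[x]opprK; apply: tlast; first by rewrite ltrNr.
by rewrite lerN2.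
Qed.

(** Encodes that local minima lie in [Q], without derivatives and in a way that tolerates flat
    stretches. Allowing the two ends of the subinterval makes the notion stable under gluing at a
    point of [Q]. *)
Definition valleys_in (Q : R -> Prop) H a b : Prop := forall s v,
  a <= s -> s <= v -> v <= b -> exists u,
  [/\ s <= u, u <= v, forall x, s <= x -> x <= v -> H u <= H x &
      [\/ Q u, u = s | u = v]].

Lemma valleys_cat Q H a b c : a <= b -> b <= c -> Q b ->
  valleys_in Q H a b -> valleys_in Q H b c -> valleys_in Q H a c.
Proof.
move=> ab bc Qb Hab Hbc s v as_ sv vc.
have [vb|bv] := leP v b; first exact: Hab.
have [sb|bs] := leP s b; last by apply: Hbc => //; exact: ltW.
have [u [su ub umin Qu]] := Hab _ _ as_ sb (lexx b).
have [w [bw wv wmin Qw]] := Hbc _ _ (lexx b) (ltW bv) vc.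
have Qu' : Q u \/ u = s by case: Qu => [|->|->]; [left|right|left].
have Qw' : Q w \/ w = v by case: Qw => [|->|->]; [left|left|right].
have [uw|wu] := leP (H u) (H w).
  exists u; split=> //; first exact: le_trans (ltW bv).
    move=> x sx xv; have [xb|/ltW bx] := leP x b; first exact: umin.
    exact: le_trans (wmin _ bx xv).
  by case: Qu' => [?|?]; [apply: Or31|apply: Or32].
exists w; split=> //; first exact: le_trans bw.
  move=> x sx xv; have [xb|/ltW bx] := leP x b; last exact: wmin.
  exact: le_trans (ltW wu) (umin _ sx xb).
by case: Qw' => [?|?]; [apply: Or31|apply: Or33].
Qed.

Lemma valleys_mono Q H a b :
  (forall x y, a <= x -> x <= y -> y <= b -> H x <= H y) -> valleys_in Q H a b.
Proof.
move=> mono s v as_ sv vb; exists s; split=> // [x sx xv|]; last exact: Or32.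
by apply: mono => //; exact: le_trans vb.
Qed.

Lemma lipschitz_cat H a b c C : lipschitz_on H a b C -> lipschitz_on H b c C ->
  lipschitz_on H a c C.
Proof.
move=> Hab Hbc x y ax xy yc; have [yb|/ltW by_] := leP y b; first exact: Hab.
have [xb|/ltW bx] := leP x b; last exact: Hbc.
have -> : H y - H x = (H y - H b) + (H b - H x) by rewrite addrA subrK.
apply: (le_trans (ler_normD _ _)).
have -> : y - x = (y - b) + (b - x) by rewrite addrA subrK.
by rewrite mulrDr; apply: lerD; [apply: Hbc|apply: Hab].
Qed.

Section Pieces.
Variables (T : nat -> R) (n : nat) (H : R -> R).
Hypothesis T_le : forall q, (q <= n)%N -> T q <= T q.+1.

Lemma pieces_mono q q' : (q <= q')%N -> (q' <= n.+1)%N -> T q <= T q'.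
Proof.
elim: q' => [|q' IH]; first by rewrite leqn0 => /eqP->.
rewrite leq_eqVlt => /predU1P[->//|]; rewrite ltnS => qq' qn.
by apply: le_trans (IH qq' (ltnW qn)) _; exact: T_le.
Qed.

Lemma lipschitz_pieces C : (forall q, (q <= n)%N -> lipschitz_on H (T q) (T q.+1) C) ->
  lipschitz_on H (T 0) (T n.+1) C.
Proof.
move=> lip; have {}lip q : (q <= n)%N -> lipschitz_on H (T 0) (T q.+1) C.
  elim: q => [|q IH] qn; first exact: lip.
  exact: lipschitz_cat (IH (ltnW qn)) (lip _ qn).
exact: lip.
Qed.

Definition nonincreasing_on a b : Prop := forall x y,
  a <= x -> x <= y -> y <= b -> H y <= H x.

Lemma nonincreasing_pieces q q' : (q <= q')%N -> (q' <= n.+1)%N ->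
  (forall k, (q <= k)%N -> (k < q')%N -> nonincreasing_on (T k) (T k.+1)) ->
  nonincreasing_on (T q) (T q').
Proof.
elim: q' => [|q' IH]; first rewrite leqn0 => /eqP-> _ _ x y qx xy yq.
  by have -> : y = x by apply: le_anti; rewrite xy (le_trans yq).
rewrite leq_eqVlt => /predU1P[-> _ _ x y qx xy yq|].
  by have -> : y = x by apply: le_anti; rewrite xy (le_trans yq).
rewrite ltnS => qq' qn dec x y qx xy yq.
have {}IH : nonincreasing_on (T q) (T q').
  by apply: IH => //; [exact: ltnW|move=> k qk kq'; apply: dec => //; exact: ltnW].
have lst : nonincreasing_on (T q') (T q'.+1) by apply: dec.
have [yT|/ltW Ty] := leP y (T q'); first exact: IH.
have [xT|/ltW Tx] := leP x (T q'); last exact: lst.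
exact: le_trans (lst _ _ (lexx _) Ty yq) (IH _ _ qx xT (lexx _)).
Qed.

(** A valley needs a descent followed by an ascent, so it can be placed where [dec] switches off.
    Pieces may be flat or reduced to a point, which is why [dec] is given and not read off [H]. *)
Lemma valleys_pieces (Q : R -> Prop) (dec : nat -> bool) :
  (forall q, (q <= n)%N -> dec q -> nonincreasing_on (T q) (T q.+1)) ->
  (forall q x y, (q <= n)%N -> ~~ dec q -> T q <= x -> x <= y -> y <= T q.+1 ->
     H x <= H y) ->
  (forall q, (q < n)%N -> dec q -> ~~ dec q.+1 -> Q (T q.+1)) ->
  valleys_in Q H (T 0) (T n.+1).
Proof.
move=> Hdec Hinc HQ.
pose minimum s v u := [/\ s <= u, u <= v & forall x, s <= x -> x <= v -> H u <= H x].
suff main q : (q <= n)%N -> valleys_in Q H (T 0) (T q.+1) /\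
   (~~ dec q -> forall s v, T 0 <= s -> s <= v -> T q <= v -> v <= T q.+1 ->
     exists u, minimum s v u /\ (Q u \/ u = s)).
  by have [] := main n (leqnn n).
have ext k s v u : (k <= n)%N -> ~~ dec k -> T k <= v -> v <= T k.+1 ->
    minimum s (T k) u -> minimum s v u.
  move=> qn nd qv vq [su uq umin]; split=> //; first exact: le_trans uq qv.
  move=> x sx xv; have [xq|/ltW qx] := leP x (T k); first exact: umin.
  apply: le_trans (umin _ (le_trans su uq) (lexx _)) _.
  by apply: Hinc qn nd _ _ _ => //; exact: le_trans vq.
elim: q => [|q IH] qn.
  split=> [s v s0 sv v1|nd s v s0 sv _ v1].
    have [d|nd] := boolP (dec 0%N).
      exists v; split=> // [x sx xv|]; last exact: Or33.
      by apply: (Hdec 0%N) => //; exact: le_trans sx.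
    exists s; split=> // [x sx xv|]; last exact: Or32.
    by apply: (Hinc 0%N) => //; exact: le_trans v1.
  exists s; split; last by right.
  split=> // x sx xv; apply: (Hinc 0%N) => //; exact: le_trans v1.
have [vq inc] := IH (ltnW qn); have T0q : T 0%N <= T q.+1 by exact/pieces_mono/leqW.
have nd_case : ~~ dec q.+1 -> forall s v, T 0%N <= s -> s <= v -> T q.+1 <= v ->
    v <= T q.+2 -> exists u, minimum s v u /\ (Q u \/ u = s).
  move=> nd s v s0 sv qv vq'; have [qs|/ltW sq] := leP (T q.+1) s.
    exists s; split; last by right.
    split=> // x sx xv; apply: Hinc qn nd qs sx _; exact: le_trans vq'.
  have [u [umin Qu]] : exists u, minimum s (T q.+1) u /\ (Q u \/ u = s).
    have [d|nd'] := boolP (dec q).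
      have [u [su uT umin Qu]] := vq _ _ s0 sq (lexx _).
      exists u; split=> //; case: Qu => [|->|->]; [by left|by right|left].
      exact: HQ.
    by apply: inc => //; exact: T_le (ltnW qn).
  by exists u; split=> //; exact: ext umin.
split=> // s v s0 sv vq'.
have [vT|/ltW Tv] := leP v (T q.+1); first exact: vq.
have [d|nd] := boolP (dec q.+1); last first.
  have [u [[su uv umin] Qu]] := nd_case nd s v s0 sv Tv vq'.
  exists u; split=> //; by case: Qu => [?|?]; [apply: Or31|apply: Or32].
have [Ts|/ltW sT] := leP (T q.+1) s.
  exists v; split=> // [x sx xv|]; last exact: Or33.
  by apply: (Hdec _ qn d) => //; exact: le_trans sx.
have [u [su uT umin Qu]] := vq _ _ s0 sT (lexx _).
have [vu|uv] := leP (H v) (H u).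
  exists v; split=> // [x sx xv|]; last exact: Or33.
  have [xT|/ltW Tx] := leP x (T q.+1); first exact: le_trans vu (umin _ sx xT).
  exact: (Hdec _ qn d).
exists u; split=> //; first exact: le_trans uT Tv.
  move=> x sx xv; have [xT|/ltW Tx] := leP x (T q.+1); first exact: umin.
  apply: le_trans (ltW uv) _; exact: (Hdec _ qn d).
case: Qu => [?|?|uE]; [exact: Or31|exact: Or32|].
have := Hdec _ qn d _ _ (lexx _) Tv vq'; rewrite -uE => vu.
by move: uv; rewrite ltNge vu.
Qed.

End Pieces.

End RealFunctions.

Section StringFunction.
Variables (R : realType) (r : nat) (D : root_system R r) (p : affine_index r).
Implicit Types (eta : vpath R r) (a b c s t u v x y C m : R).
Local Notation alpha := (affine_root D p).
Local Notation ht := (height D p).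

Lemma affine_root_mem : alpha \in Defs.roots D.
Proof.
case: p => [i|] /=; first exact: simple_root.
exact/root_opp/theta_root.
Qed.

Lemma affine_reflE : affine_refl D p = refl alpha.
Proof. by case: p => [i|] //=; rewrite reflN. Qed.

Lemma pairing_alpha : pairing alpha alpha = 2.
Proof. exact/pairing_self/(root_neq0 affine_root_mem). Qed.

(** The root operator with its two times left free, so that they can be supplied by [first_time] and
    [last_time]. *)
Definition reflected_path eta t0 t1 : vpath R r := fun t =>
  if t <= t0 then eta t
  else if t <= t1 then eta t0 + affine_refl D p *m (eta t - eta t0)
  else eta t + alpha.

Lemma height_minE eta m u : 0 <= u -> u <= 1 -> ht eta u = m ->
  (forall x, 0 <= x -> x <= 1 -> m <= ht eta x) -> height_min D p eta = m.
Proof.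
move=> u0 u1 um lbm; apply: set_minE => [|y [x /andP[x0 x1] <-]]; last exact: lbm.
by exists u => //; apply/andP.
Qed.

Lemma e_opE eta m t0 t1 : 0 <= t0 -> t0 <= t1 -> t1 <= 1 -> m != 0 ->
  (forall x, 0 <= x -> x <= 1 -> m <= ht eta x) ->
  ht eta t1 = m -> (forall x, 0 <= x -> x < t1 -> m < ht eta x) ->
  ht eta t0 = m + 1 -> (forall x, t0 < x -> x <= t1 -> ht eta x < m + 1) ->
  e_op D p eta = Some (reflected_path eta t0 t1).
Proof.
move=> t00 t01 t11 m0 mmin ht1 first ht0 last.
have t10 := le_trans t00 t01.
rewrite /e_op (height_minE t10 t11 ht1) // (negPf m0); congr Some.
have e1 : e_t1 D p eta = t1.
  apply: set_minE; first by rewrite /= (height_minE t10 t11 ht1) // t10 t11.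
  move=> y [/andP[y0 y1]]; rewrite (height_minE t10 t11 ht1) // => ym.
  by rewrite leNgt; apply/negP => /(first _ y0); rewrite ym ltxx.
rewrite e1; have -> // : e_t0 D p eta = t0.
apply: set_maxE; first by rewrite /= (height_minE t10 t11 ht1) // e1 t00 t01.
move=> y [/andP[y0]]; rewrite (height_minE t10 t11 ht1) // e1 => y1 ym.
by rewrite leNgt; apply/negP => /last/(_ y1); rewrite ym ltxx.
Qed.

(** The invariant behind the string function: it passes from a path to its image under [e_op], so
    the iterates can be counted without identifying them. *)
Definition integral_valleys eta : Prop :=
  [/\ ht eta 0 = 0, ht eta 1 \is a Num.int,
      exists C, lipschitz_on (ht eta) 0 1 C &
      valleys_in (fun u => ht eta u \is a Num.int) (ht eta) 0 1].

Lemma integral_valleys_min eta : integral_valleys eta -> exists u,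
  [/\ 0 <= u, u <= 1, ht eta u \is a Num.int &
      forall x, 0 <= x -> x <= 1 -> ht eta u <= ht eta x].
Proof.
move=> [H0 H1 _ /(_ 0 1 (lexx 0) ler01 (lexx 1))[u [u0 u1 umin Qu]]].
by exists u; split=> //; case: Qu => [//|->|->]; rewrite ?H0 ?rpred0.
Qed.

Lemma height_reflected eta t0 t1 m t : ht eta t0 = m + 1 ->
  ht (reflected_path eta t0 t1) t =
  if t <= t0 then ht eta t else if t <= t1 then 2 * (m + 1) - ht eta t
  else ht eta t + 2.
Proof.
rewrite /height /reflected_path => h0; case: ifP => // _; case: ifP => _; last first.
  by rewrite pairingDr pairing_alpha.
rewrite affine_reflE reflE pairingDr !pairingBr pairingZr pairing_alpha h0.
ring.
Qed.

(** Integrality of valleys keeps the path at height at least [m + 1] up to [t0] and makes it descend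
    on [[t0], [t1]]. Reflection turns this descent into an ascent from [m + 1], and the rest is
    raised by 2, so the new minimum is [m + 1]. *)
Lemma e_op_integral_valleys eta : integral_valleys eta -> height_min D p eta != 0 ->
  exists eta', [/\ e_op D p eta = Some eta', integral_valleys eta' &
                   height_min D p eta' = height_min D p eta + 1].
Proof.
move=> ieta; have [H0 H1 [C lipH] vH] := ieta.
have [u [u0 u1 iu umin]] := integral_valleys_min ieta.
rewrite (height_minE u0 u1 erefl) //; set m := ht eta u in iu umin * => m0.
have mlt0 : m < 0 by rewrite lt_neqAle m0 /= -H0 umin.
have mle : m <= -1.
  by have := int_ltS iu (rpred0 _) mlt0; lra.
have sub a b : 0 <= a -> b <= 1 -> lipschitz_on (ht eta) a b C.
  by move=> a0 b1 x y ax xy yb; apply: lipH => //; [exact: le_trans ax|exact: le_trans b1].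
have [|t1 [t10 t1u ht1 first]] := first_time (c := m) (sub 0 u (lexx 0) u1) u0 (lexx m).
  by rewrite H0 ltW.
have t11 := le_trans t1u u1.
have [||t0 [t00 t01 ht0 last]] := last_time (c := m + 1) (sub 0 t1 (lexx 0) t11) t10.
- by rewrite ht1; lra.
- by rewrite H0; lra.
exists (reflected_path eta t0 t1).
have hE := @height_reflected eta t0 t1 m _ ht0.
have lt01 : t0 < t1.
  by rewrite lt_neqAle t01 andbT; apply: contra_eq_neq ht0 => ->; rewrite ht1; lra.
have m1_int : m + 1 \is a Num.int by rewrite rpredD ?rpred1.
have int_ge x : ht eta x \is a Num.int -> m < ht eta x -> m + 1 <= ht eta x.
  by move=> ix; exact: int_ltS.
have t01' := le_trans t01 t11.
have low x : 0 <= x -> x <= t0 -> m + 1 <= ht eta x.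
  have [v [v0 vt vmin Qv]] := vH _ _ (lexx 0) t00 t01'.
  move=> x0 xt; apply: le_trans (vmin _ x0 xt); apply: int_ge.
    by case: Qv => [//|->|->]; rewrite ?H0 ?ht0 ?rpred0.
  by apply: first => //; exact: le_lt_trans lt01.
(* A rise from [x] to [y] would create a valley below [m + 1] and before [t1]. Being integral and
   above [m], it cannot exist. *)
have noninc x y : t0 <= x -> x <= y -> y <= t1 -> ht eta y <= ht eta x.
  move=> tx xy yt; rewrite leNgt; apply/negP => lt.
  have [v [vt vy vmin Qv]] := vH _ _ t00 (le_trans tx xy) (le_trans yt t11).
  have vx := vmin _ tx xy.
  have x_t0 : t0 < x.
    rewrite lt_neqAle tx andbT; apply: contraTneq lt => <-; rewrite -leNgt ht0.
    have [yt0|ty] := leP y t0; last exact/ltW/last.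
    by have -> : y = t0; [apply: le_anti; rewrite yt0 (le_trans tx)|rewrite ht0].
  have hx := last _ x_t0 (le_trans xy yt).
  have vlt : ht eta v < m + 1 by exact: le_lt_trans hx.
  case: Qv => [iv|v0|vE]; last by move: lt; rewrite -vE ltNge vx.
    have v0 := le_trans t00 vt; have [vt1|tv] := ltP v t1.
      by have := int_ge _ iv (first _ v0 vt1); rewrite leNgt vlt.
    have yv : y = v by apply: le_anti; rewrite vy (le_trans yt tv).
    by move: lt; rewrite yv ltNge vx.
  by move: vlt; rewrite v0 ht0 ltxx.
have h1 x : 0 <= x -> x <= t0 -> ht (reflected_path eta t0 t1) x = ht eta x + 0.
  by move=> _ xt; rewrite hE xt addr0.
have h2 x : t0 <= x -> x <= t1 -> ht (reflected_path eta t0 t1) x = 2 * (m + 1) - ht eta x.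
  move=> tx xt; rewrite hE xt; case: ifP => // xt0.
  have -> : x = t0 by apply: le_anti; rewrite tx xt0.
  by rewrite ht0; ring.
have h3 x : t1 <= x -> x <= 1 -> ht (reflected_path eta t0 t1) x = ht eta x + 2.
  move=> tx xt; rewrite hE leNgt (lt_le_trans lt01) //=; case: ifP => // xt1.
  have -> : x = t1 by apply: le_anti; rewrite tx xt1.
  by rewrite ht1; ring.
split.
- exact: (e_opE t00 t01 t11 m0).
- split.
  + by rewrite h1 // addr0.
  + by rewrite h3 // rpredD // -[2]/(2%:R) natr_int.
  + exists C; apply: (@lipschitz_cat _ _ _ t1); first apply: (@lipschitz_cat _ _ _ t0).
    * move=> x y ax xy yb; have x0 := le_trans xy yb; have y0 := le_trans ax xy.
      by rewrite !h1 // !addr0; apply: lipH => //; exact: le_trans yb _.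
    * move=> x y ax xy yb; have xt := le_trans xy yb; have ty := le_trans ax xy.
      rewrite !h2 // opprB addrC addrA subrK distrC.
      by apply: lipH => //; [exact: le_trans ax|exact: le_trans t11].
    * move=> x y ax xy yb; have xt := le_trans xy yb; have ty := le_trans ax xy.
      rewrite !h3 // opprD addrACA subrr addr0.
      by apply: lipH => //; exact: le_trans ax.
  + have Qt0 : ht (reflected_path eta t0 t1) t0 \is a Num.int by rewrite h1 ?addr0 ?ht0.
    have Qt1 : ht (reflected_path eta t0 t1) t1 \is a Num.int.
      by rewrite h3 // ht1 rpredD // -[2]/(2%:R) natr_int.
    apply: (@valleys_cat _ _ _ _ t1) => //; first apply: (@valleys_cat _ _ _ _ t0) => //.
    * move=> s v s0 sv vt0; have [w [sw wv wmin Qw]] := vH _ _ s0 sv (le_trans vt0 t01').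
      have w0 := le_trans s0 sw; have wt0 := le_trans wv vt0.
      exists w; split=> // [x sx xv|]; first by rewrite !h1 ?addr0 ?wmin ?(le_trans s0) ?(le_trans xv).
      by case: Qw => [?|->|->]; [apply: Or31; rewrite h1 ?addr0|apply: Or32|apply: Or33].
    * apply: valleys_mono => x y tx xy yt.
      have ty := le_trans tx xy; have xt := le_trans xy yt.
      by rewrite !h2 // lerD2l lerN2 noninc.
    * move=> s v ts sv v1; have [w [sw wv wmin Qw]] := vH _ _ (le_trans t10 ts) sv v1.
      have tw := le_trans ts sw; have w1 := le_trans wv v1.
      exists w; split=> // [x sx xv|].
        have tx := le_trans ts sx; have x1 := le_trans xv v1.
        by rewrite !h3 // lerD2r wmin.
      case: Qw => [?|->|->]; [apply: Or31|exact: Or32|exact: Or33].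
      by rewrite h3 // rpredD // -[2]/(2%:R) natr_int.
- apply: (@height_minE _ _ t0) => //; first by rewrite h1 // addr0.
  move=> x x0 x1; have [xt0|/ltW tx] := leP x t0; first by rewrite h1 // addr0 low.
  have [xt1|/ltW tx1] := leP x t1.
    rewrite h2 //; have := noninc _ _ (lexx t0) tx xt1; rewrite ht0; lra.
  by rewrite h3 //; have := umin _ x0 x1; rewrite -/m; lra.
Qed.

Lemma iter_e_op (n : nat) : iter n (obind (e_op D p)) None = None.
Proof. by elim: n => //= n ->. Qed.

Lemma epsilonE eta (M : nat) : integral_valleys eta ->
  height_min D p eta = - M%:R -> epsilon D p eta = M.
Proof.
move=> ieta hM.
suff iterP n : iter n (obind (e_op D p)) (Some eta) <> None <-> (n <= M)%N.
  by apply: set_maxE => [|n /iterP//]; apply/iterP.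
elim: M n eta ieta hM => [|M IH] [|n] eta ieta hM; first by split.
- have eN : e_op D p eta = None by rewrite /e_op hM oppr0 eqxx.
  by rewrite iterSr /= eN iter_e_op; split=> // /(_ erefl).
- by split.
- have [|eta' [e' ieta' hM']] := e_op_integral_valleys ieta.
    by rewrite hM oppr_eq0 pnatr_eq0.
  rewrite iterSr /= e' ltnS; apply: IH => //.
  by rewrite hM' hM -natr1; ring.
Qed.

End StringFunction.

(** * Unit strips met by a folded path *)

(* [N q] is the number of the unit strip between integral levels of [alpha]
   occupied by the folded alcove path before position [q], and [s q] tells
   whether it descends there; [K q] is the level met at position [q]. *)
Section FoldedStrips.
Variables (m : nat) (I inA s : nat -> bool) (N K : nat -> int) (d : nat).
Hypothesis N_start : N 0 = - d%:Z.
Hypothesis N_end : N m = K m - (~~ s m)%:Z.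
Hypothesis N_before : forall q, (q < m)%N -> I q -> N q = K q - (~~ s q)%:Z.
Hypothesis N_after : forall q, (q < m)%N -> I q -> N q.+1 = K q - (s q.+1)%:Z.
Hypothesis s_fold : forall q, (q < m)%N -> I q -> s q.+1 = s q (+) inA q.
Hypothesis N_const : forall q, (q < m)%N -> ~~ I q -> N q.+1 = N q.
Hypothesis s_homo : forall q, (q < m)%N -> ~~ I q -> s q -> s q.+1.

Lemma strip_gap a b : (a <= b)%N -> (b <= m)%N ->
  (forall q, (a <= q)%N -> (q < b)%N -> ~~ I q) ->
  N b = N a /\ forall q, (a <= q)%N -> (q <= b)%N -> s a -> s q.
Proof.
elim: b => [|b IH] ab bm nI.
  move: ab; rewrite leqn0 => /eqP->; split=> // q _.
  by rewrite leqn0 => /eqP->.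
move: ab; rewrite leq_eqVlt => /predU1P[<-|]; first split=> // q aq qa.
  by have -> : q = a by apply/eqP; rewrite eqn_leq aq qa.
rewrite ltnS => ab; have [|Nb sb] := IH ab (ltnW bm).
  by move=> q aq qb; apply: nI => //; exact: ltnW.
have nIb : ~~ I b by apply: nI.
split=> [|q aq]; first by rewrite N_const.
rewrite leq_eqVlt => /predU1P[-> sa|]; last by rewrite ltnS; exact: sb.
exact/s_homo/sb.
Qed.

Lemma strip_pred b :
  (exists k, [/\ (k < b)%N, I k & forall q, (k < q)%N -> (q < b)%N -> ~~ I q]) \/
  (forall q, (q < b)%N -> ~~ I q).
Proof.
elim: b => [|b IH]; first by right.
have [Ib|nIb] := boolP (I b).
  left; exists b; split=> // q bq; rewrite ltnS => qb.
  by move: (leq_ltn_trans qb bq); rewrite ltnn.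
case: IH => [[k [kb Ik nI]]|nI]; [left|right].
  exists k; split=> // [|q kq]; first exact: ltnW.
  by rewrite ltnS leq_eqVlt => /predU1P[->//|]; exact: nI.
by move=> q; rewrite ltnS leq_eqVlt => /predU1P[->//|]; exact: nI.
Qed.

Lemma strip_succ a : (a <= m)%N -> exists b, [/\ (a <= b)%N, (b <= m)%N,
  I b || (b == m) & forall q, (a <= q)%N -> (q < b)%N -> ~~ I q].
Proof.
move=> am; have ex : exists b, [&& (a <= b)%N, (b <= m)%N & I b || (b == m)].
  by exists m; rewrite am leqnn eqxx orbT.
case: (ex_minnP ex) => b /and3P[ab bm Ib] bmin; exists b; split=> // q aq qb.
apply/negP => Iq; have := bmin q; rewrite aq Iq (ltnW (leq_trans qb bm)) /=.
by rewrite leqNgt qb => /(_ isT).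
Qed.

Lemma N_at q : (q <= m)%N -> I q || (q == m) -> N q = K q - (~~ s q)%:Z.
Proof.
rewrite leq_eqVlt => /predU1P[-> _|qm]; first exact: N_end.
by rewrite ltn_eqF // orbF; exact: N_before.
Qed.

Variables (mu : int) (l : nat).
Hypothesis mu_min : forall q, (q <= m)%N -> I q || (q == m) -> mu <= K q.
Hypothesis lm : (l <= m)%N.
Hypothesis Il : I l || (l == m).
Hypothesis Kl : K l = mu.
Hypothesis mu_first : forall q, (q < l)%N -> I q -> mu < K q.
Hypothesis mu_lt : mu < - d%:Z.

(** Between consecutive positions of [I] the strip is constant and a descent persists. Comparing the
    strip numbers at the two ends leaves one possible configuration of levels and signs. *)
Lemma minimal_fold : exists k, [/\ (k < l)%N, I k,
   [/\ forall q, (k < q)%N -> (q < l)%N -> ~~ I q,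
   K k = mu + 1, s k & ~~ inA k],
   forall q, (k < q)%N -> (q <= l)%N -> s q &
   (l < m)%N -> inA l].
Proof.
have Nl := N_at lm Il; rewrite Kl in Nl.
(* Without an earlier position of [I] the path would still be in the initial strip [- d], which lies
   above [mu]. *)
have no_start b : (forall q, (q < b)%N -> ~~ I q) -> (b <= m)%N -> N b = - d%:Z.
  move=> nI bm; have [|-> _] := strip_gap (leq0n b) bm; last exact: N_start.
  by move=> q _; exact: nI.
case: (strip_pred l) => [[k [kl Ik nI]]|nI]; last first.
  by move: mu_lt Nl; rewrite (no_start l) //; case: (s l) => /=; clear; lia.
have km := leq_trans kl lm.
have [|Ngap sgap] := strip_gap kl lm; first by move=> q kq ql; exact: nI.
have muk := mu_first kl Ik; have Nk := N_after km Ik.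
(* The strip left at [k] is the one from which [l] is met. As the level at [k] exceeds [mu], it is
   the strip from [mu] to [mu + 1], entered at its top and followed down to its bottom. *)
have [Kk [sk1 sl]] : K k = mu + 1 /\ s k.+1 /\ s l.
  move: Nk Nl muk; rewrite Ngap => ->.
  by case: (s k.+1); case: (s l) => /=; clear; lia.
have sq q : (k < q)%N -> (q <= l)%N -> s q by move=> kq ql; exact: sgap.
have Nk0 := N_before km Ik.
(* A fold at [k] would mean arriving there inside the strip above [mu] without descending. The
   preceding position has level above [mu], so it would have been left descending, and the descent
   persists. *)
have nAk : ~~ inA k.
  apply/negP => Ak; have sk : s k = false.
    by have := s_fold km Ik; rewrite Ak addbT sk1 => /esym/negbTE.
  have Nmu : N k = mu by rewrite Nk0 Kk sk /=; clear; lia.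
  case: (strip_pred k) => [[j [jk Ij nIj]]|nIk]; last first.
    by move: mu_lt; rewrite -Nmu (no_start k) ?(ltnW km) // ltxx.
  have jm := ltn_trans jk km.
  have [|Nj sj] := strip_gap jk (ltnW km); first by move=> q jq qk; exact: nIj.
  have := mu_first (ltn_trans jk kl) Ij; have := N_after jm Ij.
  rewrite -Nj Nmu; case sj1 : (s j.+1) => /=; last by clear; lia.
  by have := sj k jk (leqnn k) sj1; rewrite sk.
have sk : s k by have := s_fold km Ik; rewrite (negPf nAk) addbF sk1.
(* Without a fold at [l] the descent would continue in the strip below [mu], and the next level met
   would be [mu - 1]. *)
exists k; split=> // lm'; apply: contraT => nAl; exfalso.
have Il' : I l by move: Il; rewrite ltn_eqF // orbF.
have sl1 : s l.+1 by rewrite s_fold // sl (negPf nAl).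
have Nl1 := N_after lm' Il'; rewrite sl1 Kl /= in Nl1.
have [b [lb bm Ib nIb]] := strip_succ lm'.
have [|Nb sb] := strip_gap lb bm; first by [].
have := sb b lb (leqnn b) sl1 => sb1.
have := N_at bm Ib; have := mu_min bm Ib; rewrite Nb Nl1 sb1 /=; clear; lia.
Qed.
End FoldedStrips.

(** * The lexicographic chain and a generic starting point *)

Section LexWeights.
Variable R : realType.

Fixpoint seq_dot (k e : seq R) : R :=
  if k is x :: k' then if e is y :: e' then x * y + seq_dot k' e' else 0 else 0.

Lemma seq_dotZ (c : R) k e : seq_dot k [seq c * y | y <- e] = c * seq_dot k e.
Proof.
elim: k e => [|x k IH] [|y e]; rewrite /= ?mulr0 //.
by rewrite IH mulrDr mulrCA.
Qed.

Lemma seq_dotZl (c : R) k e : seq_dot [seq y / c | y <- k] e = seq_dot k e / c.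
Proof.
elim: k e => [|x k IH] [|y e]; rewrite /= ?mul0r //.
by rewrite IH mulrDl mulrAC.
Qed.

Lemma seq_dotE n (k e : seq R) : size k = n -> size e = n ->
  seq_dot k e = \sum_(i < n) k`_i * e`_i.
Proof.
elim: n k e => [|n IH] [|x k] [|y e] //=; first by rewrite big_ord0.
by move=> [sk] [se]; rewrite big_ord_recl IH.
Qed.

Lemma finite_scale (L : seq (R * R)) : (forall z, z \in L -> 0 < z.1) ->
  exists2 k : R, 0 < k & forall z, z \in L -> k * z.2 < z.1.
Proof.
elim: L => [|z L IH] Lpos; first by exists 1.
have [|k k0 kL] := IH; first by move=> w wL; rewrite Lpos // inE wL orbT.
have z0 : 0 < z.1 by rewrite Lpos ?mem_head.
have n0 : 0 < `|z.2| + 1 by rewrite ltr_wpDl.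
have q0 : 0 < z.1 / (`|z.2| + 1) by rewrite divr_gt0.
exists (Num.min k (z.1 / (`|z.2| + 1))); first by rewrite lt_min k0.
move=> w; rewrite inE => /predU1P[->|wL].
  apply: (@le_lt_trans _ _ (z.1 / (`|z.2| + 1) * `|z.2|)).
    apply: (@le_trans _ _ (Num.min k (z.1 / (`|z.2| + 1)) * `|z.2|)).
      by rewrite ler_wpM2l ?ler_norm // le_min !ltW.
    by rewrite ler_wpM2r // ge_min lexx orbT.
  by rewrite mulrAC ltr_pdivrMr // ltr_pM2l // ltrDl.
have [w2|w2] := leP w.2 0; last first.
  by apply: le_lt_trans (kL _ wL); rewrite ler_wpM2r ?(ltW w2) // ge_min lexx.
apply: (@le_lt_trans _ _ 0); last by rewrite Lpos // inE wL orbT.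
by rewrite mulr_ge0_le0 // le_min !ltW.
Qed.

(* Evaluating at rapidly decreasing weights [e] turns the lexicographic order
   of finitely many sequences into the order of [R]. *)
Lemma lex_weights n (S : seq (seqlexi R)) : exists e : seq R,
  [/\ size e = n.+1, e`_0 = 1, all (fun y => 0 < y) e &
      forall a b : seqlexi R, a \in S -> b \in S -> size a = n.+1 -> size b = n.+1 ->
        (a < b)%O -> seq_dot a e < seq_dot b e].
Proof.
elim: n S => [|n IH] S.
  exists [:: 1]; split=> //=; first by rewrite ltr01.
  move=> [|x [|??]] [|y [|??]] //= _ _ _ _.
  by rewrite ltxi_cons ltxx implybF -ltNge !mulr1 !addr0 => /andP[].
pose tl (a : seqlexi R) : seqlexi R := behead a.
have [e [se e0 epos elex]] := IH (map tl S).
(* Each pair holds a strict gain in the first entry and the loss in the tail that the gain has to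
   outweigh; the factor [k] scales all tails down enough. *)
pose L := [seq z <- [seq (b`_0 - a`_0, seq_dot (tl a) e - seq_dot (tl b) e) |
   a <- S, b <- S] | 0 < z.1].
have [|k k0 kL] := @finite_scale L; first by move=> z; rewrite mem_filter => /andP[].
exists (1 :: [seq k * y | y <- e]); split=> //=.
- by rewrite size_map se.
- rewrite ltr01 all_map; apply/allP => y /(allP epos) y0 /=; exact: mulr_gt0.
move=> [|x a] [|y b] //= aS bS [sa] [sb]; rewrite ltxi_cons => /andP[xy xyab].
rewrite !mulr1 !seq_dotZ.
have [ltxy|yx] := ltP x y; last first.
  rewrite yx /= in xyab; have -> : x = y by apply: le_anti; rewrite xy yx.
  rewrite ltrD2l ltr_pM2l // elex //; [exact: (map_f tl aS)|exact: (map_f tl bS)].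
have /kL /= : (y - x, seq_dot a e - seq_dot b e) \in L.
  rewrite mem_filter /= subr_gt0 ltxy /=.
  by apply/allpairsP; exists (x :: a, y :: b).
by rewrite mulrBr; lra.
Qed.

End LexWeights.

Section Chain.
Variables (R : realType) (r : nat) (D : root_system R r) (lambda : 'cV[R]_r).
Hypothesis hl : dominant_integral D lambda.
Local Notation m := (size (lambda_chain D lambda)).
Implicit Types (A : {set 'I_m}) (i j : 'I_m) (a b v : 'cV[R]_r).
Local Notation pos := (pos_root D).
Local Notation co := (coords (simple D)).
Local Notation rts := (Defs.roots D).
Local Notation al := (simple D).

Lemma pairing_lambda_int a : a \in rts -> pairing a lambda \is a Num.int.
Proof. by apply: pairing_root_int => i; exact: intr_nat. Qed.

Lemma pairing_lambda_nat a : pos a -> pairing a lambda \is a Num.nat.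
Proof.
move=> pa; rewrite natrEint pairing_lambda_int ?pos_mem //=.
by apply: (pairing_dominant_ge0 (D := D)) => // i; exact: natr_ge0.
Qed.

Lemma mem_chain (h : 'cV[R]_r * nat) : h \in lambda_chain D lambda ->
  pos h.1 /\ h.2%:R < pairing h.1 lambda.
Proof.
rewrite mem_sort => /allpairsPdep[b [l [bp ll ->]]] /=.
move: bp ll; rewrite mem_filter mem_iota add0n => /andP[pb _] /= ll; split=> [//|].
by rewrite -(truncnK (pairing_lambda_nat pb)) ltr_nat.
Qed.

Lemma chain_uniq : uniq (lambda_chain D lambda).
Proof.
rewrite sort_uniq; apply: allpairs_uniq_dep => [|a _|].
- by rewrite filter_uniq // roots_uniq.
- exact: iota_uniq.
- by move=> [a l] [b k] /= _ _ [-> ->].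
Qed.

Lemma tnth_chain i : tnth (in_tuple (lambda_chain D lambda)) i = (beta i, level i).
Proof. exact: surjective_pairing. Qed.

Lemma beta_mem i : (beta i, level i) \in lambda_chain D lambda.
Proof. by rewrite -tnth_chain mem_tnth. Qed.

Lemma beta_pos i : pos (beta i).
Proof. by have [] := mem_chain (beta_mem i). Qed.

Lemma level_lt i : (level i)%:R < pairing (beta i) lambda.
Proof. by have [] := mem_chain (beta_mem i). Qed.

Lemma beta_lambda_gt0 i : 0 < pairing (beta i) lambda.
Proof. exact: le_lt_trans (ler0n _ _) (level_lt i). Qed.

Lemma chain_index b (l : nat) : pos b -> l%:R < pairing b lambda ->
  exists i, beta i = b /\ level i = l.
Proof.
move=> pb ll; have : (b, l) \in in_tuple (lambda_chain D lambda).
  rewrite /= mem_sort; apply/allpairsPdep; exists b, l; split=> //.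
    by rewrite mem_filter pb pos_mem.
  by rewrite mem_iota add0n /= -(ltr_nat R) truncnK ?pairing_lambda_nat.
by move=> /tnthP[i]; rewrite tnth_chain => -[-> ->]; exists i.
Qed.

Lemma chain_inj i j : beta i = beta j -> level i = level j -> i = j.
Proof.
move=> bij lij; have := chain_uniq; rewrite -[lambda_chain _ _]/(val (in_tuple _)).
move=> /tuple_uniqP; apply; rewrite !tnth_chain bij lij //.
Qed.

Definition chain_key i : seqlexi R := lex_key D lambda (beta i, level i).

Lemma chain_sorted i j : (i <= j)%N -> (chain_key i <= chain_key j)%O.
Proof.
pose leh (h h' : 'cV[R]_r * nat) := (lex_key D lambda h <= lex_key D lambda h')%O.
have tr : transitive leh by move=> h1 h2 h3; exact: le_trans.
have srt : sorted leh (lambda_chain D lambda).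
  by apply: sort_sorted => h h'; exact: le_total.
move=> ij; have h0 : 'cV[R]_r * nat := (0, 0%N).
have := sorted_leq_nth tr (fun h => lexx _) h0 srt i j.
rewrite !inE !ltn_ord => /(_ isT isT ij).
by rewrite /leh /chain_key -!tnth_chain !(tnth_nth h0).
Qed.

Lemma rel_level_sorted i j : (i <= j)%N -> rel_level i <= rel_level j.
Proof.
move/chain_sorted; rewrite /chain_key /lex_key /= lexi_cons => /andP[].
by [].
Qed.

Lemma rel_level_ge0 i : 0 <= rel_level i.
Proof. by rewrite divr_ge0 // ltW ?beta_lambda_gt0. Qed.

Lemma rel_level_lt1 i : rel_level i < 1.
Proof. by rewrite ltr_pdivrMr ?beta_lambda_gt0 // mul1r level_lt. Qed.

Lemma coroot_basis : (\matrix_(k, l) coroot (al l) k 0) \in unitmx.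
Proof.
have -> : (\matrix_(k, l) coroot (al l) k 0) = (\matrix_(k, l) al l k 0) *m
    diag_mx (\row_k (2 / dot (al k) (al k))).
  apply/matrixP => i j; rewrite mul_mx_diag !mxE mulrC //.
rewrite unitmx_mul simple_basis unitmxE det_diag unitfE; apply/prodf_neq0 => i _.
by rewrite mxE gt_eqF // divr_gt0 // dot_gt0 // (root_neq0 (simple_root D i)).
Qed.

Local Notation cc a := (coords (fun k => coroot (al k)) (coroot a)).

Lemma pairing_coroot_coords a v : pairing a v = \sum_k cc a k 0 * pairing (al k) v.
Proof.
rewrite /pairing {1}(coords_basis_sum (coroot a) coroot_basis) dotC dot_sumr.
by apply: eq_bigr => i _; rewrite dotZr dotC.
Qed.

Lemma coroot_eq_scale a b (c : R) : a \in rts -> b \in rts -> 0 < c ->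
  coroot a = c *: coroot b -> a = b.
Proof.
move=> ra rb c0; rewrite /coroot scalerA => ab.
have a0 := dot_gt0 (root_neq0 ra); have b0 := dot_gt0 (root_neq0 rb).
have abE : a = (dot a a / 2 * (c * (2 / dot b b))) *: b.
  rewrite -scalerA -ab scalerA [X in X *: _](_ : _ = 1) ?scale1r //.
  by field; rewrite gt_eqF.
move: (ra); rewrite abE => /(root_pos_scale rb) ->; first by rewrite scale1r.
by rewrite !(mulr_gt0, divr_gt0, invr_gt0).
Qed.

(** Equal keys make the two coroots positive multiples of each other, so the roots agree since the
    system is reduced, and then the levels do. *)
Lemma chain_key_inj : injective chain_key.
Proof.
move=> i j [lij cij]; have pi := beta_lambda_gt0 i; have pj := beta_lambda_gt0 j.
have cE : coroot (beta i) =
    (pairing (beta i) lambda / pairing (beta j) lambda) *: coroot (beta j).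
  rewrite [LHS](coords_basis_sum _ coroot_basis).
  rewrite {1}(coords_basis_sum (coroot (beta j)) coroot_basis) scaler_sumr.
  apply: eq_bigr => k _; rewrite scalerA; congr (_ *: _).
  have /(congr1 (fun s : seq R => s`_k)) := cij.
  rewrite !(nth_map 0) ?size_map -?enumT ?size_enum_ord //.
  rewrite !(nth_map k) -?enumT ?size_enum_ord // nth_ord_enum.
  move=> /(congr1 (fun z => pairing (beta i) lambda * z)).
  by rewrite mulrC divfK ?gt_eqF // => ->; ring.
have bij : beta i = beta j.
  by apply: coroot_eq_scale cE; rewrite ?pos_mem ?beta_pos // divr_gt0.
apply: chain_inj => //; move: lij; rewrite /= bij.
move=> /(congr1 (fun z => z * pairing (beta j) lambda)).
by rewrite !divfK ?gt_eqF // => /eqP; rewrite eqr_nat => /eqP.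
Qed.

(** The time at which the path starting at [v] with direction [- lambda] meets the hyperplane of
    position [i]; for [v = 0] it is [rel_level i]. *)
Definition perturbed_level v i : R :=
  ((level i)%:R + pairing (beta i) v) / pairing (beta i) lambda.

(* [x0] lies in the fundamental alcove and the path [x0 - t lambda] crosses the
   lambda-hyperplanes one at a time, in the order of the lex chain. *)
Lemma generic_point : exists x0 : 'cV[R]_r,
  [/\ forall b, pos b -> 0 < pairing b x0, forall b, pos b -> pairing b x0 < 1 &
      forall i j, (i < j)%N -> perturbed_level x0 i < perturbed_level x0 j].
Proof.
pose key a (l : nat) : seqlexi R := l%:R :: [seq cc a k 0 | k <- enum 'I_r].
pose one : seqlexi R := 1 :: [seq 0 | k <- enum 'I_r].
(* Besides the keys of the chain, the comparison of [one] with the keys of level 0 is included: it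
   is what gives [pairing b x0 < 1]. *)
pose S : seq (seqlexi R) := [seq chain_key i | i <- enum 'I_m] ++
  one :: [seq key b 0%N | b <- rts].
have [[|y e] [se0 e0 epos0 elex]] := lex_weights r S; first by [].
have se : size e = r by case: se0.
have epos : all (fun y => 0 < y) e by case/andP: epos0.
rewrite /= in e0; rewrite e0 {y se0 e0 epos0} in elex.
pose eps := \col_(k < r) e`_k.
(* The point whose pairings with the simple coroots are the weights [e], so that evaluating a chain
   key at [1 :: e] gives the perturbed level. *)
pose x0 := invmx (\matrix_(k, l) coroot (al l) k 0)^T *m eps.
have x0E k : pairing (al k) x0 = e`_k.
  have : (\matrix_(k, l) coroot (al l) k 0)^T *m x0 = eps.
    by rewrite mulmxA mulmxV ?mul1mx // unitmx_tr coroot_basis.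
  move=> /colP/(_ k); rewrite !mxE => <-; rewrite /pairing dotE.
  by apply: eq_bigr => l _; rewrite !mxE.
have keyE a l : seq_dot (key a l) (1 :: e) = l%:R + pairing a x0.
  rewrite /= mulr1 pairing_coroot_coords (@seq_dotE _ r _ e) ?se ?size_map -?enumT ?size_enum_ord //.
  congr (_ + _); apply: eq_bigr => k _; rewrite x0E (nth_map k) -?enumT ?size_enum_ord //.
  by rewrite nth_ord_enum.
have size_key b l : size (key b l) = r.+1.
  by rewrite /= size_map -?enumT size_enum_ord.
have size_ckey i : size (chain_key i) = r.+1.
  by rewrite /chain_key /lex_key size_map /= size_map -?enumT size_enum_ord.
have cposE b : pos b -> 0 < pairing b x0.
  move=> pb; apply: (pairing_dominant_gt0 (D := D)) => // k.
  by rewrite x0E; apply: (allP epos); rewrite mem_nth // se.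
exists x0; split=> // [b pb|i j ij].
  have -> : pairing b x0 = seq_dot (key b 0%N) (1 :: e) by rewrite keyE add0r.
  have oneE : seq_dot one (1 :: e) = 1.
    rewrite /= mulr1 (@seq_dotE _ r _ e) ?se ?size_map -?enumT ?size_enum_ord // big1 ?addr0 // => k _.
    by rewrite (nth_map k) -?enumT ?size_enum_ord // mul0r.
  rewrite -[ltRHS]oneE; apply: elex; rewrite ?size_key //.
  - rewrite mem_cat inE; apply/orP; right; apply/orP; right.
    exact/(map_f (fun b => key b 0%N))/pos_mem.
  - by rewrite mem_cat mem_head orbT.
  - by rewrite /= size_map -?enumT size_enum_ord.
  - by rewrite ltxi_cons ler01 /= ler10.
have ckE i' : seq_dot (chain_key i') (1 :: e) = perturbed_level x0 i'.
  by rewrite /chain_key /lex_key seq_dotZl keyE.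
rewrite -!ckE; apply: elex; rewrite ?size_ckey ?mem_cat ?map_f ?mem_enum //.
rewrite lt_neqAle chain_sorted 1?ltnW // andbT; apply: contraTneq ij.
by move=> /chain_key_inj ->; rewrite ltnn.
Qed.
End Chain.

(** * The path attached to an admissible subset *)

Section MinReps.
Variables (R : realType) (r : nat) (D : root_system R r) (lambda : 'cV[R]_r).
Implicit Types (x w : 'M[R]_r) (K : {set 'I_r}).

Lemma min_rep_coset K w : weyl_coset D K w (min_rep D K w).
Proof.
rewrite /min_rep; case: xgetP => [x _ []//|nex].
have Sw : [set n | exists2 y, weyl_coset D K w y & len D y = n]%classic (len D w).
  by exists w => //; exists 1%:M; rewrite ?mulmx1 //; exists [::].
have [k [y wy yk] kmin] := nat_has_min Sw.
case: (nex y); split=> // z wz; rewrite yk; apply: kmin; by exists z.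
Qed.

Lemma omega_pairing i : i \in (omega D @: stab_index D lambda)%SET ->
  pairing (simple D i) (longest D *m lambda) = 0.
Proof.
case/imsetP => j; rewrite inE => /eqP jl ->; rewrite /omega.
have OL := weyl_orth (weyl_longest D).
case: pickP => [k /eqP jk|/= nk].
  by rewrite -[simple D k]opprK -jk pairingNl pairing_orth // jl oppr0.
(* The default of [omega] is never taken. If [- longest *m simple D j] were not simple, reflecting
   it in a simple root that pairs positively with it would write the height 1 of [simple D j] as a
   sum exceeding 1. *)
exfalso; pose nw (v : 'cV[R]_r) := - (longest D *m v).
have nw_pos b : pos_root D b -> pos_root D (nw b).
  by move=> pb; rewrite posN ?longest_neg // weyl_root ?pos_mem //; exact: weyl_longest.
have nwK v : nw (nw v) = v by rewrite /nw mulmxN opprK mulmxA longestK mul1mx.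
set a := nw (simple D j); have pa : pos_root D a by apply/nw_pos/pos_simple.
have nsimple k : a != simple D k.
  apply: contraFneq (nk k) => ak; apply/eqP; rewrite -ak /a /nw opprK //.
have [k ak] := simple_pairing_gt0 pa.
have := height_pos_ge1 (nw_pos _ (pos_refl_simple pa (nsimple k))).
have := height_pos_ge1 (nw_pos _ (pos_simple D k)).
have := height_simple D j; rewrite -[simple D j]nwK -/a => h1.
rewrite /nw reflE mulmxBr -scalemxAr opprB.
have -> : pairing (simple D k) a *: (longest D *m simple D k) - longest D *m a =
    nw a - pairing (simple D k) a *: nw (simple D k) by rewrite /nw scalerN opprK addrC.
rewrite -/(nw (simple D k)) height_rootB height_rootZ h1; move: ak; clear; nra.
Qed.

Lemma fixed_by_parabolic K (u : 'M[R]_r) v : weyl D K u ->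
  (forall i, i \in K -> pairing (simple D i) v = 0) -> u *m v = v.
Proof.
case=> s sK -> v0; elim: s sK => [|i s IH] /=; first by rewrite mul1mx.
move=> /andP[iK /IH sv]; rewrite simple_prod_cons -mulmxA sv reflE v0 //.
by rewrite scale0r subr0.
Qed.

(** The representative differs from [w *m longest] by an element fixing the weight. Coset
    representatives thus disappear, and the directions of [Pi A] are [- (w *m lambda)]. *)
Lemma min_rep_weight w : weyl_elt D w ->
  min_rep D (omega D @: stab_index D lambda)%SET (w *m longest D) *m
    (- (longest D *m lambda)) = - (w *m lambda).
Proof.
move=> Ww; set K := (_ @: _)%SET; have [u Ku <-] := min_rep_coset K (w *m longest D).
rewrite mulmxN -[_ *m u *m _]mulmxA (fixed_by_parabolic Ku); last exact: omega_pairing.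
by rewrite -mulmxA (mulmxA (longest D)) longestK mul1mx.
Qed.

End MinReps.

Section Telescope.
Variable R : realType.

Lemma telescope_rcons (F : R -> R) (s : seq R) (z y : R) :
  \sum_(k < (size s).+1) (F (nth 0 (rcons (y :: s) z) k.+1) - F (nth 0 (rcons (y :: s) z) k)) =
  F z - F y.
Proof.
elim: s y => [|x s IH] y; first by rewrite big_ord_recl big_ord0 addr0.
by rewrite big_ord_recl /= IH addrC addrA subrK.
Qed.

(** Only the segments starting at [x] or later survive, and they telescope. For [Num.min t] this
    gives the part of the time up to [t] spent after the break [x]. *)
Lemma telescope_sorted (F : R -> R) (s : seq R) (z x : R) : sorted <=%O s -> x \in s ->
  \sum_(k < size s) (F (nth 0 (rcons s z) k.+1) - F (nth 0 (rcons s z) k)) *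
    (x <= nth 0 s k)%R%:R = F z - F x.
Proof.
elim: s => [//|y s IH] /= ps; rewrite inE => xs.
have ys : all (fun w => y <= w) s by apply: order_path_min ps; exact: le_trans.
have [xy|yx] := leP x y.
  have -> : x = y.
    case/predU1P: xs => // /(allP ys) yx; by apply: le_anti; rewrite xy.
  rewrite -(telescope_rcons F s); apply: eq_bigr => k _; rewrite (_ : _ <= _) ?mulr1 //.
  by case: k => -[|k] //= kl; rewrite (allP ys) // mem_nth.
rewrite big_ord_recl /= leNgt yx mulr0 add0r; apply: IH; first exact: path_sorted ps.
by case/predU1P: xs => // xy; move: yx; rewrite xy ltxx.
Qed.

End Telescope.

(** * Folding maps and the straight pieces of the path *)

Section Folding.
Variables (R : realType) (r : nat) (D : root_system R r) (lambda : 'cV[R]_r).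
Hypothesis hl : dominant_integral D lambda.
Local Notation m := (size (lambda_chain D lambda)).
Implicit Types (A : {set 'I_m}) (i j : 'I_m) (a b v : 'cV[R]_r) (q : nat) (t : R).
Local Notation pos := (pos_root D).
Local Notation rts := (Defs.roots D).

(** [before] extended to natural numbers, so that the position [m] can stand for infinity. *)
Definition fold_prefix A q : seq 'I_m := [seq j : 'I_m <- enum A | (j < q)%N].

Definition fold_lin A q : 'M[R]_r := refl_prod [seq beta j | j <- fold_prefix A q].

Definition fold_aff A q v : 'cV[R]_r := aff_prod (fold_prefix A q) v.

Lemma mem_fold_prefix A q j : (j \in fold_prefix A q) = (j < q)%N && (j \in A).
Proof. by rewrite mem_filter mem_enum. Qed.

Lemma fold_prefix0 A : fold_prefix A 0 = [::].
Proof. by apply/eqP; rewrite -[_ == _]negbK -has_filter; apply/hasPn. Qed.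

Lemma fold_prefix_full A : fold_prefix A m = enum A.
Proof. by apply/all_filterP/allP => j _; exact: ltn_ord. Qed.

Lemma enum_sorted A : sorted (fun i j => (i < j)%N) (enum A).
Proof.
have tr : transitive (fun i j => (i < j)%N) by move=> i j k; exact: ltn_trans.
rewrite /enum_mem sorted_filter // -enumT.
by have := iota_ltn_sorted 0 m; rewrite -val_enum_ord sorted_map.
Qed.

Lemma fold_prefixS A i : fold_prefix A i.+1 = fold_prefix A i ++ (if i \in A then [:: i] else [::]).
Proof.
have tr : transitive (fun i j => (i < j)%N) by move=> j k l; exact: ltn_trans.
apply: (irr_sorted_eq tr) => [j||| j]; first exact: ltnn.
- exact: sorted_filter (enum_sorted A).
- case: ifP => iA; last by rewrite cats0; exact: sorted_filter (enum_sorted A).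
  rewrite cats1 -[rcons _ _](revK) rev_sorted rev_rcons /=.
  rewrite path_sortedE; last by move=> j k l /= h1 h2; exact: ltn_trans h2 h1.
  rewrite all_rev -rev_sorted revK sorted_filter ?enum_sorted // andbT.
  by apply/allP => j; rewrite mem_fold_prefix => /andP[].
- rewrite mem_cat !mem_fold_prefix ltnS leq_eqVlt.
  case: ifP => iA; rewrite ?inE; last first.
    by have [/val_inj->|] := eqVneq (j : nat) i; rewrite ?iA ?andbF ?orbF.
  by rewrite -val_eqE; have [/val_inj->|] := eqVneq (j : nat) i; rewrite ?iA ?orbT ?orbF.
Qed.

Lemma refl_prod_cat (s s' : seq 'cV[R]_r) : refl_prod (s ++ s') = refl_prod s *m refl_prod s'.
Proof. by elim: s => [|a s IH] /=; rewrite ?mul1mx // IH mulmxA. Qed.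

Lemma fold_lin0 A : fold_lin A 0 = 1%:M.
Proof. by rewrite /fold_lin fold_prefix0. Qed.

Lemma fold_linS A i : fold_lin A i.+1 =
  if i \in A then fold_lin A i *m refl (beta i) else fold_lin A i.
Proof.
rewrite /fold_lin fold_prefixS map_cat refl_prod_cat.
by case: ifP => _ /=; rewrite mulmx1.
Qed.

Lemma fold_aff0 A v : fold_aff A 0 v = v.
Proof. by rewrite /fold_aff fold_prefix0. Qed.

Lemma fold_affS A i v : fold_aff A i.+1 v =
  fold_aff A i (if i \in A then aff_refl (beta i) (- (level i)%:R) v else v).
Proof. by rewrite /fold_aff fold_prefixS /aff_prod foldr_cat; case: ifP. Qed.

Lemma fold_lin_weyl A q : weyl_elt D (fold_lin A q).
Proof.
rewrite /fold_lin; elim: (fold_prefix A q) => [|j s IH] /=; first exact: weyl1.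
by apply: weylM => //; apply/weyl_refl/pos_mem/beta_pos.
Qed.

Lemma aff_reflE a (c : R) v : aff_refl a c v = refl a *m v + c *: a.
Proof. by rewrite /aff_refl reflE scalerBl opprB addrA addrAC. Qed.

Lemma fold_affE A q v : fold_aff A q v = fold_lin A q *m v + fold_aff A q 0.
Proof.
rewrite /fold_aff /fold_lin; elim: (fold_prefix A q) => [|j s IH] /=.
  by rewrite mul1mx addr0.
by rewrite !aff_reflE IH mulmxDr mulmxA -!addrA.
Qed.

Lemma gammaE A i : gamma A i = fold_lin A i *m beta i.
Proof. by []. Qed.

Lemma gamma_root A i : gamma A i \in rts.
Proof. by apply: weyl_root; [exact: fold_lin_weyl | exact/pos_mem/beta_pos]. Qed.

Lemma position_ind (P : nat -> Prop) : P 0%N -> (forall i, P i -> P i.+1) ->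
  forall q, (q <= m)%N -> P q.
Proof.
move=> P0 PS; elim=> [//|q IH] qm; exact: (PS (Ordinal qm) (IH (ltnW qm))).
Qed.

Lemma fold_prefix_sum A i (F : 'I_m -> 'cV[R]_r) :
  \sum_(j in A | (j < i.+1)%N) F j =
  \sum_(j in A | (j < i)%N) F j + (if i \in A then F i else 0).
Proof.
rewrite (bigID (fun j => j == i)) /= addrC; congr (_ + _).
  apply: eq_bigl => j; rewrite ltnS leq_eqVlt -val_eqE.
  by case: eqVneq => [/val_inj->|]; rewrite ?ltnn ?andbF ?andbT.
case: ifP => iA; last first.
  rewrite big_pred0 // => j; apply/negbTE/negP => /andP[/andP[jA _] /eqP ji].
  by rewrite -ji jA in iA.
rewrite (big_pred1 i) // => j /=; case: eqVneq => [->|]; rewrite ?andbF //.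
by rewrite iA ltnSn.
Qed.

(** The reflection at [j] displaces its argument along [beta j], and the linear part of the earlier
    folds carries this displacement to [gamma A j]. Each fold thus contributes separately, as in
    [Pi_sum]. *)
Lemma fold_aff_sum A q v : (q <= m)%N -> fold_aff A q v =
  v - \sum_(j in A | (j < q)%N) (pairing (beta j) v + (level j)%:R) *: gamma A j.
Proof.
move=> qm; move: q qm v; apply: position_ind => [v|i IH v].
  by rewrite fold_aff0 big_pred0 ?subr0 // => j; rewrite ltn0 andbF.
rewrite fold_affS fold_prefix_sum; case: ifP => _; last by rewrite addr0 IH.
rewrite opprD addrA -IH /aff_refl opprK fold_affE [in RHS]fold_affE mulmxBr.
by rewrite -scalemxAr -gammaE addrAC.
Qed.

Lemma fold_lin_sum A q v : (q <= m)%N -> fold_lin A q *m v =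
  v - \sum_(j in A | (j < q)%N) pairing (beta j) v *: gamma A j.
Proof.
move=> qm; move: q qm v; apply: position_ind => [v|i IH v].
  by rewrite fold_lin0 mul1mx big_pred0 ?subr0 // => j; rewrite ltn0 andbF.
rewrite fold_linS fold_prefix_sum; case: ifP => _; last by rewrite addr0 IH.
by rewrite opprD addrA -IH -mulmxA reflE mulmxBr -scalemxAr -gammaE.
Qed.

(** The lexicographic key begins with the relative level, so the chain is sorted by it and a bound
    on relative levels cuts out a prefix. *)
Lemma level_cut t : exists2 q, (q <= m)%N & forall j, (rel_level j <= t) = (j < q)%N.
Proof.
have ex : exists q, (q == m) || [exists j : 'I_m, (j == q :> nat) && (t < rel_level j)].
  by exists m; rewrite eqxx.
case: (ex_minnP ex) => q Pq qmin; exists q => [|j].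
  by apply: qmin; rewrite eqxx.
apply/idP/idP => [jt|jq]; last first.
  rewrite leNgt; apply/negP => tj; have := qmin j; rewrite leqNgt jq => H.
  by suff /H : (j == m :> nat) || [exists k : 'I_m, (k == j :> nat) && (t < rel_level k)] by [];
     apply/orP; right; apply/existsP; exists j; rewrite eqxx.
case/orP: Pq => [/eqP->|/existsP[k /andP[/eqP <- tk]]]; first exact: ltn_ord.
rewrite ltnNge; apply/negP => kj; have := rel_level_sorted kj.
by rewrite leNgt (le_lt_trans jt tk).
Qed.

Lemma break_elt_lambda A t : weyl_elt D (break_elt A t) /\ break_elt A t *m lambda =
  lambda - \sum_(j in A | rel_level j <= t) pairing (beta j) lambda *: gamma A j.
Proof.
have [q qm qE] := level_cut t.
rewrite /break_elt (eq_filter qE); split; first exact: fold_lin_weyl.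
by rewrite -/(fold_lin A q) fold_lin_sum //; congr (_ - _); apply: eq_bigl => j; rewrite qE.
Qed.

Lemma mem_breaks A x : (x \in breaks A) = (x \in 0 :: [seq rel_level j | j <- enum A]).
Proof. by rewrite mem_sort mem_undup. Qed.

Lemma breaks_sorted A : sorted <=%O (breaks A).
Proof. by apply: sort_sorted; exact: le_total. Qed.

Lemma breaks_ge0 A x : x \in breaks A -> 0 <= x.
Proof.
rewrite mem_breaks inE => /predU1P[->//|/mapP[j _ ->]]; exact: rel_level_ge0.
Qed.

(** In this form neither the merging of equal relative levels in [breaks] nor the coset
    representatives are visible: each fold acts after its own time, along its own root. *)
Lemma Pi_sum A t : Pi A t = - ((Num.min t 1 - Num.min t 0) *: lambda) +
  \sum_(j in A) ((Num.min t 1 - Num.min t (rel_level j)) *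
                 pairing (beta j) lambda) *: gamma A j.
Proof.
rewrite /Pi /path_of /Pi_data /=; set bs := breaks A.
pose c k := Num.min t (rcons bs 1)`_k.+1 - Num.min t (rcons bs 1)`_k.
have tel x : x \in bs -> \sum_(k < size bs) c k * (x <= bs`_k)%R%:R =
    Num.min t 1 - Num.min t x.
  by move=> xs; rewrite -(telescope_sorted (fun z => Num.min t z) 1 (breaks_sorted A) xs).
rewrite size_map.
transitivity (\sum_(k < size bs) (- ((c k * (0 <= bs`_k)%R%:R) *: lambda) +
    \sum_(j in A) (c k * (rel_level j <= bs`_k)%R%:R * pairing (beta j) lambda) *: gamma A j)).
  apply: eq_bigr => k _; rewrite -/(c k) (nth_map 0) //.
  have [Wb bE] := break_elt_lambda A bs`_k.
  rewrite min_rep_weight // bE (breaks_ge0 (mem_nth 0 (ltn_ord k))) mulr1 opprB.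
  rewrite addrC scalerDr scalerN scaler_sumr big_mkcondr /=; congr (_ + _).
  apply: eq_bigr => j _; case: ifP => _; rewrite ?mulr1 ?mulr0 ?mul0r ?scale0r //.
  by rewrite scalerA.
rewrite big_split /= sumrN -scaler_suml tel; last by rewrite mem_breaks mem_head.
congr (_ + _); rewrite exchange_big /=; apply: eq_bigr => j jA.
rewrite -scaler_suml -mulr_suml tel // mem_breaks inE; apply/orP; right.
by apply: map_f; rewrite mem_enum.
Qed.

(** Shifted by one: position [i] is met at [break_pt i.+1], and piece [q] runs from [break_pt q] to
    [break_pt q.+1] with the folds before [q] applied. The default 1 provides the final time
    [break_pt m.+1]. *)
Definition break_pt q : R :=
  if q is q'.+1 then oapp (@rel_level R r D lambda) 1 (insub q') else 0.

Lemma break_ptS i : break_pt i.+1 = rel_level i.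
Proof. by rewrite /break_pt valK. Qed.

Lemma break_pt_last : break_pt m.+1 = 1.
Proof. by rewrite /break_pt insubF // ltnn. Qed.

Lemma break_pt_le1 q : break_pt q <= 1.
Proof.
case: q => [|q] /=; first exact: ler01.
by case: insubP => [i _ _|_] //=; rewrite ltW ?rel_level_lt1.
Qed.

Lemma break_pt_le q : (q <= m)%N -> break_pt q <= break_pt q.+1.
Proof.
rewrite leq_eqVlt => /predU1P[->|qm].
  by rewrite break_pt_last break_pt_le1.
rewrite -[q in leRHS]/(val (Ordinal qm)) break_ptS.
case: q qm => [|q] qm; first exact: rel_level_ge0.
have qm' : (q < m)%N by exact: ltnW.
by rewrite -[q in leLHS]/(val (Ordinal qm')) break_ptS; exact: rel_level_sorted.
Qed.

Lemma break_pt_mono q q' : (q <= q')%N -> (q' <= m.+1)%N -> break_pt q <= break_pt q'.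
Proof. exact: (pieces_mono break_pt_le). Qed.

Lemma break_pt_ge0 q : (q <= m.+1)%N -> 0 <= break_pt q.
Proof. exact: (@break_pt_mono 0). Qed.

Lemma break_pt_locate t : 0 <= t -> t <= 1 ->
  exists2 q, (q <= m)%N & break_pt q <= t <= break_pt q.+1.
Proof.
move=> t0 t1; have ex : exists q, t <= break_pt q.+1 by exists m; rewrite break_pt_last.
case: (ex_minnP ex) => q tq qmin; exists q; first by apply: qmin; rewrite break_pt_last.
rewrite tq andbT; case: q tq qmin => [//|q] _ qmin; rewrite leNgt; apply/negP => tq.
by have := qmin q (ltW tq); rewrite ltnn.
Qed.

Lemma Pi_piece A q t : (q <= m)%N -> break_pt q <= t -> t <= break_pt q.+1 ->
  Pi A t = fold_aff A q (- (t *: lambda)).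
Proof.
move=> qm qt tq; have t0 : 0 <= t by apply: le_trans qt; exact/break_pt_ge0/leqW.
have t1 : t <= 1 by apply: le_trans tq _; exact: break_pt_le1.
rewrite Pi_sum fold_aff_sum // (min_l t1) (min_r t0) subr0; congr (_ + _).
rewrite -sumrN big_mkcondr /=; apply: eq_bigr => j _; case: ifP => jq.
  have jt : rel_level j <= t.
    by apply: le_trans qt; rewrite -break_ptS break_pt_mono // leqW.
  rewrite (min_r jt) -scaleNr pairingNr pairingZr; congr (_ *: _).
  by rewrite mulrBl divfK ?gt_eqF ?beta_lambda_gt0 //; ring.
have tj : t <= rel_level j.
  apply: le_trans tq _; rewrite -break_ptS; apply: break_pt_mono => //.
    by rewrite ltnS leqNgt jq.
  exact/leqW/ltn_ord.
by rewrite (min_l tj) subrr mul0r scale0r.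
Qed.

(** Equality of paths is equality of functions on the whole line, so the constant parts outside
    [0, 1] have to be compared as well. *)
Lemma Pi_lt0 A t : t <= 0 -> Pi A t = 0.
Proof.
move=> t0; rewrite Pi_sum (min_l t0) (min_l (le_trans t0 ler01)) subrr scale0r.
rewrite oppr0 add0r big1 // => j _.
by rewrite (min_l (le_trans t0 (rel_level_ge0 hl j))) subrr mul0r scale0r.
Qed.

Lemma Pi_gt1 A t : 1 <= t -> Pi A t = Pi A 1.
Proof.
move=> t1; rewrite !Pi_sum !minxx !(min_r t1) !(min_r (le_trans ler01 t1)).
rewrite (min_r ler01); congr (_ + _); apply: eq_bigr => j _.
have j1 := ltW (rel_level_lt1 hl j).
by rewrite (min_r (le_trans j1 t1)) (min_r j1).
Qed.

End Folding.

(** * Crossings of the generic path *)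

(** If the floors differed, the affine function would reach the larger of them at an intermediate
    time, found by dividing by [P]. *)
Lemma floor_const (R : realType) (c P t t' : R) : t <= t' ->
  (forall u, t <= u -> u <= t' -> c - u * P \isn't a Num.int) ->
  Num.floor (c - t * P) = Num.floor (c - t' * P).
Proof.
move=> tt nint; apply/eqP; apply: contraT => ne; exfalso.
have hit (z : int) : P != 0 -> t <= (c - z%:~R) / P -> (c - z%:~R) / P <= t' -> False.
  move=> P0 tu ut; have := nint _ tu ut; rewrite divfK // opprB addrC subrK.
  by rewrite intr_int.
have lt_floor (x y : R) : x <= y -> Num.floor x != Num.floor y -> x < (Num.floor y)%:~R.
  by move=> xy nxy; rewrite -(@floor_lt_int R) lt_neqAle nxy le_floor.
case: (ltgtP P 0) => P0; last by rewrite P0 !mulr0 eqxx in ne.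
- set z := Num.floor (c - t' * P); have zle : z%:~R <= c - t' * P by exact: (@floor_le R).
  have ltz : c - t * P < z%:~R.
    by apply: lt_floor => //; move: P0 tt; clear; nra.
  apply: (hit z); rewrite ?lt_eqF // ?ler_ndivlMr ?ler_ndivrMr //.
    by move: ltz; clear; lra.
  by move: zle; clear; lra.
- set z := Num.floor (c - t * P); have zle : z%:~R <= c - t * P by exact: (@floor_le R).
  have ltz : c - t' * P < z%:~R.
    by apply: lt_floor; rewrite 1?eq_sym //; move: P0 tt; clear; nra.
  apply: (hit z); rewrite ?gt_eqF // ?ler_pdivlMr ?ler_pdivrMr //.
    by move: zle; clear; lra.
  by move: ltz; clear; lra.
Qed.

Section Crossings.
Variables (R : realType) (r : nat) (D : root_system R r) (lambda : 'cV[R]_r).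
Hypothesis hl : dominant_integral D lambda.
Local Notation m := (size (lambda_chain D lambda)).
Implicit Types (i j : 'I_m) (a b v : 'cV[R]_r) (q : nat) (t u : R).
Local Notation pos := (pos_root D).
Local Notation rts := (Defs.roots D).
Variable x0 : 'cV[R]_r.
Hypothesis x0_gt0 : forall b, pos b -> 0 < pairing b x0.
Hypothesis x0_lt1 : forall b, pos b -> pairing b x0 < 1.
Local Notation tau := (@perturbed_level R r D lambda x0).
Hypothesis tau_lt : forall i j, (i < j)%N -> tau i < tau j.

Lemma tau_gt0 i : 0 < tau i.
Proof.
by rewrite divr_gt0 ?beta_lambda_gt0 // ltr_wpDl // x0_gt0 // beta_pos.
Qed.

Lemma tau_lt1 i : tau i < 1.
Proof.
rewrite ltr_pdivrMr ?beta_lambda_gt0 // mul1r.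
have li := pairing_lambda_int hl (pos_mem (beta_pos hl i)).
have := int_ltS (natr_int R (level i)) li (level_lt hl i).
by have := x0_lt1 (beta_pos hl i); lra.
Qed.

Lemma tau_pairing i t : pairing (beta i) (x0 - t *: lambda) =
  - (level i)%:R + (tau i - t) * pairing (beta i) lambda.
Proof.
rewrite pairingBr pairingZr /perturbed_level mulrBl divfK; first by ring.
by rewrite gt_eqF ?beta_lambda_gt0.
Qed.

(** Since [pairing b x0] lies strictly between 0 and 1, an integral value [z] at a time in [0, 1]
    satisfies [- pairing b lambda < z <= 0], which is exactly the range of levels in the chain. *)
Lemma crossing b t : pos b -> 0 <= t -> t <= 1 ->
  pairing b (x0 - t *: lambda) \is a Num.int -> exists2 i, beta i = b & tau i = t.
Proof.
move=> pb t0 t1 /intrP[z zE]; move: (zE); rewrite pairingBr pairingZr => zE'.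
have P0 : 0 <= pairing b lambda by exact/natr_ge0/(pairing_lambda_nat hl).
have b0 := x0_gt0 pb; have b1 := x0_lt1 pb.
have z1 : z <= 0 by rewrite -ltzD1 -(ltr_int R) intrD -zE'; nra.
have lP : `|z|%N%:R < pairing b lambda :> R.
  rewrite natr_absz ler0_norm // rmorphN /= -zE'; nra.
have [i [bi li]] := chain_index hl pb lP; exists i => //.
rewrite /perturbed_level li bi natr_absz ler0_norm // rmorphN /= -zE'.
by rewrite opprB subrK mulfK // gt_eqF // (le_lt_trans _ lP).
Qed.

Lemma strip_const b t t' : b \in rts -> 0 <= t -> t <= t' -> t' <= 1 ->
  (forall i, t <= tau i -> tau i <= t' -> b != beta i /\ b != - beta i) ->
  Num.floor (pairing b (x0 - t *: lambda)) = Num.floor (pairing b (x0 - t' *: lambda)).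
Proof.
move=> rb t0 tt t1 nb; rewrite !pairingBr !pairingZr; apply: floor_const => // u tu ut.
have u0 := le_trans t0 tu; have u1 := le_trans ut t1.
rewrite -pairingZr -pairingBr; apply/negP => iu.
have [pb|nb'] := boolP (pos b).
  have [i bi ti] := crossing pb u0 u1 iu; have := nb i.
  by rewrite ti bi eqxx => /(_ tu ut)[].
have pb : pos (- b) by rewrite posN.
have [|i bi ti] := crossing pb u0 u1; first by rewrite pairingNl rpredN.
by have := nb i; rewrite ti bi opprK eqxx => /(_ tu ut)[].
Qed.

Definition cross_pt q : R := if q is q'.+1 then oapp tau 1 (insub q') else 0.

Lemma cross_ptS i : cross_pt i.+1 = tau i.
Proof. by rewrite /cross_pt valK. Qed.

Lemma cross_pt_last : cross_pt m.+1 = 1.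
Proof. by rewrite /cross_pt insubF // ltnn. Qed.

Lemma cross_pt_ge0 q : 0 <= cross_pt q.
Proof.
case: q => [//|q] /=; case: insubP => [i _ _|_] /=; last exact: ler01.
exact/ltW/tau_gt0.
Qed.

Lemma cross_pt_lt q : (q <= m)%N -> cross_pt q < cross_pt q.+1.
Proof.
rewrite leq_eqVlt => /predU1P[->|qm].
  rewrite cross_pt_last; case E: (m) => [|n]; first exact: ltr01.
  rewrite /cross_pt; case: insubP => [i _ _|]; first exact: tau_lt1.
  by move/negP; case; rewrite E ltnSn.
rewrite -[q in ltRHS]/(val (Ordinal qm)) cross_ptS.
case: q qm => [|q] qm; first exact: tau_gt0.
by rewrite -[q in ltLHS]/(val (Ordinal (ltnW qm))) cross_ptS; exact: tau_lt.
Qed.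

Lemma tau_le i j : (i <= j)%N -> tau i <= tau j.
Proof.
by rewrite leq_eqVlt => /predU1P[/val_inj->//|/tau_lt/ltW].
Qed.

Lemma cross_pt_le1 q : (q <= m.+1)%N -> cross_pt q <= 1.
Proof.
case: q => [_|q]; first exact: ler01.
by rewrite /cross_pt; case: insubP => [i _ _ _|_ _] //=; exact/ltW/tau_lt1.
Qed.

Lemma cross_pt_between q i : cross_pt q < tau i -> tau i < cross_pt q.+1 -> False.
Proof.
case: (ltngtP i q) => iq.
- case: q iq => [//|q]; rewrite ltnS /cross_pt => iq.
  case: insubP => [j _ jq|_] /=; last by rewrite ltNge (ltW (tau_lt1 i)).
  by rewrite ltNge tau_le // jq.
- rewrite /cross_pt; case: insubP => [j _ jq|] /=; last first.
    by rewrite -leqNgt leqNgt (ltn_trans iq (ltn_ord i)).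
  by move=> _; rewrite ltNge tau_le // jq ltnW.
- by rewrite -iq cross_ptS ltxx.
Qed.

Definition cross_mid q : R := (cross_pt q + cross_pt q.+1) / 2.

Lemma cross_midP q : (q <= m)%N ->
  [/\ cross_pt q < cross_mid q, cross_mid q < cross_pt q.+1, 0 <= cross_mid q & cross_mid q <= 1].
Proof.
move=> qm; have := cross_pt_lt qm; have := cross_pt_ge0 q.
have /cross_pt_le1 : (q < m.+1)%N by [].
by rewrite /cross_mid; split; lra.
Qed.

Lemma mid_before b i : b \in rts -> b != beta i -> b != - beta i ->
  Num.floor (pairing b (x0 - cross_mid i *: lambda)) =
  Num.floor (pairing b (x0 - tau i *: lambda)).
Proof.
move=> rb b1 b2; have [c1 c2 c3 c4] := cross_midP (ltnW (ltn_ord i)).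
rewrite cross_ptS in c2.
apply: strip_const => //; [exact: ltW|exact/ltW/tau_lt1|move=> j tj jt].
suff -> : j = i by [].
have [ji|ij|/val_inj//] := ltngtP j i; last by move: (tau_lt ij); rewrite ltNge jt.
case: (@cross_pt_between i j); first exact: lt_le_trans tj.
by rewrite cross_ptS tau_lt.
Qed.

Lemma mid_after b i : b \in rts -> b != beta i -> b != - beta i ->
  Num.floor (pairing b (x0 - cross_mid i.+1 *: lambda)) =
  Num.floor (pairing b (x0 - tau i *: lambda)).
Proof.
move=> rb b1 b2; have [c1 c2 c3 c4] := cross_midP (ltn_ord i).
rewrite cross_ptS in c1.
apply/esym/strip_const => //; [exact/ltW/tau_gt0|exact: ltW|move=> j tj jt].
suff -> : j = i by [].
have [ji|ij|/val_inj//] := ltngtP j i; first by move: (tau_lt ji); rewrite ltNge tj.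
case: (@cross_pt_between i.+1 j); last exact: le_lt_trans c2.
by rewrite cross_ptS tau_lt.
Qed.

Lemma mid_last b : b \in rts ->
  Num.floor (pairing b (x0 - cross_mid m *: lambda)) =
  Num.floor (pairing b (x0 - lambda)).
Proof.
move=> rb; rewrite -[lambda in RHS]scale1r.
have [c1 c2 c3 c4] := cross_midP (leqnn m).
apply: strip_const => // j tj _; exfalso.
by apply: (@cross_pt_between m j); [exact: lt_le_trans tj|rewrite cross_pt_last tau_lt1].
Qed.

Lemma mid_first b : b \in rts ->
  Num.floor (pairing b (x0 - cross_mid 0 *: lambda)) = Num.floor (pairing b x0).
Proof.
move=> rb; rewrite -[x0 in RHS]subr0 -(scale0r lambda).
have [c1 c2 c3 c4] := cross_midP (leq0n m).
apply/esym/strip_const => // j _ jt; exfalso.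
by apply: (@cross_pt_between 0 j); [exact: tau_gt0|exact: le_lt_trans c2].
Qed.

(** The time [u] is where the pairing with [beta i] is one unit higher. If the midpoint came no
    later than [u], then [crossing] would give a crossing strictly between two consecutive ones. *)
Lemma mid_before_near i : 0 < (tau i - cross_mid i) * pairing (beta i) lambda < 1.
Proof.
have [c1 c2 c3 c4] := cross_midP (ltnW (ltn_ord i)); rewrite cross_ptS in c2.
have P0 := beta_lambda_gt0 hl i; apply/andP; split; first by rewrite mulr_gt0 ?subr_gt0.
rewrite ltNge; apply/negP => ge1; pose u := tau i - (pairing (beta i) lambda)^-1.
have uP : (tau i - u) * pairing (beta i) lambda = 1.
  by rewrite /u opprB addrC subrK mulVf // gt_eqF.
have cu : cross_mid i <= u.
  by rewrite -(ler_pM2r P0); move: ge1 uP; rewrite !mulrBl; lra.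
have ut : u < tau i by rewrite /u ltrBlDr ltrDl invr_gt0.
have [||||j _ tj] := @crossing (beta i) u.
- exact: beta_pos.
- exact: le_trans cu.
- exact/ltW/(lt_trans ut)/tau_lt1.
- by rewrite tau_pairing uP rpredD ?rpredN ?natr_int ?rpred1.
apply: (@cross_pt_between i j); rewrite tj ?cross_ptS //; exact: lt_le_trans cu.
Qed.

Lemma mid_after_near i : 0 < (cross_mid i.+1 - tau i) * pairing (beta i) lambda < 1.
Proof.
have [c1 c2 c3 c4] := cross_midP (ltn_ord i); rewrite cross_ptS in c1.
have P0 := beta_lambda_gt0 hl i; apply/andP; split; first by rewrite mulr_gt0 ?subr_gt0.
rewrite ltNge; apply/negP => ge1; pose u := tau i + (pairing (beta i) lambda)^-1.
have uP : (tau i - u) * pairing (beta i) lambda = -1.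
  by rewrite /u opprD addNKr mulNr mulVf // gt_eqF.
have cu : u <= cross_mid i.+1.
  by rewrite -(ler_pM2r P0); move: ge1 uP; rewrite !mulrBl; lra.
have ut : tau i < u by rewrite /u ltrDl invr_gt0.
have [||||j _ tj] := @crossing (beta i) u.
- exact: beta_pos.
- exact: le_trans (ltW (tau_gt0 i)) (ltW ut).
- exact: le_trans c4.
- by rewrite tau_pairing uP rpredD ?rpredN ?natr_int ?rpred1.
apply: (@cross_pt_between i.+1 j); rewrite tj ?cross_ptS //; exact: le_lt_trans c2.
Qed.

End Crossings.

(** * Folding rules of an admissible subset *)

Section Admissible.
Variables (R : realType) (r : nat) (D : root_system R r) (lambda : 'cV[R]_r).
Hypothesis hl : dominant_integral D lambda.
Local Notation m := (size (lambda_chain D lambda)).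
Variable A : {set 'I_m}.
Implicit Types (i j : 'I_m).

Lemma qb_path_cat (w : 'M[R]_r) s a s' : qb_path D w (s ++ a :: s') ->
  qb_edge D finset.set0 a (w *m refl_prod s) (w *m refl_prod s *m refl a).
Proof.
elim: s w => [|b s IH] w /=; first by rewrite mulmx1 => -[].
by case=> _ /IH; rewrite !mulmxA.
Qed.

Lemma fold_prefix_cat q q' : (q <= q')%N -> (q' <= m)%N ->
  exists s, fold_prefix A q' = fold_prefix A q ++ s.
Proof.
move=> qq' q'm; have {q'm} : (q <= q')%N && (q' <= m)%N by rewrite qq'.
elim: q' {qq'} => [|q' IH]; first by rewrite leqn0 => /andP[/eqP-> _]; exists [::]; rewrite cats0.
case/andP; rewrite leq_eqVlt => /predU1P[-> _|]; first by exists [::]; rewrite cats0.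
rewrite ltnS => qq' q'm; have [|s E] := IH; first by rewrite qq' ltnW.
exists (s ++ if Ordinal q'm \in A then [:: Ordinal q'm] else [::]).
by rewrite catA -E -[q'.+1]/((Ordinal q'm).+1) fold_prefixS.
Qed.

Lemma admissible_edge i : admissible A -> i \in A ->
  qb_edge D finset.set0 (beta i) (fold_lin A i) (fold_lin A i *m refl (beta i)).
Proof.
move=> hA iA; have [s] := fold_prefix_cat (ltn_ord i) (leqnn m).
rewrite fold_prefix_full fold_prefixS iA -catA /= => E.
move: hA; rewrite /admissible E map_cat /= => /qb_path_cat.
by rewrite mul1mx.
Qed.
End Admissible.

Section FoldRules.
Variables (R : realType) (r : nat) (D : root_system R r) (lambda : 'cV[R]_r).
Hypothesis hl : dominant_integral D lambda.
Local Notation m := (size (lambda_chain D lambda)).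
Variables (p : affine_index r) (A : {set 'I_m}).
Hypothesis hA : admissible A.
Implicit Types (i j : 'I_m) (a b v : 'cV[R]_r) (q : nat) (t u : R).
Local Notation pos := (pos_root D).
Local Notation rts := (Defs.roots D).
Local Notation alpha := (affine_root D p).

Definition fold_root q : 'cV[R]_r := (fold_lin A q)^T *m alpha.

Definition fold_base q : R := pairing alpha (fold_aff A q 0).

(** The slope of the height on piece [q] is minus the pairing of this root with [lambda]; the sign
    of the root still makes sense where the slope is zero. *)
Definition descends q : bool := pos (fold_root q).

Definition Pi_height t : R := height D p (Pi A) t.

Definition at_alpha q : bool := oapp (fun i => i \in I_alpha p A) false (insub q).

Definition in_fold q : bool := oapp (fun i => i \in A) false (insub q).

(** The floor only serves to land in [int]: at the positions of [I_alpha] and at [m] the height is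
    integral, by [break_level_int]. *)
Definition break_level q : int := Num.floor (Pi_height (break_pt D lambda q.+1)).

Lemma fold_root_mem q : fold_root q \in rts.
Proof.
apply: weyl_root; last exact: affine_root_mem.
exact/weylV/fold_lin_weyl.
Qed.

Lemma fold_aff_pairing q v :
  pairing alpha (fold_aff A q v) = pairing (fold_root q) v + fold_base q.
Proof.
rewrite fold_affE pairingDr; congr (_ + _); rewrite /fold_root pairing_mulmxl ?trmxK //.
exact/orth_tr/weyl_orth/(fold_lin_weyl hl).
Qed.

Lemma fold_base_int q : (q <= m)%N -> fold_base q \is a Num.int.
Proof.
move=> qm; rewrite /fold_base fold_aff_sum // sub0r pairingNr rpredN pairing_sumr.
apply: rpred_sum => j _; rewrite pairing0r add0r pairingZr rpredM ?natr_int //.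
by apply: roots_int; [exact: affine_root_mem|exact: gamma_root].
Qed.

Lemma Pi_heightE q t : (q <= m)%N -> break_pt D lambda q <= t ->
  t <= break_pt D lambda q.+1 ->
  Pi_height t = - (t * pairing (fold_root q) lambda) + fold_base q.
Proof.
move=> qm qt tq; rewrite /Pi_height /height (Pi_piece hl A qm) //.
by rewrite fold_aff_pairing pairingNr pairingZr.
Qed.

Lemma at_alphaE i : at_alpha i = (fold_root i == beta i) || (fold_root i == - beta i).
Proof.
rewrite /at_alpha valK /= inE gammaE /fold_root.
have O := weyl_orth (fold_lin_weyl hl A i).
have E a : (fold_lin A i *m beta i == a) = ((fold_lin A i)^T *m a == beta i).
  by apply/eqP/eqP => [<-|<-]; rewrite ?orthKl ?orthKr.
by rewrite !E mulmxN eqr_oppLR.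
Qed.

Lemma in_foldE i : in_fold i = (i \in A).
Proof. by rewrite /in_fold valK. Qed.

Lemma fold_rootS i : fold_root i.+1 =
  if i \in A then refl (beta i) *m fold_root i else fold_root i.
Proof.
rewrite /fold_root fold_linS; case: ifP => // _.
by rewrite trmx_mul refl_tr mulmxA.
Qed.

Lemma descends_fold i : at_alpha i -> descends i.+1 = descends i (+) in_fold i.
Proof.
rewrite at_alphaE in_foldE /descends fold_rootS; case: ifP => iA; last by rewrite addbF.
rewrite addbT => fi; suff -> : refl (beta i) *m fold_root i = - fold_root i.
  by rewrite posN // fold_root_mem.
case/orP: fi => /eqP->; first exact: refl_self.
by rewrite mulmxN refl_self.
Qed.

(** Admissibility enters the argument here, through the sign rule for quantum Bruhat edges. *)
Lemma descends_homo i : ~~ at_alpha i -> descends i -> descends i.+1.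
Proof.
rewrite at_alphaE /descends fold_rootS; case: ifP => // iA nfi pfi.
apply: contraT => npf; case/negP: nfi; apply/orP; left; apply/eqP.
exact: qb_edge_sign (admissible_edge hA iA) pfi npf.
Qed.

Lemma break_level_int q : (q <= m)%N -> at_alpha q || (q == m) ->
  (break_level q)%:~R = Pi_height (break_pt D lambda q.+1).
Proof.
move=> qm qI; apply: floorK; rewrite (@Pi_heightE q) ?break_pt_le //.
rewrite rpredD ?fold_base_int // rpredN.
case/orP: qI => [|/eqP->]; last first.
  by rewrite break_pt_last mul1r; apply: (pairing_lambda_int hl); exact: fold_root_mem.
have [qm' fq|] := ltnP q m; last first.
  by rewrite /at_alpha => mq; rewrite insubF // ltnNge mq.
move: fq; rewrite -[q]/(val (Ordinal qm')) break_ptS at_alphaE.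
set i := Ordinal qm'; rewrite /rel_level.
have E : (level i)%:R / pairing (beta i) lambda * pairing (beta i) lambda \is a Num.int.
  by rewrite divfK ?natr_int // gt_eqF // beta_lambda_gt0.
by case/orP => /eqP->; rewrite ?pairingNl ?mulrN ?rpredN.
Qed.

Variable x0 : 'cV[R]_r.
Hypothesis x0_gt0 : forall b, pos b -> 0 < pairing b x0.
Hypothesis x0_lt1 : forall b, pos b -> pairing b x0 < 1.
Local Notation tau := (@perturbed_level R r D lambda x0).
Hypothesis tau_lt : forall i j, (i < j)%N -> tau i < tau j.
Local Notation mid q := (@cross_mid R r D lambda x0 q).

Definition strip q : int :=
  Num.floor (pairing alpha (fold_aff A q (x0 - mid q *: lambda))).

Lemma stripE q : (q <= m)%N -> strip q =
  Num.floor (pairing (fold_root q) (x0 - mid q *: lambda)) + Num.floor (fold_base q).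
Proof. by move=> qm; rewrite /strip fold_aff_pairing floorDrz // fold_base_int. Qed.

Lemma floor_pos_x0 b : b \in rts -> Num.floor (pairing b x0) = - (~~ pos b)%:Z.
Proof.
move=> rb; apply/eqP; rewrite floor_eq; case pb: (pos b) => /=.
  by rewrite oppr0 add0r ltW ?x0_gt0 ?x0_lt1.
have pNb : pos (- b) by rewrite posN ?pb.
have := x0_gt0 pNb; have := x0_lt1 pNb; rewrite pairingNl.
by move=> h1 h2; apply/andP; split; rewrite ?rmorphN /=; lra.
Qed.

Lemma strip_start : strip 0 = - (delta0 p)%:Z.
Proof.
have rf := fold_root_mem 0; rewrite stripE // (mid_first hl) // floor_pos_x0 //.
have -> : fold_base 0 = 0 by rewrite /fold_base fold_aff0 pairing0r.
rewrite floor0 addr0 /fold_root fold_lin0 trmx1 mul1mx /delta0.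
case: p => [i|] /=; first by rewrite pos_simple.
by rewrite posN ?pos_theta // theta_root.
Qed.

Lemma strip_end : strip m = break_level m - (~~ descends m)%:Z.
Proof.
have rf := fold_root_mem m; rewrite stripE // (mid_last hl) //.
have li : pairing (fold_root m) lambda \is a Num.int by exact: (pairing_lambda_int hl).
rewrite pairingBr floorDrz ?rpredN // floor_pos_x0 // /break_level break_pt_last.
rewrite (@Pi_heightE m) ?break_pt_last ?break_pt_le1 // mul1r floorDrz ?fold_base_int //.
by rewrite -addrA addrC.
Qed.

(** At such a position the pulled back root is [beta i] up to sign, so [mid_before_near] places the
    perturbed path within one unit of the level: above it when descending, below it otherwise. *)
Lemma strip_before i : at_alpha i -> strip i = break_level i - (~~ descends i)%:Z.
Proof.
move=> Ii; have im := ltnW (ltn_ord i); apply/eqP.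
have := break_level_int im; rewrite Ii => /(_ isT).
rewrite (@Pi_heightE i) ?break_pt_le // break_ptS => bE.
have /andP[d0 d1] := mid_before_near hl x0_gt0 x0_lt1 tau_lt i.
rewrite floor_eq fold_aff_pairing; move: Ii bE; rewrite at_alphaE /descends.
have lE : rel_level i * pairing (beta i) lambda = (level i)%:R.
  by rewrite divfK // gt_eqF // beta_lambda_gt0.
case/orP => /eqP->; rewrite ?posN ?beta_pos ?pos_mem ?beta_pos //= ?pairingNl tau_pairing //.
  rewrite lE => bE; rewrite subr0 !rmorphD /= bE; apply/andP; split; lra.
rewrite mulrN lE => bE; rewrite !rmorphD /= rmorphN bE /=; apply/andP; split; lra.
Qed.

Lemma strip_after i : at_alpha i -> strip i.+1 = break_level i - (descends i.+1)%:Z.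
Proof.
move=> Ii; have im := ltnW (ltn_ord i); apply/eqP.
have := break_level_int im; rewrite Ii => /(_ isT).
have bi := ltn_ord i.
rewrite (@Pi_heightE i.+1) ?break_pt_le //.
rewrite break_ptS => bE.
have /andP[d0 d1] := mid_after_near hl x0_gt0 x0_lt1 tau_lt i.
have : (fold_root i.+1 == beta i) || (fold_root i.+1 == - beta i).
  move: Ii; rewrite at_alphaE fold_rootS; case: ifP => // _ /orP[]/eqP->.
    by rewrite refl_self eqxx orbT.
  by rewrite mulmxN refl_self opprK eqxx.
rewrite floor_eq fold_aff_pairing; move: bE; rewrite /descends.
have lE : rel_level i * pairing (beta i) lambda = (level i)%:R.
  by rewrite divfK // gt_eqF // beta_lambda_gt0.
move=> + /orP[] /eqP fE; rewrite fE ?posN ?beta_pos ?pos_mem ?beta_pos //= ?pairingNl tau_pairing //.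
  rewrite lE => bE; rewrite !rmorphD /= bE rmorphN /=; apply/andP; split; lra.
rewrite mulrN lE => bE; rewrite subr0 !rmorphD /= bE; apply/andP; split; lra.
Qed.

(** At time [tau i] the path lies on the hyperplane of position [i], so a fold there does not move
    it; and up to the midpoints on either side no hyperplane of [alpha] is met. *)
Lemma strip_constS i : ~~ at_alpha i -> strip i.+1 = strip i.
Proof.
rewrite at_alphaE negb_or => /andP[n1 n2]; have im := ltnW (ltn_ord i).
have rf := fold_root_mem i; have rf1 := fold_root_mem i.+1.
have [n3 n4] : fold_root i.+1 != beta i /\ fold_root i.+1 != - beta i.
  rewrite fold_rootS; case: ifP => // _.
  have E a : (refl (beta i) *m fold_root i == a) = (fold_root i == refl (beta i) *m a).
    by apply/eqP/eqP => [<-|->]; rewrite mulmxA reflK mul1mx.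
  by rewrite !E mulmxN refl_self opprK.
rewrite !stripE ?ltn_ord // (mid_before hl) // (mid_after hl) //.
rewrite -!floorDrz ?fold_base_int ?ltn_ord // -!fold_aff_pairing fold_affS.
case: ifP => // _; congr (Num.floor (pairing _ (fold_aff A i _))).
by rewrite /aff_refl (tau_pairing hl) subrr mul0r addr0 subrr scale0r subr0.
Qed.

End FoldRules.

(** * Signed levels *)

Lemma bigmax_seqP (R : realDomainType) (T : eqType) (F : T -> R) x (s : seq T) : x \in s ->
  exists2 h, h \in s & F h = \big[Num.max/F x]_(h <- s) F h /\
    forall h', h' \in s -> F h' <= \big[Num.max/F x]_(h <- s) F h.
Proof.
move=> xs.
have [h hs hE] : exists2 h, h \in s & F h = \big[Num.max/F x]_(h <- s) F h.
  have : {subset s <= s} by [].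
  elim: {1 4}s => [|y s' IH] sub; first by exists x; rewrite ?big_nil.
  have [|h hs hE] := IH; first by move=> z zs; apply: sub; rewrite inE zs orbT.
  rewrite big_cons -hE; have [yh|hy] := leP (F y) (F h); first by exists h.
  by exists y; rewrite ?sub ?mem_head.
by exists h => //; split=> // h' hs'; exact: le_bigmax_seq.
Qed.

Section SignedLevels.
Variables (R : realType) (r : nat) (D : root_system R r) (lambda : 'cV[R]_r).
Hypothesis hl : dominant_integral D lambda.
Local Notation m := (size (lambda_chain D lambda)).
Variables (p : affine_index r) (A : {set 'I_m}).
Implicit Types (i j : 'I_m) (a b v : 'cV[R]_r) (q : nat) (t u : R).
Local Notation pos := (pos_root D).
Local Notation rts := (Defs.roots D).
Local Notation alpha := (affine_root D p).

Lemma sgn_rootK a : sgn_root D a * sgn_root D a = 1.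
Proof. by rewrite /sgn_root; case: ifP; rewrite ?mulr1 ?mulrNN ?mulr1. Qed.

Lemma abs_rootN a : a \in rts -> abs_root D (- a) = abs_root D a.
Proof.
move=> ra; rewrite /abs_root /sgn_root posN //.
by case: (pos a); rewrite /= ?scaleN1r ?scale1r ?opprK.
Qed.

Lemma pairing_abs_root a v : pairing (abs_root D a) v = sgn_root D a * pairing a v.
Proof.
rewrite /abs_root /sgn_root; case: ifP => _; first by rewrite scale1r mul1r.
by rewrite scaleN1r pairingNl mulN1r.
Qed.

Lemma hyperplane_inj a (x y : R) : a != 0 -> hyperplane a x = hyperplane a y -> x = y.
Proof.
move=> a0 xy; have : hyperplane a x ((x / 2) *: a).
  by rewrite /hyperplane /= pairingZr pairing_self // divfK ?pnatr_eq0.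
by rewrite xy /hyperplane /= pairingZr pairing_self // divfK ?pnatr_eq0.
Qed.

Lemma Pi_rel_level i : Pi A (rel_level i) = fold_aff A i (- (rel_level i *: lambda)).
Proof.
apply: Pi_piece => //; first exact: ltnW.
  by rewrite -break_ptS break_pt_le // ltnW.
by rewrite break_ptS.
Qed.

Lemma pairing_rel_level i : pairing (beta i) (- (rel_level i *: lambda)) = - (level i)%:R.
Proof. by rewrite pairingNr pairingZr divfK // gt_eqF // beta_lambda_gt0. Qed.

Lemma pairing_gamma_fold i v :
  pairing (gamma A i) (fold_aff A i v) - pairing (gamma A i) (Pi A (rel_level i)) =
  pairing (beta i) v + (level i)%:R.
Proof.
rewrite Pi_rel_level -pairingBr fold_affE [X in _ - X]fold_affE opprD addrACA subrr addr0.
rewrite -mulmxBr gammaE pairing_orth; first by rewrite pairingBr pairing_rel_level opprK.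
exact: weyl_orth (fold_lin_weyl hl A i).
Qed.

(** The image hyperplane passes through [Pi A (rel_level i)], which fixes its level. This identifies
    the levels of the alcove model with heights of the path. *)
Lemma folded_hyperplane i :
  [set aff_prod (before A i) v | v in hyperplane (beta i) (- (level i)%:R)]%classic =
  hyperplane (abs_root D (gamma A i)) (pairing (abs_root D (gamma A i)) (Pi A (rel_level i))).
Proof.
have O := weyl_orth (fold_lin_weyl hl A i).
have key := pairing_gamma_fold i.
apply/seteqP; split=> [_ [v vH <-]|y]; rewrite /hyperplane /= !pairing_abs_root.
  congr (_ * _); apply/eqP; rewrite -subr_eq0 key; move: vH; rewrite /hyperplane /= => ->.
  by rewrite addNr.
move=> /(congr1 (fun z => sgn_root D (gamma A i) * z)); rewrite !mulrA sgn_rootK !mul1r => yE.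
exists ((fold_lin A i)^T *m (y - fold_aff A i 0)); last first.
  by rewrite -/(fold_aff A i _) fold_affE orthKr // subrK.
rewrite /hyperplane /=; apply/eqP; rewrite -subr_eq0 opprK -key.
by rewrite fold_affE orthKr // subrK yE subrr.
Qed.

Lemma signed_level_Some i : i \in I_alpha p A ->
  signed_level p A (Some i) = - (break_level p A i)%:~R.
Proof.
move=> iI; have iI' : at_alpha p A i by rewrite /at_alpha valK.
have := break_level_int hl (p := p) (A := A) (ltnW (ltn_ord i)); rewrite iI' => /(_ isT).
rewrite break_ptS /Pi_height /height => bE.
have gE : abs_root D (gamma A i) = abs_root D alpha.
  move: iI; rewrite inE => /orP[]/eqP-> //; rewrite abs_rootN //.
  exact: affine_root_mem.
rewrite /signed_level /folded_level folded_hyperplane gE pairing_abs_root -bE.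
set z := break_level p A i; pose s : int := if pos alpha then 1 else -1.
have sE : sgn_root D alpha = s%:~R by rewrite /sgn_root /s; case: ifP; rewrite ?rmorphN.
(* [hyperplane_inj] makes the chosen level unique, and [- (s * z)] shows that one exists, so the
   default 0 is not taken. *)
case: xgetP => [l _ /hyperplane_inj|/(_ (- (s * z)))[]]; last first.
  by rewrite /= sE rmorphN opprK rmorphM.
have a0 : abs_root D alpha != 0.
  rewrite /abs_root scaler_eq0 negb_or (root_neq0 (affine_root_mem D p)) andbT.
  by rewrite /sgn_root; case: ifP; rewrite ?oppr_eq0 oner_eq0.
by move=> /(_ a0) lE; rewrite -[l%:~R]opprK lE mulrN mulrA sgn_rootK mul1r.
Qed.

Lemma signed_level_None : signed_level p A None = - (break_level p A m)%:~R.
Proof.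
rewrite break_level_int ?leqnn ?eqxx ?orbT // break_pt_last.
rewrite /signed_level mulrA sgn_rootK mul1r /wt pairingNr; congr (- _).
rewrite /Pi_height /height (@Pi_piece _ _ _ _ hl A m) ?break_pt_last ?break_pt_le1 //.
by rewrite scale1r /fold_aff fold_prefix_full.
Qed.

Definition position (h : option 'I_m) : nat := if h is Some i then i else m.

Lemma position_le h : (position h <= m)%N.
Proof. by case: h => [i|] //=; exact: ltnW. Qed.

Lemma mem_I_hat h : (h \in I_hat p A) = (at_alpha p A (position h) && (h != None)) || (h == None).
Proof.
rewrite mem_rcons inE; case: h => [i|]; last by rewrite !eqxx orbT.
rewrite /= orbF andbT /at_alpha valK /= mem_map ?mem_enum //.
by move=> j k [].
Qed.

Lemma I_hat_positions h : h \in I_hat p A -> at_alpha p A (position h) || (position h == m).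
Proof. by rewrite mem_I_hat; case: h => [i|]; rewrite /= ?andbT ?orbF ?eqxx ?orbT // => ->. Qed.

Lemma positions_I_hat q : (q <= m)%N -> at_alpha p A q || (q == m) ->
  exists2 h, h \in I_hat p A & position h = q.
Proof.
move=> qm; case/orP => [|/eqP->]; last first.
  by exists None; rewrite ?mem_I_hat ?eqxx ?orbT.
move=> qI; have qm' : (q < m)%N.
  rewrite ltn_neqAle qm andbT; apply: contraTneq qI => ->.
  by rewrite /at_alpha insubF // ltnn.
by exists (Some (Ordinal qm')); rewrite // mem_I_hat /= qI.
Qed.

Lemma signed_levelE h : h \in I_hat p A ->
  signed_level p A h = - (break_level p A (position h))%:~R.
Proof.
case: h => [i|]; last by rewrite signed_level_None.
rewrite mem_I_hat /= andbT orbF /at_alpha valK /= => iI.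
exact: signed_level_Some.
Qed.

Lemma I_hat_sorted : sorted ltn [seq position h | h <- I_hat p A].
Proof.
rewrite /I_hat map_rcons -map_comp /= -[rcons _ _]revK rev_sorted rev_rcons /=.
rewrite path_sortedE; last by move=> j k l /= h1 h2; exact: ltn_trans h2 h1.
rewrite all_rev -rev_sorted revK sorted_map enum_sorted andbT.
by apply/allP => _ /mapP[i _ ->] /=.
Qed.

Lemma I_hat_lt (a b : nat) : (a < size (I_hat p A))%N -> (b < size (I_hat p A))%N ->
  (position (nth None (I_hat p A) a) < position (nth None (I_hat p A) b))%N = (a < b)%N.
Proof.
move=> al bl; have srt := I_hat_sorted.
have nE x : (x < size (I_hat p A))%N ->
    position (nth None (I_hat p A) x) = nth m [seq position h | h <- I_hat p A] x.
  by move=> xl; rewrite (nth_map None).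
rewrite !nE //; have lt := sorted_ltn_nth ltn_trans m srt.
apply/idP/idP => [|ab]; last by apply: lt; rewrite ?inE ?size_map.
apply: contraTT; rewrite -!leqNgt leq_eqVlt => /predU1P[->//|ba].
by apply: ltnW; apply: lt; rewrite ?inE ?size_map.
Qed.

End SignedLevels.

(** * The root operator as an exchange of folds *)

Section RootOperator.
Variables (R : realType) (r : nat) (D : root_system R r) (lambda : 'cV[R]_r).
Hypothesis hl : dominant_integral D lambda.
Local Notation m := (size (lambda_chain D lambda)).
Variables (p : affine_index r) (A : {set 'I_m}).
Hypothesis hA : admissible A.
Implicit Types (i j k : 'I_m) (a b v : 'cV[R]_r) (q l : nat) (t u : R).
Local Notation pos := (pos_root D).
Local Notation rts := (Defs.roots D).
Local Notation alpha := (affine_root D p).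
Local Notation at_a q := (at_alpha p A q).
Local Notation lev q := (break_level p A q).
Local Notation dsc q := (descends p A q).
Local Notation T q := (break_pt D lambda q).

Lemma max_levelP : exists mu : int,
  [/\ max_level p A = - mu%:~R,
      exists2 q, (q <= m)%N & (at_a q || (q == m)) /\ lev q = mu &
      forall q, (q <= m)%N -> at_a q || (q == m) -> mu <= lev q].
Proof.
have NI : None \in I_hat p A by rewrite mem_I_hat orbT.
have [h hI [hE hmax]] := bigmax_seqP (signed_level p A) NI.
exists (lev (position h)); split.
- by rewrite -(signed_levelE hl hI).
- by exists (position h); [exact: position_le|split=> //; exact: I_hat_positions].
move=> q qm qI; have [h' h'I <-] := positions_I_hat qm qI.
have := hmax _ h'I; rewrite -hE !(signed_levelE hl) // lerN2 ler_int //.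
Qed.

(** What the comparison of the two paths needs to know of [f_op]. The case [l = m] stands for
    infinity, where nothing is removed from [A]. *)
Record fold_step k l (A' : {set 'I_m}) : Prop := FoldStep {
  step_lt : (k < l)%N;
  step_le : (l <= m)%N;
  step_end : at_a l || (l == m);
  step_start : at_a k;
  step_level : lev k = lev l + 1;
  step_notin : k \notin A;
  step_desc : forall q, (k <= q)%N -> (q <= l)%N -> dsc q;
  step_in : (l < m)%N -> in_fold A l;
  step_first : forall q, (q < l)%N -> at_a q -> lev l < lev q;
  step_min : forall q, (q <= m)%N -> at_a q || (q == m) -> lev l <= lev q;
  step_neg : lev l < - (delta0 p)%:Z;
  step_set : forall j, (j \in A') = (j == k) || ((j \in A) && (j != l :> nat))
}.

Lemma f_opE : (delta0 p)%:R < max_level p A ->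
  exists k l A', f_op p A = Some A' /\ fold_step k l A'.
Proof.
move=> Mgt; have [mu [ME [q0 q0m [q0I q0E]] mumin]] := max_levelP.
have mu_neg : mu < - (delta0 p)%:Z.
  by move: Mgt; rewrite ME ltrNr -(ltr_int R) rmorphN.
pose sI := I_hat p A; pose P h := signed_level p A h == max_level p A.
have hasP_ : has P sI.
  have [h hI hq] := positions_I_hat q0m q0I; apply/hasP; exists h => //.
  by rewrite /P (signed_levelE hl hI) hq q0E ME.
pose n := find P sI; have nlt : (n < size sI)%N by rewrite -has_find.
pose h := nth None sI n; have hI : h \in sI by exact: mem_nth.
have hE : lev (position h) = mu.
  have := nth_find None hasP_; rewrite -/n -/h /P (signed_levelE hl hI) ME.
  by rewrite eqr_opp eqr_int => /eqP.
have hlm := position_le h; have hat := I_hat_positions hI.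
have idx q : at_a q -> (q < m)%N -> exists2 x, (x < size sI)%N & position (nth None sI x) = q.
  move=> qI qm; have [h' h'I <-] := positions_I_hat (ltnW qm) (introT orP (or_introl qI)).
  by exists (index h' sI); rewrite ?index_mem // nth_index.
have first q : (q < position h)%N -> at_a q -> mu < lev q.
  move=> qh qI; have qm := leq_trans qh hlm; have [x xs xq] := idx q qI qm.
  rewrite lt_neqAle mumin ?qI ?(ltnW qm) // andbT eq_sym; apply/negP => /eqP qmu.
  have xn : (x < n)%N by rewrite -(I_hat_lt xs nlt) xq.
  have := before_find None xn; rewrite /P (signed_levelE hl (mem_nth _ xs)) xq qmu ME.
  by rewrite eqxx.
(* The strips of a generic path supply the hypotheses of [minimal_fold], whose conclusion no longer
   mentions the point. *)
have [x0 [x0_gt0 x0_lt1 tau_lt]] := generic_point hl.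
have r1 q : (q < m)%N -> at_a q -> strip p A x0 q = lev q - (~~ dsc q)%:Z.
  by move=> qm; exact: (strip_before hl x0_gt0 x0_lt1 tau_lt (i := Ordinal qm)).
have r2 q : (q < m)%N -> at_a q -> strip p A x0 q.+1 = lev q - (dsc q.+1)%:Z.
  by move=> qm; exact: (strip_after hl x0_gt0 x0_lt1 tau_lt (i := Ordinal qm)).
have r3 q : (q < m)%N -> at_a q -> dsc q.+1 = dsc q (+) in_fold A q.
  by move=> qm; exact: (descends_fold hl (i := Ordinal qm)).
have r4 q : (q < m)%N -> ~~ at_a q -> strip p A x0 q.+1 = strip p A x0 q.
  by move=> qm; exact: (strip_constS hl x0_gt0 x0_lt1 tau_lt (i := Ordinal qm)).
have r5 q : (q < m)%N -> ~~ at_a q -> dsc q -> dsc q.+1.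
  by move=> qm; exact: (descends_homo hl hA (i := Ordinal qm)).
have [kk [kl kI [nI klev kd kA] desc lin]] := minimal_fold
  (strip_start hl p A x0_gt0 x0_lt1 tau_lt) (strip_end hl p A x0_gt0 x0_lt1 tau_lt)
  r1 r2 r3 r4 r5 mumin hlm hat hE first mu_neg.
have km := leq_trans kl hlm; have [x xs xk] := idx kk kI km.
have xn : (x < n)%N by rewrite -(I_hat_lt xs nlt) xk.
have n0 : (0 < n)%N by exact: leq_ltn_trans xn.
have n1n : (n.-1 < n)%N by rewrite prednK.
(* An entry of [I_hat] strictly between [k] and [h] would be a position of [I_alpha] inside a gap
   that has none. *)
have xpred : x = n.-1.
  apply/eqP; rewrite eqn_leq -ltnS prednK // xn /= leqNgt.
  apply/negP => xlt.
  have n1s := ltn_trans n1n nlt; pose g := nth None sI n.-1.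
  have kg : (kk < position g)%N by rewrite -xk (I_hat_lt xs n1s).
  have gh : (position g < position h)%N by rewrite (I_hat_lt n1s nlt).
  have gI := I_hat_positions (mem_nth None n1s); case/negP: (nI _ kg gh).
  by move: gI; rewrite (ltn_eqF (leq_trans gh hlm)) orbF.
pose k := Ordinal km.
have nk : nth None sI n.-1 = Some k.
  rewrite -xpred; move: xk; case: (nth None sI x) => [j|] /= E.
    by congr Some; apply: val_inj.
  by have := km; rewrite -E ltnn.
exists k, (position h), (k |: (if h is Some j then A :\ j else A))%SET; split.
  by rewrite /f_op Mgt -/sI -/P -/n -/h nk.
split=> //; first by rewrite hE.
- by move: kA; rewrite /in_fold -[kk]/(val k) valK.
- move=> q; rewrite leq_eqVlt => /predU1P[<- //|]; exact: desc.
- by rewrite hE.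
- by rewrite hE.
- by rewrite hE.
move=> j; rewrite !inE; congr (_ || _); case: h {hI hE hlm hat first desc lin nI kl} => [i|] /=.
  by rewrite in_setD1 andbC -(inj_eq val_inj).
by rewrite (ltn_eqF (ltn_ord j)) andbT.
Qed.

End RootOperator.

(** * Effect of the exchange of folds on the path *)

Section FoldExchange.
Variables (R : realType) (r : nat) (D : root_system R r) (lambda : 'cV[R]_r).
Hypothesis hl : dominant_integral D lambda.
Local Notation m := (size (lambda_chain D lambda)).
Variables (p : affine_index r) (A : {set 'I_m}).
Implicit Types (i j : 'I_m) (a b v : 'cV[R]_r) (q : nat) (t u : R).
Local Notation alpha := (affine_root D p).
Local Notation at_a q := (at_alpha p A q).
Local Notation lev q := (break_level p A q).
Local Notation T q := (break_pt D lambda q).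

Lemma aff_reflNN a (c : R) v : aff_refl (- a) (- c) v = aff_refl a c v.
Proof. by rewrite /aff_refl pairingNl opprK scalerN -scaleNr opprD opprK. Qed.

(** Conjugating by the earlier folds turns the reflection at [i] into the one in the image
    hyperplane, which is the hyperplane of [alpha] through [Pi A (rel_level i)]. *)
Lemma fold_aff_refl i v : at_a i ->
  fold_aff A i (aff_refl (beta i) (- (level i)%:R) v) =
  aff_refl alpha (lev i)%:~R (fold_aff A i v).
Proof.
move=> iI; have E : fold_aff A i (aff_refl (beta i) (- (level i)%:R) v) =
    aff_refl (gamma A i) (pairing (gamma A i) (Pi A (rel_level i))) (fold_aff A i v).
  rewrite /aff_refl pairing_gamma_fold // opprK fold_affE [in RHS]fold_affE.
  by rewrite mulmxBr -scalemxAr -gammaE addrAC.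
have -> : (lev i)%:~R = pairing alpha (Pi A (rel_level i)).
  by rewrite (break_level_int hl) ?iI ?(ltnW (ltn_ord i)) // break_ptS.
rewrite E; move: iI; rewrite /at_alpha valK /= inE => /orP[]/eqP-> //.
by rewrite pairingNl aff_reflNN.
Qed.

Lemma aff_reflK a (c : R) v : a != 0 -> aff_refl a c (aff_refl a c v) = v.
Proof.
move=> a0; rewrite /aff_refl pairingBr pairingZr pairing_self //.
rewrite -addrA -opprD -scalerDl.
by rewrite [X in X *: _](_ : _ = 0) ?scale0r ?subr0 //; ring.
Qed.

Lemma aff_refl_shift a (c : R) v : a != 0 ->
  aff_refl a (c + 1) (aff_refl a c v) = v + a.
Proof.
move=> a0; rewrite /aff_refl pairingBr pairingZr pairing_self //.
rewrite -addrA -opprD -scalerDl -scaleNr.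
by rewrite [X in X *: _](_ : _ = 1) ?scale1r //; ring.
Qed.

Variables (k : 'I_m) (l : nat) (A' : {set 'I_m}).
Hypothesis st : fold_step p A k l A'.

Lemma alpha_neq0 : alpha != 0.
Proof. exact/(root_neq0 (D := D))/affine_root_mem. Qed.

Lemma step_before q v : (q <= k)%N -> fold_aff A' q v = fold_aff A q v.
Proof.
elim: q v => [|q IH] v qk; first by rewrite !fold_aff0.
have qm := ltn_trans qk (ltn_ord k); rewrite -[q]/(val (Ordinal qm)) !fold_affS.
rewrite (step_set st) IH; last exact: ltnW.
by rewrite -(inj_eq val_inj) /= (ltn_eqF qk) (ltn_eqF (ltn_trans qk (step_lt st))) andbT.
Qed.

Lemma step_between q v : (k < q)%N -> (q <= l)%N ->
  fold_aff A' q v = aff_refl alpha (lev l + 1)%:~R (fold_aff A q v).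
Proof.
elim: q v => [//|q IH] v; rewrite ltnS leq_eqVlt => /predU1P[<- kl|kq ql].
  rewrite !fold_affS (step_set st) eqxx /= (negPf (step_notin st)).
  by rewrite step_before // fold_aff_refl ?(step_start st) // (step_level st).
have qm := leq_trans ql (step_le st); rewrite -[q]/(val (Ordinal qm)) !fold_affS.
rewrite (step_set st) IH //; last exact: ltnW.
by rewrite -(inj_eq val_inj) /= (gtn_eqF kq) (ltn_eqF ql) andbT.
Qed.

(** Dropping the fold at [l] inserts a reflection at level [lev l] next to the one at [lev l + 1]
    inserted at [k]. Two parallel reflections one unit apart compose to the translation by
    [alpha]. *)
Lemma step_after q v : (l < q)%N -> (q <= m)%N ->
  fold_aff A' q v = fold_aff A q v + alpha.
Proof.
elim: q v => [//|q IH] v; rewrite ltnS leq_eqVlt => /predU1P[lq|lq] qm.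
  have lm : (l < m)%N by rewrite lq.
  have la : at_a l by have := step_end st; rewrite (ltn_eqF lm) orbF.
  have lA : Ordinal lm \in A by have := step_in st lm; rewrite -[l]/(val (Ordinal lm)) in_foldE.
  have E : fold_aff A l v = aff_refl alpha (lev l)%:~R (fold_aff A l.+1 v).
    rewrite -[l in fold_aff A l.+1]/(val (Ordinal lm)) fold_affS lA fold_aff_refl //.
    by rewrite aff_reflK // alpha_neq0.
  rewrite -lq -[l in LHS]/(val (Ordinal lm)) fold_affS (step_set st) /= eqxx andbF orbF.
  rewrite -(inj_eq val_inj) /= (gtn_eqF (step_lt st)) step_between ?(step_lt st) // E.
  by rewrite rmorphD /= aff_refl_shift // alpha_neq0.
rewrite -[q]/(val (Ordinal qm)) !fold_affS (step_set st) IH //; last exact: ltnW.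
rewrite -(inj_eq val_inj) /= (gtn_eqF (ltn_trans (step_lt st) lq)) (gtn_eqF lq).
by rewrite andbT.
Qed.

Lemma Pi_before t : t <= T k.+1 -> Pi A' t = Pi A t.
Proof.
move=> tk; have [t0|t0] := leP t 0; first by rewrite !(Pi_lt0 hl).
have t1 : t <= 1 by apply: le_trans tk _; exact: break_pt_le1.
have [q qm /andP[qt tq]] := break_pt_locate D lambda (ltW t0) t1.
have [qk|kq] := leqP q k; first by rewrite !(Pi_piece hl _ qm qt tq) step_before.
(* Several positions may share a time: a piece beyond [k] can contain [t] only if [t] is the common
   end, which also belongs to piece [k]. *)
have tE : t = T k.+1 by apply: le_anti; rewrite tk (le_trans _ qt) // break_pt_mono // leqW.
have km := ltnW (ltn_ord k).
rewrite !(Pi_piece hl _ km) ?step_before ?tE //; by apply: break_pt_le.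
Qed.

Lemma Pi_between t : T k.+1 <= t -> t <= T l.+1 ->
  Pi A' t = aff_refl alpha (lev l + 1)%:~R (Pi A t).
Proof.
move=> kt tl; have kl := step_lt st; have lm := step_le st.
have t0 : 0 <= t by apply: le_trans kt; apply: break_pt_ge0 => //; exact/leqW/ltn_ord.
have t1 : t <= 1 by apply: le_trans tl _; exact: break_pt_le1.
have [q qm /andP[qt tq]] := break_pt_locate D lambda t0 t1.
have piece x : (x <= m)%N -> (k < x)%N -> (x <= l)%N -> T x <= t -> t <= T x.+1 ->
    Pi A' t = aff_refl alpha (lev l + 1)%:~R (Pi A t).
  by move=> xm kx xl xt tx; rewrite !(Pi_piece hl _ xm xt tx) step_between.
have [qk|kq] := leqP q k.
  have tE : t = T k.+1.
    by apply: le_anti; rewrite kt (le_trans tq) // break_pt_mono // ltnS ltnW.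
  apply: (piece k.+1) => //; rewrite tE; apply: break_pt_le => //.
have [ql|lq] := leqP q l; first exact: (piece q).
have tE : t = T l.+1.
  by apply: le_anti; rewrite tl (le_trans _ qt) // break_pt_mono // leqW.
by apply: (piece l) => //; rewrite tE; apply: break_pt_le.
Qed.

Lemma Pi_after t : T l.+1 <= t -> (l < m)%N -> t <= 1 -> Pi A' t = Pi A t + alpha.
Proof.
move=> lt lm t1; have t0 : 0 <= t by apply: le_trans lt; apply: break_pt_ge0 => //; exact: leqW.
have [q qm /andP[qt tq]] := break_pt_locate D lambda t0 t1.
have [ql|lq] := leqP q l; last by rewrite !(Pi_piece hl _ qm qt tq) step_after.
have tE : t = T l.+1.
  by apply: le_anti; rewrite lt (le_trans tq) // break_pt_mono // ltnS ltnW.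
have lt2 : t <= T l.+2 by rewrite tE; apply: break_pt_le.
by rewrite !(Pi_piece hl _ lm lt lt2) step_after.
Qed.

End FoldExchange.

(** * Comparison of the root operators *)

Section Comparison.
Variables (R : realType) (r : nat) (D : root_system R r) (lambda : 'cV[R]_r).
Hypothesis hl : dominant_integral D lambda.
Local Notation m := (size (lambda_chain D lambda)).
Variables (p : affine_index r) (A : {set 'I_m}).
Hypothesis hA : admissible A.
Implicit Types (i j : 'I_m) (a b v : 'cV[R]_r) (q : nat) (t u : R).
Local Notation alpha := (affine_root D p).
Local Notation at_a q := (at_alpha p A q).
Local Notation lev q := (break_level p A q).
Local Notation dsc q := (descends p A q).
Local Notation T q := (break_pt D lambda q).
Local Notation H := (Pi_height p A).

Definition alpha_break u : Prop := exists2 i : 'I_m, at_a i & u = rel_level i.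

Lemma pairing_fold_root q : if dsc q then 0 <= pairing (fold_root p A q) lambda
  else pairing (fold_root p A q) lambda <= 0.
Proof.
have rf := fold_root_mem hl p A q.
have dom (e : 'I_r) : 0 <= pairing (simple D e) lambda by exact/natr_ge0/hl.
case: ifP => d; first exact: pairing_dominant_ge0 dom d.
rewrite -oppr_ge0 -pairingNl; apply: pairing_dominant_ge0 dom _.
by rewrite posN //; move: d; rewrite /descends => ->.
Qed.

Lemma Pi_height_descends q : (q <= m)%N -> dsc q -> nonincreasing_on H (T q) (T q.+1).
Proof.
move=> qm d x y qx xy yq; have := pairing_fold_root q; rewrite d => P0.
rewrite !(Pi_heightE hl p A qm) ?(le_trans qx xy) ?(le_trans xy yq) //.
by rewrite lerD2r lerN2 ler_wpM2r.
Qed.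

Lemma Pi_height_ascends q x y : (q <= m)%N -> ~~ dsc q -> T q <= x -> x <= y ->
  y <= T q.+1 -> H x <= H y.
Proof.
move=> qm d qx xy yq; have := pairing_fold_root q; rewrite (negPf d) => P0.
rewrite !(Pi_heightE hl p A qm) ?(le_trans qx xy) ?(le_trans xy yq) //.
by rewrite lerD2r lerN2 ler_wnM2r.
Qed.

Lemma Pi_height_valleys : valleys_in alpha_break H 0 1.
Proof.
have <- : T m.+1 = 1 by exact: break_pt_last.
apply: (valleys_pieces (break_pt_le hl) (dec := descends p A)).
- exact: Pi_height_descends.
- exact: Pi_height_ascends.
move=> q qm d nd; exists (Ordinal qm); last by rewrite -break_ptS.
by apply: contraT => nI; case/negP: nd; exact: (descends_homo hl hA (i := Ordinal qm)).
Qed.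

Lemma Pi_height_lipschitz : exists C, lipschitz_on H 0 1 C.
Proof.
exists (\sum_(q < m.+1) `|pairing (fold_root p A q) lambda|).
have <- : T m.+1 = 1 by exact: break_pt_last.
apply: (lipschitz_pieces (T := break_pt D lambda)) => q qm x y qx xy yq.
rewrite !(Pi_heightE hl p A qm) ?(le_trans qx xy) ?(le_trans xy yq) //.
set P := pairing _ lambda; set B := fold_base _ _ _.
have -> : - (y * P) + B - (- (x * P) + B) = - (P * (y - x)) by ring.
rewrite normrN normrM (ger0_norm (_ : 0 <= y - x)) ?subr_ge0 // ler_wpM2r ?subr_ge0 //.
rewrite (bigD1 (Ordinal (qm : (q < m.+1)%N))) //= lerDl sumr_ge0 //.
Qed.

Lemma alpha_break_level u : alpha_break u ->
  exists2 i : 'I_m, at_a i & u = T i.+1 /\ H u = (lev i)%:~R.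
Proof.
case=> i iI ->; exists i => //; rewrite (break_level_int hl) ?iI ?(ltnW (ltn_ord i)) //.
by rewrite break_ptS.
Qed.

Lemma Pi_height0 : H 0 = 0.
Proof. by rewrite /Pi_height /height (Pi_lt0 hl) // pairing0r. Qed.

Lemma Pi_height1 : H 1 = (lev m)%:~R.
Proof. by rewrite (break_level_int hl) ?eqxx ?orbT // break_pt_last. Qed.

Lemma Pi_integral_valleys : integral_valleys D p (Pi A).
Proof.
split; first exact: Pi_height0.
- by rewrite -/(H 1) Pi_height1 intr_int.
- exact: Pi_height_lipschitz.
move=> s v s0 sv v1; have [u [su uv umin Qu]] := Pi_height_valleys s0 sv v1.
exists u; split=> //; case: Qu => [/alpha_break_level[i _ [_ hu]]|?|?].
- by apply: Or31; rewrite -/(H u) hu intr_int.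
- exact: Or32.
- exact: Or33.
Qed.

Lemma Pi_height_ge (mu : int) :
  (forall q, (q <= m)%N -> at_a q || (q == m) -> mu <= lev q) -> mu <= 0 ->
  forall t, 0 <= t -> t <= 1 -> mu%:~R <= H t.
Proof.
move=> mumin mu0 t t0 t1.
have [u [_ _ umin Qu]] := Pi_height_valleys (lexx 0) ler01 (lexx 1).
apply: le_trans (umin t t0 t1); case: Qu => [/alpha_break_level[i iI [_ ->]]|->|->].
- by rewrite ler_int mumin ?iI ?(ltnW (ltn_ord i)).
- by rewrite Pi_height0 lerz0.
- by rewrite Pi_height1 ler_int mumin ?eqxx ?orbT.
Qed.

(** The initial height 0 is not among the levels, so [mu] can be positive; the minimum of the height
    is then reached at time 0 and [epsilon] vanishes. *)
Lemma Pi_epsilon (mu : int) : max_level p A = - mu%:~R ->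
  (exists2 q, (q <= m)%N & (at_a q || (q == m)) /\ lev q = mu) ->
  (forall q, (q <= m)%N -> at_a q || (q == m) -> mu <= lev q) ->
  epsilon D p (Pi A) = if mu <= 0 then `|mu|%N else 0%N.
Proof.
move=> ME [q qm [qI qmu]] mumin; apply: epsilonE; first exact: Pi_integral_valleys.
case: ifP => mu0.
  apply: (@height_minE _ _ _ _ _ _ (T q.+1)).
  - by apply: break_pt_ge0.
  - exact: break_pt_le1.
  - rewrite -/(H _) -(break_level_int hl) // qmu natr_absz ler0_norm //.
    by rewrite rmorphN opprK.
  move=> t t0 t1; rewrite natr_absz ler0_norm // rmorphN opprK.
  exact: Pi_height_ge.
apply: (@height_minE _ _ _ _ _ _ 0) => //; first by rewrite -/(H 0) Pi_height0 oppr0.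
move=> t t0 t1; rewrite oppr0 -(mulr0z 1) -/(0%:~R); apply: Pi_height_ge => // x xm xI.
by apply: le_trans (mumin x xm xI); rewrite ltW // ltNge mu0.
Qed.

Lemma f_op_epsilon : f_op p A <> None <-> (delta0 p < epsilon D p (Pi A))%N.
Proof.
have [mu [ME muq mumin]] := max_levelP hl p A.
rewrite (Pi_epsilon ME muq mumin) /f_op ME.
have -> : ((delta0 p)%:R < - mu%:~R :> R) = (mu < - (delta0 p)%:Z).
  by rewrite ltrNr -[RHS](ltr_int R) rmorphN.
case: ifP => [lt|nlt]; split=> //.
  by move=> _; case: ifP; lia.
by case: ifP; move: nlt; lia.
Qed.

Lemma f_op_e_op : f_op p A <> None -> e_op D p (Pi A) = omap (@Pi R r D lambda) (f_op p A).
Proof.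
move=> fN; have Mgt : (delta0 p)%:R < max_level p A.
  by move: fN; rewrite /f_op; case: ifP.
have [k [l [A' [-> st]]]] := f_opE hl hA Mgt; rewrite /=.
pose mu := lev l; have kl := step_lt st; have lm := step_le st.
have mu_lt : mu < 0 by apply: lt_le_trans (step_neg st) _; rewrite oppr_le0.
have km : (k.+1 <= m.+1)%N by exact/leqW/ltn_ord.
have Hk : H (T k.+1) = mu%:~R + 1.
  by rewrite -(break_level_int hl) ?(step_start st) ?(ltnW (ltn_ord k)) // (step_level st) rmorphD.
have Hl : H (T l.+1) = mu%:~R by rewrite -(break_level_int hl) // (step_end st).
have Hge t : 0 <= t -> t <= 1 -> mu%:~R <= H t.
  by apply: Pi_height_ge; [exact: step_min st|exact: ltW].
have Tk0 : 0 <= T k.+1 by exact: break_pt_ge0.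
have Tk1 : T k.+1 <= 1 by exact: break_pt_le1.
have Tl1 : T l.+1 <= 1 by exact: break_pt_le1.
(* Positions before [l] have level at least [mu + 1]. A later one can only matter if its time
   coincides with [T k.+1], where the height is known. *)
have Hge_k t : 0 <= t -> t <= T k.+1 -> mu%:~R + 1 <= H t.
  move=> t0 tk; have [u [_ uk umin Qu]] := Pi_height_valleys (lexx 0) Tk0 Tk1.
  apply: le_trans (umin t t0 tk); case: Qu => [/alpha_break_level[i iI [uE ->]]|->|->].
  - have [il|li] := ltnP i l.
      by rewrite -(intrD _ _ 1) ler_int lezD1 (step_first st).
    have uk' : u = T k.+1.
      by apply: le_anti; rewrite uk uE break_pt_mono // ltnS ltnW // (leq_trans kl).
    rewrite -Hk -uk' uE (break_level_int hl) ?iI ?(ltnW (ltn_ord i)) //.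
  - by rewrite Pi_height0 -(intrD _ _ 1) lerz0 lezD1.
  - by rewrite Hk.
have dec : nonincreasing_on H (T k.+1) (T l.+1).
  apply: (nonincreasing_pieces (n := m)) => // [|q kq ql]; first by rewrite ltnS ltnW.
  by apply: Pi_height_descends; [exact: leq_trans lm|apply: (step_desc st) => //; exact: ltnW].
have Tkl : T k.+1 <= T l.+1 by apply: break_pt_mono => //; rewrite ltnS ltnW.
have [C lipH] := Pi_height_lipschitz.
have lip (x1 x2 : R) : 0 <= x1 -> x2 <= 1 -> lipschitz_on H x1 x2 C.
  by move=> a0 b1 x y ax xy yb; apply: lipH => //; [exact: le_trans ax|exact: le_trans b1].
have [||t1 [kt1 t1l Ht1 first]] := first_time (c := mu%:~R) (lip _ _ Tk0 Tl1) Tkl.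
- by rewrite Hl.
- by rewrite Hk lerDl.
have t10 : 0 <= t1 by exact: le_trans kt1.
have t11 : t1 <= 1 by exact: le_trans Tl1.
have [||t0 [kt0 t01 Ht0 last]] := last_time (c := mu%:~R + 1) (lip _ _ Tk0 t11) kt1.
- by rewrite Ht1 lerDl.
- by rewrite Hk.
have -> : e_op D p (Pi A) = Some (reflected_path D p (Pi A) t0 t1).
  apply: (e_opE (m := mu%:~R)) => //; first exact: le_trans kt0.
  - by rewrite intr_eq0 lt_eqF.
  - move=> x x0 xt; have [xk|/ltW kx] := leP x (T k.+1); last exact: first.
    by apply: lt_le_trans (Hge_k _ x0 xk); rewrite ltrDl.
have HE t : pairing alpha (Pi A t) = H t by [].
(* From [t1] to [T l.+1] the height stays at [mu], where the reflection at level [mu + 1] acts as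
   the translation by [alpha]. If [l = m], nothing remains after [T l.+1]. *)
have Pi_shift t : t1 <= t -> t <= 1 -> Pi A' t = Pi A t + alpha.
  move=> tt t1'; have [tl|lt] := leP t (T l.+1).
    have ht : H t = mu%:~R.
      apply: le_anti; rewrite Hge ?(le_trans t10 tt) // andbT -Ht1.
      exact: dec.
    rewrite (Pi_between hl st (le_trans kt1 tt) tl) /aff_refl HE ht rmorphD /=.
    by rewrite opprD addNKr scaleN1r opprK.
  have [lm'|ml] := ltnP l m; first by apply: (Pi_after hl st) => //; exact: ltW.
  have lE : l = m by apply/eqP; rewrite eqn_leq lm ml.
  by move: lt; rewrite lE break_pt_last ltNge t1'.
congr Some; apply/funext => t; rewrite /reflected_path.
case: ifP => [tt0|/negbT]; last rewrite -ltNge => t0t.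
  have [tk|/ltW kt] := leP t (T k.+1); first by rewrite (Pi_before hl st).
  (* Between [T k.+1] and [t0] the path stays on the hyperplane of the reflection, which therefore
     fixes it. *)
  have ht : H t = mu%:~R + 1.
    have t0l := le_trans t01 t1l.
    apply/le_anti/andP; split; [rewrite -Hk|rewrite -Ht0]; apply: dec => //.
    exact: le_trans t0l.
  rewrite (Pi_between hl st kt) ?(le_trans tt0) ?(le_trans t01) // /aff_refl HE ht.
  by rewrite rmorphD /= subrr scale0r subr0.
have kt := le_trans kt0 (ltW t0t).
case: ifP => [tt1|/negbT]; last rewrite -ltNge => t1t.
  rewrite (Pi_between hl st kt) ?(le_trans tt1) // /aff_refl affine_reflE reflE.
  rewrite pairingBr !HE Ht0 rmorphD /=.
  by rewrite addrA [_ + (_ - _)]addrC subrK.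
have [t_1|/ltW lt1] := leP t 1; first by rewrite Pi_shift // ltW.
by rewrite !(Pi_gt1 hl _ lt1) Pi_shift.
Qed.
End Comparison.

Theorem theorem6p11 (R : realType) (r : nat) (D : root_system R r)
    (lambda : 'cV[R]_r) (hlambda : dominant_integral D lambda)
    (p : affine_index r) (A : {set 'I_(size (lambda_chain D lambda))})
    (hA : admissible A) :
  (f_op p A <> None <-> (delta0 p < epsilon D p (Pi A))%N) /\
  (f_op p A <> None -> e_op D p (Pi A) = omap (@Pi R r D lambda) (f_op p A)).
Proof. by split; [exact: f_op_epsilon | exact: f_op_e_op]. Qed.
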